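(* For real $P\ge 2$ one has $$N_{\mathrm{glob}}(P)=\#S(P)+O\left(\frac{P^3}{\log P}\right)=\frac{864}{\pi^6}P^3+O\left(\frac{P^3}{\log P}\right),$$ with absolute implied constants. In particular, asymptotically 100% of the varieties $Y_{a,b,c}$ with $(a,b,c)\in S(P)$ have a $\mathbb{Q}$-point, i.e. $N_{\mathrm{glob}}(P)/\#S(P)\to 1$ as $P\to\infty$.
   Context: Let $S$ be the set of triples $(a,b,c)$ of nonzero integers such that each of $a$, $b$, $c$ is squarefree and $c>0$ ($a$ and $b$ may be negative). For $(a,b,c)\in S$ let $Y=Y_{a,b,c}\subset\mathbb{A}^6_{\mathbb{Q}}$ be the affine variety defined by $$(x^2-ay^2)(z^2-bt^2)(u^2-abw^2)=c$$ in the variables $x,y,z,t,u,w$. For $P\ge 1$ put $S(P)=\{(a,b,c)\in S:\max\{|a|,|b|,c\}\le P\}$ and $$N_{\mathrm{glob}}(P)=\#\{(a,b,c)\in S(P): Y_{a,b,c}(\mathbb{Q})\ne\emptyset\}.$$ *)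

(* Defs.v *)
From mathcomp Require Import all_boot all_order all_algebra finmap.
From mathcomp Require Import all_classical all_reals all_analysis.

Set Implicit Arguments.
Unset Strict Implicit.
Unset Printing Implicit Defensive.

Import Order.TTheory GRing.Theory Num.Theory.
Local Open Scope classical_set_scope.
Local Open Scope ring_scope.

Definition squarefree (n : int) : Prop :=
  forall d : int, (d ^+ 2 %| n)%Z -> d \is a GRing.unit.

Definition triples : set (int * int * int) :=
  [set abc | let: (a, b, c) := abc in
    [/\ a != 0, b != 0 & c != 0] /\
    [/\ squarefree a, squarefree b & squarefree c] /\
    0 < c].

Definition Y_points (a b c : int) (K : fieldType) :
    set (K * K * K * K * K * K) :=
  [set p | let: (x, y, z, t, u, w) := p in
    (x ^+ 2 - a%:~R * y ^+ 2) * (z ^+ 2 - b%:~R * t ^+ 2)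
      * (u ^+ 2 - (a * b)%:~R * w ^+ 2) = c%:~R].
Arguments Y_points : clear implicits.

Section Counting.
Variable R : realType.

Definition triples_le (P : R) : set (int * int * int) :=
  [set abc | triples abc /\
    let: (a, b, c) := abc in
    (Num.max (Num.max `|a| `|b|) c)%:~R <= P].

Lemma finite_triples_le (P : R) : finite_set (triples_le P).
Proof.
pose n := Num.truncn P.
pose s := [seq i%:Z | i <- iota 0 n.+1] ++ [seq - i%:Z | i <- iota 0 n.+1].
have sP (i : int) : `|i|%:~R <= P -> i \in s.
  rewrite -abszE -pmulrn => iP.
  have ni : (`|i|%N <= n)%N.
    by rewrite /n truncn_ge_nat// (le_trans _ iP).
  have h : `|i|%N \in iota 0 n.+1 by rewrite mem_iota.
  rewrite mem_cat; apply/orP; case: (leP 0 i) => i0; [left|right].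
    by rewrite -[i]gez0_abs//; exact: (map_f Posz).
  rewrite -[i]opprK -(ltz0_abs i0).
  exact: (map_f (fun i : nat => - i%:Z)).
clearbody s; apply: (sub_finite_set (B :=
  [set` [seq (ab, c) | ab <- [seq (a, b) | a <- s, b <- s], c <- s]])).
  move=> [[a b] c] [[_ [_ c0]]] /= h.
  have le3 (x : int) : x <= Num.max (Num.max `|a| `|b|) c -> x%:~R <= P.
    by move=> xm; apply: le_trans h; rewrite ler_int.
  have [sa sb sc] : [/\ a \in s, b \in s & c \in s].
    by split; apply: sP; apply: le3; rewrite ?(gtr0_norm c0) !le_max lexx ?orbT.
  apply/allpairsP; exists ((a, b), c); split=> //=.
  by apply/allpairsP; exists (a, b).
exact: finite_seq.
Qed.

(* [fset_set] is empty on infinite sets; [finite_triples_le] rules that out. *)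
Definition card_triples (P : R) : nat := #|` fset_set (triples_le P)|.

Definition N_glob (P : R) : nat :=
  #|` fset_set [set abc | triples_le P abc /\
    let: (a, b, c) := abc in Y_points a b c rat !=set0]|.

End Counting.

(* Main.v *)
Require Import Defs.
From mathcomp Require Import all_boot all_order all_algebra all_fingroup all_solvable all_field finmap.
From mathcomp Require Import all_classical all_reals all_analysis.
From mathcomp Require Import ring lra zify.

Set Implicit Arguments.
Unset Strict Implicit.
Unset Printing Implicit Defensive.

Import Order.TTheory GRing.Theory Num.Theory.
Import numFieldNormedType.Exports.
Local Open Scope classical_set_scope.
Local Open Scope ring_scope.

(** A positive integer [c] is represented by the equation exactly when it is a product of norms from
Q(sqrt a), Q(sqrt b) and Q(sqrt (a b)); call this [normG a b c]. For fixed [a, b] the nonzero such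
[c] form a group containing the squares. The theorem rests on three facts.

One odd prime suffices. Let [p] be an odd prime dividing [a] but not [b], modulo which [b] is a
non-residue, or the same with [a] and [b] exchanged. Then every [c > 0] is such a product
([normG_of_noncyclic_prime]). Conceptually, the local extension generated by both square roots is
not cyclic at [p], so the only global obstruction disappears. The elementary argument runs as
follows. Modulo norms, [c] may be taken squarefree and prime to [2 a b]. Its primes fall into
three classes, [c = ca * cb * ce]: those split by sqrt a, those among the others split by sqrt b,
and the rest, which sqrt (a b) splits. Pick primes [r] and [t] such that [r * ca] is a norm from
Q(sqrt a), [t * cb] one from Q(sqrt b) and [r * t * ce] one from Q(sqrt (a b)); then [c] is a
product of the three up to squares. By Legendre's theorem ([legendre]) this asks only for
prescribed values of quadratic symbols at [r] and [t] ([normG_core]). Such primes exist by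
Dirichlet's theorem for real characters ([dirichlet_signs]), proved here through the
non-vanishing of [L(1, chi)] and Shapiro's estimate. Quadratic reciprocity makes the conditions
compatible as soon as a multiplicative sign [phi] of [c] has a certain value. The prime [p]
provides a product of norms [h] with [phi h = -1] ([phi_flip]), so that [c] or [c * h] has the
right sign.

Pairs without such a prime are rare. Each odd prime [p] excludes a proportion of about [1 / p] of
the pairs modulo [p ^ 2], and a large sieve leaves [O (X ^ 2 / ln X)] exceptional pairs
([exceptional_count]); they account for at most [O (P ^ 3 / ln P)] triples ([pointless_bound]).

The number of squarefree integers up to [n] is [6 / pi ^ 2 * n + O (n / ln n)] ([sqf_err_le]), by
induction from the unique decomposition of an integer as a squarefree number times a square and
from Euler's value of [\sum 1 / k ^ 2] ([basel]). The number of triples is four times the cube of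
this count. *)

(** * Legendre symbols and quadratic reciprocity *)

(** Euler's criterion: when the half power is 1, the exponent of [x] with respect to a generator
    of the cyclic unit group is even. *)
Lemma finField_half_exp (F : finFieldType) (x : F) : odd #|F| -> x != 0 ->
  x ^+ (#|F|.-1)./2 = if [exists y : F, y ^+ 2 == x] then 1 else -1.
Proof.
move=> oF x0; set m := (_)./2.
have q2m : #|F|.-1 = (m * 2)%N.
  by rewrite /m muln2 -[LHS]odd_double_half -subn1 oddB ?oF// (ltnW (finNzRing_gt1 F)).
have pow1 (y : F) : y != 0 -> y ^+ (m * 2) = 1.
  move=> y0; rewrite -q2m; apply: (mulIf y0); rewrite -exprSr mul1r prednK ?expf_card//.
  exact: ltnW (finNzRing_gt1 F).
have m0 : (0 < m)%N by case: (m) q2m (finNzRing_gt1 F) => //; case: #|F| => [|[]].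
have pm : (x ^+ m == 1) || (x ^+ m == -1) by rewrite -sqrf_eq1 -exprM pow1.
case: existsP => [[y /eqP yx]|nex].
  rewrite -yx -exprM mulnC pow1//; apply: contra_neq x0 => y0.
  by rewrite -yx y0 expr0n.
case/orP: pm => /eqP // xm; case: nex.
have [g gen] := cyclicP (field_unit_group_cyclic [group of [set: {unit F}]]).
have ux : x \is a GRing.unit by rewrite unitfE.
have [k kE] : exists k, FinRing.Unit ux = (g ^+ k)%g.
  by apply/cycleP; rewrite -gen inE.
have xE : x = (val g) ^+ k by rewrite -FinRing.val_unitX -kE.
have og : #[g]%g = (m * 2)%N by rewrite orderE -gen card_finField_unit q2m.
have : (#[g]%g %| k * m)%N.
  rewrite order_dvdn; apply/eqP; apply: val_inj => /=.
  by rewrite FinRing.val_unitX exprM -xE xm.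
rewrite og mulnC dvdn_pmul2r// => /dvdnP[j jE].
by exists ((val g) ^+ j); rewrite -exprM xE jE.
Qed.

(** The Legendre symbol, with integer values and an integer argument; a prime lower argument is
    intended. *)
Definition leg (p : nat) (a : int) : int :=
  if (a%:~R : 'F_p) == 0 then 0
  else if [exists y : 'F_p, y ^+ 2 == a%:~R] then 1 else -1.

Lemma intFp_eq0 (p : nat) (a : int) : prime p -> ((a%:~R : 'F_p) == 0) = (p %| a)%Z.
Proof. by move=> pp; rewrite (dvdz_pcharf (pchar_Fp pp)). Qed.

Lemma leg_eq0 (p : nat) (a : int) : prime p -> (leg p a == 0) = (p %| a)%Z.
Proof.
by move=> pp; rewrite /leg intFp_eq0//; case: ifP => // _; case: ifP.
Qed.

Lemma leg_mod (p : nat) (a b : int) : prime p -> (p %| a - b)%Z -> leg p a = leg p b.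
Proof.
move=> pp; rewrite -intFp_eq0// rmorphB/= subr_eq0 => /eqP e.
by rewrite /leg e.
Qed.

Lemma leg_euler_F (p : nat) (a : int) : prime p -> odd p ->
  (a%:~R : 'F_p) ^+ (p.-1)./2 = (leg p a)%:~R.
Proof.
move=> pp op; have p3 : (2 < p)%N by rewrite odd_prime_gt2.
rewrite /leg; case: ifPn => [/eqP->|a0].
  by rewrite expr0n; case: (_ == _)%N / eqP => // ; lia.
have := @finField_half_exp 'F_p a%:~R; rewrite card_Fp// => -> //.
by case: ifP.
Qed.

Lemma leg_euler (p : nat) (a : int) : prime p -> odd p ->
  (p %| a ^+ (p.-1)./2 - leg p a)%Z.
Proof.
move=> pp op; rewrite -intFp_eq0// rmorphB rmorphXn/= leg_euler_F//.
by rewrite subrr.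
Qed.

Lemma leg_cases (p : nat) (a : int) : [\/ leg p a = 0, leg p a = 1 | leg p a = -1].
Proof.
rewrite /leg; case: ifP => _; first by constructor 1.
by case: ifP => _; [constructor 2|constructor 3].
Qed.

(** Congruences modulo an odd prime between the values 0, 1, -1 are equalities; this transfers
    identities from a field of characteristic [p] to the integers. *)
Lemma sign_congr (p : nat) (e f : int) : (2 < p)%N ->
  [\/ e = 0, e = 1 | e = -1] -> [\/ f = 0, f = 1 | f = -1] ->
  (p %| e - f)%Z -> e = f.
Proof.
move=> p3 he hf /dvdzP[k kE].
have b : `|k * p| <= 2 by rewrite -kE; case: he => ->; case: hf => ->.
have k0 : k = 0.
  apply/eqP; apply: contraTT b => k0; rewrite -ltNge normrM.
  have : 1 <= `|k| by rewrite -gtz0_ge1 normr_gt0.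
  by have -> : `|p%:Z| = p by []; nia.
by move: kE; rewrite k0; lia.
Qed.

Lemma legM (p : nat) (a b : int) : prime p -> odd p ->
  leg p (a * b) = leg p a * leg p b.
Proof.
move=> pp op; apply: (@sign_congr p); rewrite ?odd_prime_gt2//.
- exact: leg_cases.
- by case: (leg_cases p a) => ->; case: (leg_cases p b) => ->; rewrite ?mulr0 ?mul0r ?mul1r ?mulr1 ?mulrNN;
    by [constructor 1|constructor 2|constructor 3].
rewrite -intFp_eq0// rmorphB/= rmorphM/= -!leg_euler_F// rmorphM/=.
by rewrite exprMn subrr.
Qed.

Lemma leg1 (p : nat) : prime p -> leg p 1 = 1.
Proof.
move=> pp; rewrite /leg oner_eq0; case: existsP => // -[]; exists 1.
by rewrite expr1n.
Qed.

Lemma leg_sqrP (p : nat) (a : int) : prime p -> leg p a = 1 ->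
  exists x : int, (p %| x ^+ 2 - a)%Z.
Proof.
move=> pp; rewrite /leg; case: ifP => // _; case: existsP => // -[y /eqP yE] _.
exists (y : nat)%:Z; rewrite -intFp_eq0// rmorphB rmorphXn/= -pmulrn.
by rewrite natr_Zp yE subrr.
Qed.

Lemma leg_sqr (p : nat) (x : int) : prime p -> ~~ (p %| x)%Z -> leg p (x ^+ 2) = 1.
Proof.
move=> pp px; rewrite /leg intFp_eq0//.
have -> : (p %| x ^+ 2)%Z = false.
  by apply/negP; rewrite expr2 -intFp_eq0// rmorphM/= mulf_eq0 intFp_eq0// (negbTE px).
by case: existsP => // -[]; exists x%:~R; rewrite rmorphXn.
Qed.

Lemma leg_sign (p : nat) (x : int) : prime p -> ~~ (p %| x)%Z -> leg p x ^+ 2 = 1.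
Proof.
move=> pp; rewrite -leg_eq0//; case: (leg_cases p x) => ->; rewrite ?expr1n ?sqrrN ?expr1n//.
Qed.

(** A generator of the unit group cannot have half power 1. *)
Lemma leg_nonres (p : nat) : prime p -> odd p -> exists n : nat, (n < p)%N /\ leg p n = -1.
Proof.
move=> pp op.
have [g gen] := cyclicP (field_unit_group_cyclic [group of [set: {unit 'F_p}]]).
have p3 : (2 < p)%N by rewrite odd_prime_gt2.
have og : #[g]%g = (p.-1)%N by rewrite orderE -gen card_finField_unit card_Fp.
exists (val g : nat); split; first by rewrite -[X in (_ < X)%N](Fp_cast pp) ltn_ord.
have E : ((val g : nat)%:Z)%:~R = val g :> 'F_p by rewrite -pmulrn natr_Zp.
have := leg_euler_F (val g : nat) pp op; rewrite E.
case: (leg_cases p (val g : nat)) => // -> /eqP.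
  by rewrite expf_eq0 => /andP[_] /eqP g0; have := valP g; rewrite g0 unitr0.
rewrite -FinRing.val_unitX => /eqP g1.
have /eqP : (g ^+ (p.-1)./2)%g = 1%g by apply: val_inj.
rewrite -order_dvdn og => /dvdn_leq.
by move: p3; lia.
Qed.

Definition chi4 (n : nat) : int :=
  if (n %% 4 == 1)%N then 1 else if (n %% 4 == 3)%N then -1 else 0.
Definition chi8 (n : nat) : int :=
  if (n %% 8 \in [:: 1; 7])%N then 1 else if (n %% 8 \in [:: 3; 5])%N then -1 else 0.

Lemma chi4M (m n : nat) : chi4 (m * n) = chi4 m * chi4 n.
Proof.
rewrite /chi4 -modnMm.
have : (m %% 4 < 4)%N by rewrite ltn_pmod.
have : (n %% 4 < 4)%N by rewrite ltn_pmod.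
by case: (m %% 4)%N => [|[|[|[|]]]] //; case: (n %% 4)%N => [|[|[|[|]]]].
Qed.

Lemma chi8M (m n : nat) : chi8 (m * n) = chi8 m * chi8 n.
Proof.
rewrite /chi8 -modnMm.
have : (m %% 8 < 8)%N by rewrite ltn_pmod.
have : (n %% 8 < 8)%N by rewrite ltn_pmod.
by case: (m %% 8)%N => [|[|[|[|[|[|[|[|]]]]]]]] //; case: (n %% 8)%N => [|[|[|[|[|[|[|[|]]]]]]]].
Qed.

Lemma chi4_sign (n : nat) : odd n -> chi4 n ^+ 2 = 1.
Proof.
move=> on; have : ((n %% 4) %% 2 = 1)%N by rewrite modn_dvdm// modn2 on.
have : (n %% 4 < 4)%N by rewrite ltn_pmod.
by rewrite /chi4; case: (n %% 4)%N => [|[|[|[|]]]].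
Qed.

Lemma chi8_sign (n : nat) : odd n -> chi8 n ^+ 2 = 1.
Proof.
move=> on; have : ((n %% 8) %% 2 = 1)%N by rewrite modn_dvdm// modn2 on.
have : (n %% 8 < 8)%N by rewrite ltn_pmod.
by rewrite /chi8; case: (n %% 8)%N => [|[|[|[|[|[|[|[|]]]]]]]].
Qed.

Lemma leg_m1 (p : nat) : prime p -> odd p -> leg p (-1) = chi4 p.
Proof.
move=> pp op; apply: (@sign_congr p); rewrite ?odd_prime_gt2//.
- exact: leg_cases.
- by rewrite /chi4; case: ifP => _; [constructor 2|case: ifP => _; [constructor 3|constructor 1]].
have -> : chi4 p = (-1) ^+ (p.-1)./2.
  have := divn_eq p 4; set k := (p %/ 4)%N => e.
  have : (p %% 4 < 4)%N by rewrite ltn_pmod.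
  have : ((p %% 4) %% 2 = 1)%N by rewrite modn_dvdm// modn2 op.
  rewrite /chi4; case E: (p %% 4)%N e => [|[|[|[|]]]] // e _ _.
    have -> : ((p.-1)./2 = k * 2)%N by rewrite e; lia.
    by rewrite mulnC exprM sqrrN !expr1n.
  have -> : ((p.-1)./2 = (k * 2).+1)%N by rewrite e; lia.
  by rewrite exprS mulnC exprM sqrrN !expr1n mulr1.
by rewrite -opprB rpredN leg_euler.
Qed.

(** The symbol as a function on the field, for summation over residue classes. *)
Definition legF (p : nat) (x : 'F_p) : int := leg p (x : nat)%:Z.

Lemma natFpK (p : nat) (x : 'F_p) : ((x : nat)%:Z)%:~R = x.
Proof. by rewrite -pmulrn natr_Zp. Qed.

Lemma legF_intr (p : nat) (a : int) : legF (a%:~R : 'F_p) = leg p a.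
Proof. by rewrite /legF /leg natFpK. Qed.

Lemma legFM (p : nat) (x y : 'F_p) : prime p -> odd p -> legF (x * y) = legF x * legF y.
Proof.
by move=> pp op; rewrite -{1}(natFpK x) -{1}(natFpK y) -rmorphM/= legF_intr legM.
Qed.

Lemma legF_eq0 (p : nat) (x : 'F_p) : (legF x == 0) = (x == 0).
Proof. by rewrite /legF /leg natFpK; case: ifP => // _; case: ifP. Qed.

Lemma legF_sqr1 (p : nat) (x : 'F_p) : legF x * legF x = (x != 0)%:R.
Proof.
by rewrite -legF_eq0 /legF; case: (leg_cases p (x : nat)) => ->.
Qed.

(** Multiplication by a non-residue changes the sign of the sum. *)
Lemma sum_legF (p : nat) : prime p -> odd p -> \sum_(x : 'F_p) legF x = 0.
Proof.
move=> pp op; have [n [_ ln]] := leg_nonres pp op.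
have n0 : (n%:Z%:~R : 'F_p) != 0 by rewrite -legF_eq0 legF_intr ln.
suff : \sum_(x : 'F_p) legF x = - \sum_(x : 'F_p) legF x by lia.
rewrite {1}(reindex_inj (mulfI n0)) -sumrN /=.
by apply: eq_bigr => x _; rewrite legFM// legF_intr ln mulN1r.
Qed.

(** The additive character attached to a [p]-th root of unity [z]. *)
Definition zexp (L : fieldType) (p : nat) (z : L) (x : 'F_p) : L := z ^+ (x : nat).

Lemma zeta_add (p : nat) (L : fieldType) (z : L) (x y : 'F_p) : prime p ->
  z ^+ p = 1 -> zexp z (x + y) = zexp z x * zexp z y.
Proof.
by move=> pp zp; rewrite /zexp /= [X in (_ %% X)%N]Fp_cast// expr_mod// exprD.
Qed.

Lemma zeta_mul (p : nat) (L : fieldType) (z : L) (x : 'F_p) (n : nat) : prime p ->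
  z ^+ p = 1 -> zexp z (x * n%:R) = (zexp z x) ^+ n.
Proof.
move=> pp zp; elim: n => [|n IH]; first by rewrite mulr0 expr0 /zexp expr0.
by rewrite -(addn1 n) natrD mulrDr mulr1 zeta_add// IH exprD.
Qed.

Lemma sum_zeta (p : nat) (L : fieldType) (z : L) (t : 'F_p) : prime p ->
  z ^+ p = 1 -> z != 1 -> \sum_(x : 'F_p) zexp z (x * t) = p%:R *+ (t == 0).
Proof.
move=> pp zp z1; case: eqP => [->|/eqP t0].
  under eq_bigr do rewrite mulr0 /zexp expr0.
  by rewrite sumr_const card_Fp.
transitivity (\sum_(x : 'F_p) zexp z x); first by rewrite [RHS](reindex_inj (mulIf t0)).
have : (z - 1) * \sum_(i : 'F_p) zexp z i = 0.
  rewrite mulrBl mul1r {2}(reindex_inj (addIr 1)) /= mulr_sumr -sumrB big1// => i _.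
  rewrite zeta_add// mulrC [zexp z 1](_ : _ = z) ?subrr//.
by move/eqP; rewrite mulf_eq0 subr_eq0 (negbTE z1) => /eqP.
Qed.

(** The substitution [y = x t] turns the square into a sum over [t] of [legF t] times a complete
    sum of roots of unity, in which only [t = -1] survives the vanishing of the sum of [legF].
    *)
Lemma gauss_sum_sqr (p : nat) (L : fieldType) (z : L) : prime p -> odd p ->
  z ^+ p = 1 -> z != 1 ->
  (\sum_(x : 'F_p) (legF x)%:~R * zexp z x) ^+ 2 = (chi4 p * p)%:~R.
Proof.
move=> pp op zp z1; rewrite expr2 mulr_suml.
transitivity (\sum_(x : 'F_p) \sum_(t : 'F_p)
    (legF t * (x != 0)%:R)%:~R * zexp z (x * (1 + t))).
  apply: eq_bigr => x _; case: (eqVneq x 0) => [->|x0].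
    rewrite (_ : legF 0 = 0) ?mul0r; last by apply/eqP; rewrite legF_eq0.
    by rewrite big1// => t _; rewrite mulr0 mul0r.
  rewrite mulr_sumr (reindex_inj (mulfI x0)); apply: eq_bigr => t _ /=.
  rewrite mulrDr mulr1 zeta_add// legFM// mulrACA -rmorphM/= mulrA.
  by rewrite [legF x * (legF x * _)]mulrA legF_sqr1 x0 mul1r mulr1 mulrA.
rewrite exchange_big /=.
transitivity (\sum_(t : 'F_p) (legF t)%:~R * (p%:R *+ (t == -1) - 1 : L)).
  apply: eq_bigr => t _; rewrite -addr_eq0 addrC -(sum_zeta _ pp zp z1) (bigD1 (0 : 'F_p))//=.
  rewrite mulr0 mul0r add0r [in RHS](bigD1 (0 : 'F_p))//= mul0r [zexp z 0]expr0 addrAC subrr add0r.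
  by rewrite mulr_sumr; apply: eq_bigr => x ->; rewrite mulr1.
under eq_bigr do rewrite mulrBr mulr1.
rewrite sumrB -rmorph_sum/= sum_legF// subr0 (bigD1 (-1))//= eqxx mulr1n big1 ?addr0.
  by rewrite rmorphM/= -leg_m1// -[in RHS]legF_intr rmorphN1.
by move=> t /negbTE ->; rewrite mulr0n mulr0.
Qed.

(** Quadratic reciprocity, by computing the [q]-th power of the Gauss sum over an algebraic
    closure of the field with [q] elements twice: by Frobenius, and from its square. *)
Lemma leg_recip (p q : nat) : prime p -> odd p -> prime q -> odd q -> p != q ->
  leg q (chi4 p * p) = leg p q.
Proof.
move=> pp op pq oq npq.
have [K [f _]] := countable_algebraic_closure 'F_q.
have cK : q \in [pchar K] by rewrite (fmorph_pchar f) pchar_Fp.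
have pK : (p%:R : K) != 0.
  by rewrite -(dvdn_pcharf cK) dvdn_prime2// eq_sym.
have [z /eqP rz] : exists z : K, root (\poly_(i < p) 1) z.
  by apply/closed_rootP; rewrite size_poly_eq ?oner_eq0// neq_ltn prime_gt1// orbT.
have sz : \sum_(i < p) z ^+ i = 0.
  by apply: etrans rz; rewrite horner_poly; apply: eq_bigr => i _; rewrite mul1r.
have zp : z ^+ p = 1 by apply/eqP; rewrite -subr_eq0 subrX1 sz mulr0.
have z1 : z != 1.
  apply: contraNneq pK => z1; rewrite -sz z1.
  by under eq_bigr do rewrite expr1n; rewrite sumr_const card_ord.
set G := \sum_(x : 'F_p) (legF x)%:~R * zexp z x.
have G2 : G ^+ 2 = (chi4 p * p)%:~R by rewrite gauss_sum_sqr.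
have G0 : G != 0.
  rewrite -sqrf_eq0 G2 rmorphM/= mulf_neq0//.
  have : (chi4 p)%:~R ^+ 2 = 1 :> K by rewrite -rmorphXn/= chi4_sign.
  by move=> c4; apply/eqP => c0; move/eqP: c4; rewrite c0 expr0n eq_sym oner_eq0.
have qm : q = ((q.-1)./2 * 2).+1 by move: oq (prime_gt0 pq); lia.
have Gq : G ^+ q = (leg p q)%:~R * G.
  have q0 : (q%:R : 'F_p) != 0.
    by rewrite -(dvdn_pcharf (pchar_Fp pp)) dvdn_prime2.
  rewrite -(pFrobenius_autE cK) rmorph_sum /= mulr_sumr [RHS](reindex_inj (mulIf q0)) /=.
  apply: eq_bigr => x _.
  rewrite rmorphM/= rmorph_int pFrobenius_autE -zeta_mul// legFM// mulrA -rmorphM/=.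
  rewrite mulrCA [q%:R]pmulrn legF_intr -expr2 leg_sign ?mulr1//.
  by rewrite -intFp_eq0// -pmulrn.
have := chi4_sign op => c4.
have E : (chi4 p * p)%:~R ^+ (q.-1)./2 = (leg p q)%:~R :> K.
  by apply: (mulIf G0); rewrite -Gq -G2 -exprM mulnC -exprSr -qm.
apply: (@sign_congr q); rewrite ?odd_prime_gt2//.
- exact: leg_cases.
- exact: leg_cases.
rewrite -(@intFp_eq0 q)// rmorphB/= -leg_euler_F// -(fmorph_eq0 f) rmorphB rmorphXn/=.
by rewrite !rmorph_int E subrr.
Qed.

(** As for reciprocity, with [z + 1 / z] for a primitive eighth root of unity [z], whose square
    is 2, in the role of the Gauss sum. *)
Lemma leg_2 (q : nat) : prime q -> odd q -> leg q 2 = chi8 q.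
Proof.
move=> pq oq.
have [K [f _]] := countable_algebraic_closure 'F_q.
have cK : q \in [pchar K] by rewrite (fmorph_pchar f) pchar_Fp.
have [z /eqP rz] : exists z : K, root ('X^4 + 1) z.
  by apply/closed_rootP; rewrite size_polyDl ?size_polyXn// size_poly1.
have z4 : z ^+ 4 = -1.
  by move: rz; rewrite hornerD hornerXn hornerC => /eqP; rewrite addr_eq0 => /eqP.
have z0 : z != 0.
  by apply/eqP => z0; move/eqP: z4; rewrite z0 expr0n eq_sym oppr_eq0 oner_eq0.
pose t := z + z^-1.
have t2 : t ^+ 2 = 2%:~R.
  have : z ^+ 2 * t ^+ 2 = z ^+ 2 * 2%:~R.
    rewrite /t; transitivity (z ^+ 4 + 2 * z ^+ 2 + 1); first by field.
    by rewrite z4; ring.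
  by move/mulfI; apply; rewrite expf_neq0.
have two0 : (2%:~R : K) != 0.
  by rewrite -(dvdz_pcharf cK) /= ; move: (odd_prime_gt2 oq pq); rewrite dvdzE /= => h; apply/negP => /dvdn_leq; lia.
have t0 : t != 0 by rewrite -sqrf_eq0 t2.
have z8 : z ^+ 8 = 1 by rewrite (exprM z 4 2) z4 sqrrN expr1n.
have tq : t ^+ q = (chi8 q)%:~R * t.
  rewrite -(pFrobenius_autE cK) rmorphD/= fmorphV/= !pFrobenius_autE.
  rewrite -(expr_mod _ z8).
  have : ((q %% 8) %% 2 = 1)%N by rewrite modn_dvdm// modn2 oq.
  have : (q %% 8 < 8)%N by rewrite ltn_pmod.
  have z5 : z ^+ 5 = - z by rewrite exprS z4 mulrN1.
  have zi : z^-1 = - z ^+ 3.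
    by apply: (mulfI z0); rewrite mulfV// mulrN -exprS z4 opprK.
  have z7 : z ^+ 7 = - z ^+ 3 by rewrite (exprD z 4 3) z4 mulN1r.
  rewrite /chi8 /t; case: (q %% 8)%N => [|[|[|[|[|[|[|[|]]]]]]]] //= _ _.
  + by rewrite expr1 mul1r.
  + by rewrite -[z ^+ 3]opprK -zi invrN invrK mulN1r opprD addrC.
  + by rewrite z5 mulN1r opprD invrN.
  + by rewrite z7 -zi invrK mul1r addrC.
have qm : q = ((q.-1)./2 * 2).+1 by move: oq (prime_gt0 pq); lia.
have E : (2%:~R : K) ^+ (q.-1)./2 = (chi8 q)%:~R :> K.
  by apply: (mulIf t0); rewrite -tq -t2 -exprM mulnC -exprSr -qm.
apply: (@sign_congr q); rewrite ?odd_prime_gt2//.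
- exact: leg_cases.
- by rewrite /chi8; case: ifP => _; [constructor 2|case: ifP => _; [constructor 3|constructor 1]].
rewrite -(@intFp_eq0 q)// rmorphB/= -leg_euler_F// -(fmorph_eq0 f) rmorphB rmorphXn/=.
by rewrite !rmorph_int E subrr.
Qed.

(** * Norms from quadratic fields and Legendre's theorem *)

(** [c] is a norm from Q(sqrt a) over Q; also meaningful when [a] is a square. *)
Definition nrm (a c : rat) : Prop := exists x y : rat, c = x ^+ 2 - a * y ^+ 2.

Lemma nrmM (a c d : rat) : nrm a c -> nrm a d -> nrm a (c * d).
Proof.
move=> [x [y ->]] [z [t ->]]; exists (x * z + a * y * t), (x * t + y * z); ring.
Qed.

Lemma nrm_sqr (a k : rat) : nrm a (k ^+ 2).
Proof. by exists k, 0; ring. Qed.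

Lemma nrmV (a c : rat) : nrm a c -> nrm a c^-1.
Proof.
have [->|c0] := eqVneq c 0; first by rewrite invr0.
by move=> nc; rewrite (_ : c^-1 = c * c^-1 ^+ 2); [apply: nrmM nc (nrm_sqr _ _)|field].
Qed.

(** If [a] is a square, the norm form splits into two linear factors. *)
Lemma nrm_square (a s c : rat) : a = s ^+ 2 -> s != 0 -> nrm a c.
Proof.
move=> -> s0; exists ((c + 1) / 2), ((c - 1) / (2 * s)); field.
by rewrite s0.
Qed.

Lemma csqrt_ex (n : nat) : exists k, (n <= k ^ 2)%N.
Proof. by exists n; rewrite expnS expn1; case: n => // n; rewrite leq_pmulr. Qed.

(** The ceiling of the square root. *)
Definition csqrt (n : nat) : nat := ex_minn (csqrt_ex n).

Lemma csqrt_ge (n : nat) : (n <= csqrt n ^ 2)%N.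
Proof. by rewrite /csqrt; case: ex_minnP. Qed.

Lemma csqrt_lt (n k : nat) : (k < csqrt n)%N -> (k ^ 2 < n)%N.
Proof.
rewrite /csqrt; case: ex_minnP => m _ min km; rewrite ltnNge.
by apply: contraL km => /min; rewrite leqNgt.
Qed.

Lemma absz_sub_ord (X : nat) (i j : 'I_X) : (`|i%:Z - j%:Z| < X)%N.
Proof. by have := ltn_ord i; have := ltn_ord j; lia. Qed.

(** The box principle for the lattice cut out by the two congruences. When [M] is not a square,
    the box has more than [M * `|a|] points. *)
Lemma legendre_small_vector (a : int) (M : nat) (al mu : int) :
  a != 0 -> (forall k, M != k ^ 2)%N ->
  exists x y z : int, [/\ (x, y, z) != (0, 0, 0),
    (M %| x - al * y)%Z, (`|a|%N %| x - mu * z)%Z &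
    [/\ (`|x| ^ 2 < `|a| * M)%N, (`|y| ^ 2 < M)%N & (`|z| ^ 2 < `|a|)%N]].
Proof.
move=> a0 Mns; set A := `|a|%N.
have A0 : (0 < A)%N by rewrite absz_gt0.
have M0 : (0 < M)%N by rewrite lt0n; apply/eqP => M0; have := Mns 0%N; rewrite M0.
set X := csqrt (A * M); set Y := csqrt M; set Z := csqrt A.
have big : (M * A < X * Y * Z)%N.
  have hX := csqrt_ge (A * M); have hZ := csqrt_ge A.
  have hY : (M < Y ^ 2)%N by rewrite ltn_neqAle Mns csqrt_ge.
  rewrite -ltn_sqr !expnMn.
  apply: (@leq_trans ((A * M) * Y ^ 2 * A)); last by apply: leq_mul => //; apply: leq_mul.
  rewrite (_ : (M ^ 2 * A ^ 2 = (A * M) * M * A)%N); last by ring.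
  by rewrite ltn_pmul2r// ltn_pmul2l// muln_gt0 A0.
have lM (w : int) : (`|(w %% M)%Z| < M)%N.
  by rewrite -ltz_nat gez0_abs ?modz_ge0 ?ltz_pmod//; case: (M) M0.
have lA (w : int) : (`|(w %% A)%Z| < A)%N.
  by rewrite -ltz_nat gez0_abs ?modz_ge0 ?ltz_pmod//; case: (A) A0.
pose F (u : 'I_X * 'I_Y * 'I_Z) : 'I_M * 'I_A :=
  (Ordinal (lM (u.1.1%:Z - al * u.1.2%:Z)), Ordinal (lA (u.1.1%:Z - mu * u.2%:Z))).
have /injectivePn[u [v uv Fuv]] : ~~ injectiveb F.
  apply: contraL big => /injectiveP/leq_card.
  by rewrite !card_prod !card_ord -leqNgt.
have congr (n : nat) (w w' : int) : (0 < n)%N -> `|(w %% n)%Z|%N = `|(w' %% n)%Z|%N -> (n %| w - w')%Z.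
  move=> n0 e; rewrite -eqz_mod_dvd; apply/eqP.
  have p (k : int) : (k %% n)%Z = `|(k %% n)%Z|%N :> int by rewrite gez0_abs// modz_ge0; case: (n) n0.
  by rewrite p e -p.
case: u v uv Fuv => [[x1 y1] z1] [[x2 y2] z2] /= uv [e1 e2].
exists (x1%:Z - x2%:Z), (y1%:Z - y2%:Z), (z1%:Z - z2%:Z); split.
- apply: contra uv => /eqP[ex ey ez].
  by do 3?[apply/andP; split]; rewrite -val_eqE /=; lia.
- have := congr _ _ _ M0 e1; congr (_ %| _)%Z; rewrite /=; ring.
- have := congr _ _ _ A0 e2; congr (_ %| _)%Z; rewrite /=; ring.
by split; apply: csqrt_lt; apply: absz_sub_ord.
Qed.

Lemma csqrt_sqr (k : nat) : csqrt (k ^ 2) = k.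
Proof.
apply/eqP; rewrite eqn_leq -(leq_sqr k) csqrt_ge andbT leqNgt.
by apply/negP => /csqrt_lt; rewrite ltnn.
Qed.

(** For positive [a], with [T = a M]: a multiple of [a M] taken by the form on the small vector
    is [0] or [- a M]. *)
Lemma box_quotient_neg (T U P Q k : int) : 0 <= U < T -> 0 <= P < T -> 0 <= Q < T ->
  U - P - Q = k * T -> k = 0 \/ k = -1.
Proof.
move=> hU hP hQ e; have T0 : 0 < T by lia.
have : -2 * T < k * T by rewrite -e; lia.
have : k * T < 1 * T by rewrite -e; lia.
by rewrite !ltr_pM2r//; lia.
Qed.

(** The same for negative [a]. *)
Lemma box_quotient_pos (T U P Q k : int) : 0 <= U < T -> 0 <= P < T -> 0 <= Q < T ->
  U + P - Q = k * T -> k = 0 \/ k = 1.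
Proof.
move=> hU hP hQ e; have T0 : 0 < T by lia.
have : -1 * T < k * T by rewrite -e; lia.
have : k * T < 2 * T by rewrite -e; lia.
by rewrite !ltr_pM2r//; lia.
Qed.

(** On the vector of the box principle the form [x ^ 2 - a y ^ 2 - M z ^ 2] is a multiple of [a
    M] and small, hence [0] or [- a M]. In the second case [x ^ 2 - a y ^ 2 = M (z ^ 2 - a)],
    and [M] is a quotient of two norms. *)
Lemma legendre_norm (a : int) (M : nat) (al mu : int) :
  a != 0 -> (0 < M)%N -> coprime M `|a| ->
  (M %| al ^+ 2 - a)%Z -> (`|a|%N %| mu ^+ 2 - M%:Z)%Z -> nrm a%:~R M%:R.
Proof.
move=> a0 M0 co dM da.
have [/eqP->|ne] := boolP (M == (csqrt M) ^ 2)%N.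
  by rewrite natrX; apply: nrm_sqr.
have Mns k : (M != k ^ 2)%N by apply: contra ne => /eqP->; rewrite csqrt_sqr.
have acase : a = `|a|%N \/ a = - `|a|%N%:Z by clear; lia.
have [x [y [z [nz dx dz [bx b_y bz]]]]] := legendre_small_vector al mu a0 Mns.
set A := `|a|%N in acase co da dz bx bz.
have A0 : (0 < A)%N by rewrite absz_gt0.
have toZ (w : int) (n : nat) : (`|w| ^ 2 < n)%N -> w ^+ 2 < n%:Z.
  by move=> h; rewrite -ltz_nat in h; apply: le_lt_trans h; rewrite -abszX; case: (w ^+ 2).
move/toZ: bx => bx; move/toZ: b_y => b_y; move/toZ: bz => bz.
set f := x ^+ 2 - a * y ^+ 2 - M%:Z * z ^+ 2.
have fM : (M %| f)%Z.
  rewrite (_ : f = (x - al * y) * (x + al * y) + (al ^+ 2 - a) * y ^+ 2 - M%:Z * z ^+ 2); last by rewrite /f; ring.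
  by rewrite !(rpredB, rpredD)//= ?(dvdz_mulr, dvdz_mull).
have fA : (A %| f)%Z.
  rewrite (_ : f = (x - mu * z) * (x + mu * z) + (mu ^+ 2 - M%:Z) * z ^+ 2 - a * y ^+ 2); last by rewrite /f; ring.
  by rewrite !(rpredB, rpredD)//= ?(dvdz_mulr, dvdz_mull)// dvdzE.
have /dvdzP[k kE] : (A%:Z * M%:Z %| f)%Z by rewrite Gauss_dvdz ?fM ?fA// /coprimez /gcdz/= gcdnC -/A; move: co; rewrite /coprime => /eqP ->.
have sq (w : int) : 0 <= w ^+ 2 by rewrite sqr_ge0.
have sx := sq x; have sy := sq y; have sz := sq z.
have h1 : A%:Z * y ^+ 2 < A%:Z * M%:Z by rewrite ltr_pM2l.
have h2 : M%:Z * z ^+ 2 < A%:Z * M%:Z by rewrite mulrC ltr_pM2r.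
have h3 : 0 <= A%:Z * y ^+ 2 by rewrite mulr_ge0.
have h4 : 0 <= M%:Z * z ^+ 2 by rewrite mulr_ge0.
rewrite PoszM in bx.
(* the two signs of [a] *)
have fcase : f = 0 \/ f = - a * M%:Z.
  case: acase => aA; rewrite kE.
    have [||||->|->] := @box_quotient_neg (A%:Z * M%:Z) (x ^+ 2) (A%:Z * y ^+ 2) (M%:Z * z ^+ 2) k;
      rewrite ?sx ?h3 ?h4// -?kE /f aA; by [left; ring|right; ring|].
  have [||||->|->] := @box_quotient_pos (A%:Z * M%:Z) (x ^+ 2) (A%:Z * y ^+ 2) (M%:Z * z ^+ 2) k;
    rewrite ?sx ?h3 ?h4// -?kE /f aA; by [ring|left; ring|right; ring|].
have a0' : (a%:~R : rat) != 0 by rewrite intr_eq0.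
have M0' : (M%:R : rat) != 0 by rewrite pnatr_eq0 -lt0n.
case: fcase => fE.
  have E : (x%:~R : rat) ^+ 2 - a%:~R * y%:~R ^+ 2 = M%:R * z%:~R ^+ 2.
    by apply/eqP; rewrite -subr_eq0 pmulrn -!rmorphXn -!rmorphM -!rmorphB/= -/f fE.
  have [z0|z0] := eqVneq z 0.
    have y0 : y != 0.
      apply: contra nz => /eqP y0; move: fE; rewrite /f z0 y0 expr0n !mulr0 !subr0 => /eqP.
      by rewrite sqrf_eq0 => /eqP ->.
    have y0' : (y%:~R : rat) != 0 by rewrite intr_eq0.
    have ae : (a%:~R : rat) = (x%:~R / y%:~R) ^+ 2.
      move/eqP: E; rewrite z0 expr0n mulr0 subr_eq0 => /eqP E.
      by rewrite exprMn E; field.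
    apply: (nrm_square _ ae); apply: contra_neq a0' => s0.
    by rewrite ae s0 expr0n.
  have z0' : (z%:~R : rat) != 0 by rewrite intr_eq0.
  exists (x%:~R / z%:~R), (y%:~R / z%:~R).
  by apply: (mulIf (expf_neq0 2 z0')); rewrite -E; field.
have E : (x%:~R : rat) ^+ 2 - a%:~R * y%:~R ^+ 2 = M%:R * (z%:~R ^+ 2 - a%:~R).
  apply/eqP; rewrite -subr_eq0 pmulrn -!rmorphXn -!rmorphM -!rmorphB -rmorphM -rmorphB/=.
  by rewrite (_ : _ - _ = f + a * M%:Z); [rewrite fE; apply/eqP; rewrite mulNr addNr|rewrite /f; ring].
have [az|az] := eqVneq ((z%:~R : rat) ^+ 2 - a%:~R) 0.
  move/eqP: az; rewrite subr_eq0 eq_sym => /eqP az.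
  by apply: (nrm_square _ az); apply: contra_neq a0' => s0; rewrite az s0 expr0n.
rewrite (_ : M%:R = (x%:~R ^+ 2 - a%:~R * y%:~R ^+ 2) * (z%:~R ^+ 2 - a%:~R * 1 ^+ 2)^-1); last first.
  by rewrite E expr1n mulr1 mulfK.
by apply: nrmM; [exists x%:~R, y%:~R|apply: nrmV; exists z%:~R, 1].
Qed.

(** A boolean form in terms of exponents; [squarefreeP] compares it with divisibility by
    squares. *)
Definition sqf (n : nat) : bool := (0 < n)%N && all (fun p => logn p n == 1%N) (primes n).

Lemma sqf_prod (n : nat) : sqf n -> n = (\prod_(p <- primes n) p)%N.
Proof.
move=> /andP[n0 /allP s]; rewrite [LHS](prod_prime_decomp n0) prime_decompE big_map.
by apply: eq_big_seq => p /= /s/eqP ->; rewrite expn1.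
Qed.

Lemma coprime_primes_prod (p : nat) (s : seq nat) : prime p -> p \notin s -> all prime s ->
  coprime p (\prod_(q <- s) q)%N.
Proof.
move=> pp; elim: s => [|q s IH]; first by rewrite big_nil coprimen1.
rewrite inE negb_or big_cons coprimeMr => /andP[pq ps] /= /andP[qq sp].
by rewrite IH// andbT prime_coprime// dvdn_prime2.
Qed.

Lemma dvd_sqr_congr (m x z d : int) : (m %| z - x)%Z -> (m %| x ^+ 2 - d)%Z -> (m %| z ^+ 2 - d)%Z.
Proof.
move=> h1 h2; rewrite (_ : z ^+ 2 - d = (z - x) * (z + x) + (x ^+ 2 - d)); last by ring.
by rewrite rpredD ?dvdz_mulr.
Qed.

Lemma sqrt_crt_seq (s : seq nat) (d : int) : uniq s -> all prime s ->
  (forall p, p \in s -> exists x : int, (p %| x ^+ 2 - d)%Z) ->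
  exists x : int, ((\prod_(p <- s) p)%N %| x ^+ 2 - d)%Z.
Proof.
elim: s => [|p s IH] /=; first by exists 0; rewrite big_nil dvd1z.
move=> /andP[ps us] /andP[pp prs] H.
have [x hx] := IH us prs (fun q qs => H q (@mem_behead _ (p :: s) q qs)).
have [y hy] := H p (mem_head _ _).
have co : coprimez p (\prod_(q <- s) q)%N by apply: coprime_primes_prod.
exists (zchinese p (\prod_(q <- s) q)%N y x).
rewrite big_cons PoszM Gauss_dvdz//; apply/andP; split.
  by apply: dvd_sqr_congr hy; rewrite -eqz_mod_dvd zchinese_modl.
by apply: dvd_sqr_congr hx; rewrite -eqz_mod_dvd zchinese_modr.
Qed.

Lemma sqrt_crt (n : nat) (d : int) : sqf n ->
  (forall p, prime p -> odd p -> (p %| n)%N -> ~~ (p %| d)%Z -> leg p d = 1) ->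
  exists x : int, (n %| x ^+ 2 - d)%Z.
Proof.
move=> sn H; rewrite (sqf_prod sn); apply: sqrt_crt_seq; rewrite ?primes_uniq ?all_prime_primes//.
move=> p; rewrite mem_primes => /and3P[pp n0 pn].
have [pd|pd] := boolP (p %| d)%Z; first by exists 0; rewrite expr0n sub0r rpredN.
have [op|] := boolP (odd p); first by apply: leg_sqrP => //; apply: H.
move=> /negbTE ep; have -> : p = 2%N.
  by apply/eqP; rewrite eq_sym -dvdn_prime2// dvdn2 ep.
exists d; rewrite (_ : d ^+ 2 - d = d * (d - 1)); last by ring.
rewrite dvdzE abszM /= dvdn2 oddM negb_and.
by lia.
Qed.

(** Legendre's theorem for [x ^ 2 - a y ^ 2 = M z ^ 2]. No condition at 2 or at infinity
    appears: infinity is harmless as [M > 0], and the place 2 follows by the product formula, of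
    which the box principle is a substitute. *)
Lemma legendre (a : int) (M : nat) : sqf `|a| -> sqf M -> odd M ->
  (forall l, prime l -> (l %| M)%N -> leg l a = 1) ->
  (forall q, prime q -> odd q -> (q %| a)%Z -> leg q M = 1) ->
  nrm a%:~R M%:R.
Proof.
move=> sa sM oM Ha HM.
have a0 : a != 0 by rewrite -absz_gt0; case/andP: sa.
have M0 : (0 < M)%N by case/andP: sM.
have [al hal] : exists x : int, (M %| x ^+ 2 - a)%Z.
  by apply: sqrt_crt => // p pp _ pM _; apply: Ha.
have [mu hmu] : exists x : int, (`|a|%N %| x ^+ 2 - M%:Z)%Z.
  by apply: sqrt_crt => // p pp op pa _; apply: HM.
apply: (legendre_norm a0 M0 _ hal hmu).
rewrite coprime_sym coprime_has_primes ?absz_gt0//; apply/hasPn => l.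
rewrite mem_primes => /and3P[pl _ lM].
rewrite mem_primes pl absz_gt0 a0 /=; apply/negP => la.
have := Ha l pl lM; have /eqP -> : leg l a == 0 by rewrite leg_eq0// dvdzE.
by [].
Qed.

(** * Non-vanishing of L(1, chi) for real characters *)

Lemma sum_dvd (R : nmodType) (F : nat -> R) (d N : nat) : (0 < d)%N ->
  \sum_(1 <= n < N.+1 | (d %| n)%N) F n = \sum_(1 <= m < (N %/ d).+1) F (d * m)%N.
Proof.
move=> d0; elim: N => [|N IH]; first by rewrite div0n !big_geq.
rewrite big_mkcond big_nat_recr//= -big_mkcond IH divnS//.
case: ifP => dN; last by rewrite add0n addr0.
rewrite add1n [RHS]big_nat_recr//=; congr (_ + F _).
by have := divnK dN; rewrite divnS// dN add1n mulnC.
Qed.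

(** A Cauchy criterion with explicit error: the limit is the supremum of [u n - e n]. *)
Lemma sup_squeeze (R : realType) (u e : nat -> R) : (forall n, 0 <= e n) ->
  (forall m n, (m <= n)%N -> `|u m - u n| <= e m) ->
  exists L : R, forall n, `|u n - L| <= e n.
Proof.
move=> e0 h; pose A := [set u n - e n | n in [set: nat]]%classic.
have hA m n : u m - e m <= u n + e n.
  have [mn|/ltnW nm] := leqP m n.
    by have := h _ _ mn; rewrite ler_norml; have := e0 n; lra.
  by have := h _ _ nm; rewrite ler_norml; have := e0 m; lra.
have hs : has_sup A.
  split; first by exists (u 0%N - e 0%N), 0%N.
  by exists (u 0%N + e 0%N) => _ [n _ <-].
exists (sup A) => n; rewrite ler_norml.
have h1 : u n - e n <= sup A by apply: ub_le_sup; [case: hs|exists n].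
have h2 : sup A <= u n + e n by apply: ge_sup; [case: hs|move=> _ [m _ <-]].
by lra.
Qed.

Lemma sumr_nat_diff (R : zmodType) (F : nat -> R) (i m j : nat) : (i <= m)%N -> (m <= j)%N ->
  \sum_(i <= n < j) F n - \sum_(i <= n < m) F n = \sum_(m <= n < j) F n.
Proof. by move=> im mj; rewrite [X in X - _](@big_cat_nat _ _ _ m i j)//= [X in X - _]addrC addrK. Qed.

(** Partial summation against the bounded partial sums of [chi]. *)
Lemma abel_bound (R : realType) (chi f : nat -> R) (B : R) (m k : nat) :
  (forall n, `|\sum_(0 <= i < n) chi i| <= B) ->
  (forall n, (m <= n)%N -> f n.+1 <= f n) -> (forall n, 0 <= f n) -> (m <= k)%N ->
  `|\sum_(m <= n < k) chi n * f n| <= 2 * B * f m.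
Proof.
move=> hB fd f0 mk.
have hS j : (m <= j)%N -> `|\sum_(m <= i < j) chi i| <= 2 * B.
  move=> mj; have -> : \sum_(m <= i < j) chi i = \sum_(0 <= i < j) chi i - \sum_(0 <= i < m) chi i.
    by rewrite sumr_nat_diff.
  by apply: le_trans (ler_normB _ _) _; have := hB j; have := hB m; lra.
have key : forall j, `|\sum_(m <= n < m + j) chi n * f n - (\sum_(m <= i < m + j) chi i) * f (m + j)%N|
    <= 2 * B * (f m - f (m + j)%N).
  elim=> [|j IH]; first by rewrite addn0 !big_geq// mul0r subrr normr0 subrr mulr0.
  rewrite addnS !big_nat_recr ?leq_addr//=; set S := BIG_F in IH *.
  set T := \sum_(m <= i < m + j) chi i in IH *.
  set s := (m + j)%N in IH *.
  have hT : `|T + chi s| <= 2 * B.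
    by have := hS s.+1; rewrite big_nat_recr ?leq_addr//= => -> //; rewrite ltnW// ltnS leq_addr.
  rewrite (_ : _ - _ = (\sum_(m <= n < s) chi n * f n - T * f s) + (T + chi s) * (f s - f s.+1)); last by ring.
  apply: le_trans (ler_normD _ _) _.
  rewrite (_ : 2 * B * (f m - f s.+1) = 2 * B * (f m - f s) + 2 * B * (f s - f s.+1)); last by ring.
  apply: lerD => //; rewrite normrM ler_pM//.
  by rewrite ger0_norm// subr_ge0 fd// leq_addr.
have := key (k - m)%N; rewrite subnKC// => hk.
have := hS k mk => hSk; have fk := f0 k.
rewrite -[X in `|X|](subrK ((\sum_(m <= i < k) chi i) * f k)).
apply: le_trans (ler_normD _ _) _.
have : `|(\sum_(m <= i < k) chi i) * f k| <= 2 * B * f k by rewrite normrM (ger0_norm fk) ler_wpM2r.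
by lra.
Qed.

(** What is used of a non-principal real Dirichlet character; [B] bounds its partial sums. *)
Definition real_char (R : realType) (B : R) (chi : nat -> R) : Prop :=
  [/\ chi 1%N = 1, forall m n, chi (m * n)%N = chi m * chi n,
      forall n, [\/ chi n = 0, chi n = 1 | chi n = -1]
    & forall n, `|\sum_(0 <= i < n) chi i| <= B].

Lemma real_char_le1 (R : realType) (B : R) (chi : nat -> R) n : real_char B chi -> `|chi n| <= 1.
Proof. by case=> _ _ h _; case: (h n) => ->; rewrite ?normr0 ?normrN ?normr1 ?ler01. Qed.

Lemma real_char_B0 (R : realType) (B : R) (chi : nat -> R) : real_char B chi -> 0 <= B.
Proof. by case=> _ _ _ /(_ 0%N); rewrite big_geq// normr0. Qed.

(** The partial sums of [L(1, chi)]. *)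
Definition Lpart (R : realType) (chi : nat -> R) (N : nat) : R :=
  \sum_(1 <= n < N.+1) chi n * n%:R^-1.

Lemma Lpart_tail (R : realType) (B : R) (chi : nat -> R) (m n : nat) : real_char B chi ->
  (m <= n)%N -> `|Lpart chi m - Lpart chi n| <= 2 * B / m.+1%:R.
Proof.
move=> hc mn; rewrite /Lpart distrC sumr_nat_diff//.
apply: abel_bound => //; first by case: hc.
- by move=> k mk; rewrite lef_pV2 ?posrE ?ltr0n ?ler_nat// (leq_trans _ mk).
Qed.

Lemma L_exists (R : realType) (B : R) (chi : nat -> R) : real_char B chi ->
  exists L : R, forall n, `|Lpart chi n - L| <= 2 * B / n.+1%:R.
Proof.
move=> hc; apply: sup_squeeze => [n|m n]; last exact: Lpart_tail.
by rewrite divr_ge0// mulr_ge0//; apply: real_char_B0 hc.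
Qed.

(** The coefficients of the Dirichlet series [zeta(s) L(s, chi)]. *)
Definition divsum (R : realType) (chi : nat -> R) (n : nat) : R :=
  \sum_(1 <= d < n.+1 | (d %| n)%N) chi d.

Lemma big_nat_dvd (R : nmodType) (F : nat -> R) (m N : nat) : (0 < m)%N -> (m <= N)%N ->
  \sum_(1 <= d < m.+1 | (d %| m)%N) F d = \sum_(1 <= d < N.+1 | (d %| m)%N) F d.
Proof.
move=> m0 mN; rewrite [RHS](@big_cat_nat _ _ _ m.+1 1 N.+1)//= [X in _ + X]big_nat_cond [X in _ + X]big_pred0 ?addr0//.
by move=> d; apply/negP => /andP[/andP[md _] /(dvdn_leq m0)]; rewrite leqNgt md.
Qed.

(** The multiplicativity of [divsum], in the form needed for an induction on the prime
    factorization. *)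
Lemma divsum_pfactor (R : realType) (B : R) (chi : nat -> R) (p k m : nat) : real_char B chi ->
  prime p -> (0 < m)%N -> ~~ (p %| m)%N ->
  divsum chi (p ^ k * m) = (\sum_(0 <= j < k.+1) chi p ^+ j) * divsum chi m.
Proof.
move=> hc pp m0 pm; elim: k => [|k IH]; first by rewrite expn0 mul1n big_nat1 expr0 mul1r.
have pk0 j : (0 < p ^ j * m)%N by rewrite muln_gt0 expn_gt0 prime_gt0.
rewrite [LHS]/divsum (bigID (fun d => p %| d)%N)/=.
have -> : \sum_(1 <= d < (p ^ k.+1 * m).+1 | (d %| p ^ k.+1 * m)%N && (p %| d)%N) chi d
    = chi p * divsum chi (p ^ k * m).
  transitivity (\sum_(1 <= d < (p ^ k.+1 * m).+1 | (p %| d)%N) (if (d %| p ^ k.+1 * m)%N then chi d else 0)).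
    by rewrite [RHS]big_mkcond/= [LHS]big_mkcond/=; apply: eq_bigr => d _; case: (p %| d)%N; case: (d %| _)%N.
  rewrite sum_dvd ?prime_gt0// expnS -mulnA mulKn ?prime_gt0// mulr_sumr [RHS]big_mkcond/=.
  apply: eq_bigr => d _; rewrite dvdn_pmul2l ?prime_gt0//.
  by case: ifP => //; case: hc => _ ->.
have -> : \sum_(1 <= d < (p ^ k.+1 * m).+1 | (d %| p ^ k.+1 * m)%N && ~~ (p %| d)%N) chi d = divsum chi m.
  rewrite /divsum (@big_nat_dvd _ _ m (p ^ k.+1 * m))// ?leq_pmull ?expn_gt0 ?prime_gt0//.
  apply: eq_bigl => d; apply/andP/idP => [[dp pd]|dm].
    by rewrite -(@Gauss_dvdr d (p ^ k.+1))// coprime_sym coprimeXl// prime_coprime.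
  by split; [rewrite dvdn_mull|apply: contra pm => /dvdn_trans; apply].
rewrite IH big_nat_recl//= expr0 mulrDl mul1r addrC mulrA; congr (_ + _ * _).
by rewrite mulr_sumr; apply: eq_bigr => j _; rewrite exprS.
Qed.

Lemma geom_sign (R : realType) (x : R) (k : nat) : [\/ x = 0, x = 1 | x = -1] ->
  0 <= \sum_(0 <= j < k.+1) x ^+ j /\ (~~ odd k -> 1 <= \sum_(0 <= j < k.+1) x ^+ j).
Proof.
case=> ->.
- rewrite big_nat_recl// expr0 big1_seq ?addr0; first by split.
  by move=> j _; rewrite expr0n.
- rewrite big_nat_recl// expr0.
  have h : 0 <= \sum_(0 <= i < k) (1 : R) ^+ i.+1 by apply: sumr_ge0 => i _; rewrite expr1n.
  by split => [|_]; lra.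
have -> : \sum_(0 <= j < k.+1) (-1 : R) ^+ j = (~~ odd k)%:R.
  elim: k => [|k IH]; first by rewrite big_nat1.
  rewrite big_nat_recr//= IH -signr_odd /=; case: (odd k) => /=; rewrite ?expr0 ?expr1; lra.
by split => [|->]; case: (odd k).
Qed.

(** Each prime contributes a geometric sum with ratio 0, 1 or -1, which is nonnegative, and at
    least 1 when it has an odd number of terms, as at squares. *)
Lemma divsum_ge0 (R : realType) (B : R) (chi : nat -> R) (n : nat) : real_char B chi -> (0 < n)%N ->
  0 <= divsum chi n /\ ((forall p, ~~ odd (logn p n)) -> 1 <= divsum chi n).
Proof.
move=> hc; elim/ltn_ind: n => n IH n0.
have [->|n1] := eqVneq n 1%N.
  by rewrite /divsum big_mkcond big_nat1 dvd1n; case: hc => -> _ _ _; split.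
have n2 : (1 < n)%N by rewrite ltn_neqAle eq_sym n1.
have pp := pdiv_prime n2; set p := pdiv n in pp.
have [m pm nE] := pfactor_coprime pp n0.
have m0 : (0 < m)%N by move: n0; rewrite nE muln_gt0 => /andP[].
have e0 : (0 < logn p n)%N by rewrite logn_gt0 mem_primes pp n0 pdiv_dvd.
have mn : (m < n)%N by rewrite nE -[X in (X < _)%N]muln1 ltn_pmul2l// -(exp1n (logn p n)) ltn_exp2r ?prime_gt1.
have [r0 r1] := IH m mn m0.
have ndp : ~~ (p %| m)%N by rewrite -prime_coprime.
have -> : divsum chi n = (\sum_(0 <= j < (logn p n).+1) chi p ^+ j) * divsum chi m.
  by rewrite {1}nE mulnC (divsum_pfactor _ hc).
have [_ _ /(_ p) hv _] := hc.
have [g0 g1] := geom_sign (logn p n) hv.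
split; first by rewrite mulr_ge0.
move=> ev; apply: mulr_ege1; first exact: g1.
apply: r1 => q; have := ev q.
have -> : logn q n = (logn q m + logn p n * logn q p)%N.
  by rewrite {1}nE lognM ?lognX// expn_gt0 prime_gt0.
by rewrite oddD oddM (negbTE (ev p)) addbF.
Qed.

Definition sq (R : realType) (k : nat) : R := Num.sqrt k%:R.

Lemma sq_ge0 (R : realType) (k : nat) : 0 <= sq R k.
Proof. exact: sqrtr_ge0. Qed.

Lemma sq_gt0 (R : realType) (k : nat) : (0 < k)%N -> 0 < sq R k.
Proof. by move=> k0; rewrite sqrtr_gt0 ltr0n. Qed.

Lemma sqK (R : realType) (k : nat) : sq R k ^+ 2 = k%:R.
Proof. by rewrite sqr_sqrtr. Qed.

Lemma sqM (R : realType) (k l : nat) : sq R (k * l) = sq R k * sq R l.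
Proof. by rewrite /sq natrM sqrtrM. Qed.

Lemma sq_le (R : realType) (k l : nat) : (k <= l)%N -> sq R k <= sq R l.
Proof. by move=> kl; rewrite /sq ler_sqrt ?ler_nat. Qed.

Lemma sqX2 (R : realType) (k : nat) : sq R (k ^ 2) = k%:R.
Proof. by rewrite /sq natrX sqrtr_sqr ger0_norm. Qed.

Lemma isq_le (R : realType) (k l : nat) : (0 < k)%N -> (k <= l)%N -> (sq R l)^-1 <= (sq R k)^-1.
Proof.
by move=> k0 kl; rewrite lef_pV2 ?posrE ?sq_gt0 ?sq_le//; apply: leq_trans kl.
Qed.

Definition hsum (R : realType) (k : nat) : R := \sum_(1 <= m < k.+1) (sq R m)^-1.

Lemma sq_step (R : realType) (k : nat) :
  (sq R k.+1)^-1 <= 2 * (sq R k.+1 - sq R k) /\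
  ((0 < k)%N -> 2 * (sq R k.+1 - sq R k) <= (sq R k)^-1).
Proof.
have := sqK R k; have := sqK R k.+1; rewrite -natr1.
have := sq_ge0 R k; have : 0 < sq R k.+1 by apply: sq_gt0.
set x := sq R k; set y := sq R k.+1 => y0 x0 ey ex.
have E : (y - x) * (x + y) = 1.
  by rewrite (_ : _ * _ = y ^+ 2 - x ^+ 2); [rewrite ey ex addrC addKr|ring].
have xy : x <= y by apply: sq_le.
split.
  rewrite -(ler_pM2l y0) mulfV ?gt_eqF//; nra.
move=> k0; have xp : 0 < x by apply: sq_gt0.
by rewrite -(ler_pM2l xp) mulfV ?gt_eqF//; nra.
Qed.

Lemma hsum_le (R : realType) (k : nat) : hsum R k <= 2 * sq R k.
Proof.
rewrite /hsum; elim: k => [|k IH]; first by rewrite big_geq// mulr_ge0 ?sq_ge0.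
by rewrite big_nat_recr//=; have [h _] := sq_step R k; lra.
Qed.

(** Comparison of the sum with the integral of the inverse square root. *)
Lemma hsum_asymp (R : realType) : exists C : R, forall k, (0 < k)%N ->
  `|hsum R k - 2 * sq R k - C| <= (sq R k)^-1.
Proof.
have [||C hC] := @sup_squeeze R (fun n => hsum R n.+1 - 2 * sq R n.+1) (fun n => (sq R n.+1)^-1).
- by move=> n; rewrite invr_ge0 sq_ge0.
- move=> m n mn.
  suff : 0 <= (hsum R m.+1 - 2 * sq R m.+1) - (hsum R n.+1 - 2 * sq R n.+1) <= (sq R m.+1)^-1 - (sq R n.+1)^-1.
    have : 0 < (sq R n.+1)^-1 by rewrite invr_gt0 sq_gt0.
    by move=> ? /andP[? ?]; rewrite ler_norml; apply/andP; split; lra.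
  elim: n mn => [|n IH]; first by rewrite leqn0 => /eqP ->; rewrite !subrr lexx.
  rewrite leq_eqVlt => /orP[/eqP->|]; first by rewrite !subrr lexx.
  rewrite ltnS => /IH; rewrite /hsum [\sum_(1 <= i < n.+3) _]big_nat_recr//=.
  by have [h1 /(_ isT) h2] := sq_step R n.+1; move=> /andP[? ?]; apply/andP; split; lra.
by exists C => -[//|k] _; apply: hC.
Qed.

Lemma harmonic_ge_ln (R : realType) (n : nat) : ln (n.+1%:R : R) <= \sum_(1 <= k < n.+1) k%:R^-1.
Proof.
elim: n => [|n IH]; first by rewrite ln1 big_geq.
rewrite big_nat_recr//=.
have -> : (n.+2%:R : R) = n.+1%:R * (1 + n.+1%:R^-1).
  by rewrite mulrDr mulr1 mulfV ?pnatr_eq0// natr1.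
have i0 : (0 : R) < n.+1%:R^-1 by rewrite invr_gt0.
rewrite lnM ?posrE ?ltr0n ?addr_gt0//; apply: lerD => //.
by apply: le_ln1Dx; rewrite (lt_trans _ i0)// ltrN10.
Qed.

Lemma sum_pairs (R : pzRingType) (chi g : nat -> R) (N : nat) :
  \sum_(1 <= n < N.+1) (\sum_(1 <= d < n.+1 | (d %| n)%N) chi d) * g n =
  \sum_(1 <= d < N.+1) \sum_(1 <= m < (N %/ d).+1) chi d * g (d * m)%N.
Proof.
transitivity (\sum_(1 <= n < N.+1) \sum_(1 <= d < N.+1) (if (d %| n)%N then chi d * g n else 0)).
  apply: eq_big_nat => n /andP[n0 nN]; rewrite (@big_nat_dvd _ _ n N)// big_mkcond mulr_suml.
  by apply: eq_bigr => d _; case: ifP => // _; rewrite mul0r.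
rewrite exchange_big_nat /=; apply: eq_big_nat => d /andP[d0 dN].
by rewrite -big_mkcond sum_dvd.
Qed.

Lemma sum_squares_le (R : numDomainType) (g : nat -> R) (T : nat) : (forall n, (0 < n)%N -> 0 <= g n) ->
  \sum_(1 <= k < T.+1) g (k ^ 2)%N <= \sum_(1 <= n < (T ^ 2).+1) g n.
Proof.
move=> g0; elim: T => [|T IH]; first by rewrite !big_geq.
rewrite big_nat_recr//= [X in _ <= X](@big_cat_nat _ _ _ (T ^ 2).+1 1)//=; last first.
  by rewrite ltnS leq_exp2r.
apply: lerD => //; rewrite big_nat_recr/=; last by rewrite ltn_exp2r.
rewrite lerDr big_nat_cond sumr_ge0// => i /andP[/andP[Ti _] _].
by apply: g0; apply: leq_ltn_trans Ti.
Qed.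

(** The terms of [\sum divsum n / sqrt n] at squares already give a harmonic sum. *)
Lemma hyperbola_lower (R : realType) (B : R) (chi : nat -> R) (T : nat) : real_char B chi ->
  ln (T.+1%:R : R) <= \sum_(1 <= d < (T ^ 2).+1) \sum_(1 <= m < (T ^ 2 %/ d).+1) chi d * (sq R (d * m))^-1.
Proof.
move=> hc; rewrite -(sum_pairs chi (fun n => (sq R n)^-1)).
apply: le_trans (harmonic_ge_ln R T) _.
have ds n : (0 < n)%N -> 0 <= divsum chi n * (sq R n)^-1.
  by move=> n0; rewrite mulr_ge0 ?invr_ge0 ?sq_ge0//; case: (divsum_ge0 hc n0).
apply: le_trans (sum_squares_le T ds).
apply: ler_sum_nat => k /andP[k0 _]; rewrite sqX2 ler_peMl ?invr_ge0//.
have [|_ ->//] := @divsum_ge0 R B chi (k ^ 2) hc; first by rewrite expn_gt0 k0.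
by move=> q; rewrite lognX oddM.
Qed.

Lemma exchange_hyperbola (R : nmodType) (F : nat -> nat -> R) (T : nat) :
  \sum_(T.+1 <= d < (T ^ 2).+1) \sum_(1 <= m < (T ^ 2 %/ d).+1) F d m =
  \sum_(1 <= m < T.+1) \sum_(T.+1 <= d < (T ^ 2 %/ m).+1) F d m.
Proof.
transitivity (\sum_(T.+1 <= d < (T ^ 2).+1) \sum_(1 <= m < T.+1 | (d * m <= T ^ 2)%N) F d m).
  apply: eq_big_nat => d /andP[Td dT].
  rewrite (big_nat_widen _ _ T.+1) /=; last first.
    by have := leq_trunc_div (T ^ 2) d; move: Td; rewrite ltnS; nia.
  by apply: eq_bigl => m; rewrite ltnS leq_divRL ?(leq_trans _ Td)// mulnC.
under eq_bigr do rewrite big_mkcond.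
rewrite exchange_big_nat/=; apply: eq_big_nat => m /andP[m0 mT].
rewrite -big_mkcond [RHS](big_nat_widen _ _ (T ^ 2).+1) /=; last first.
  by rewrite ltnS leq_div.
by apply: eq_bigl => d; rewrite ltnS leq_divRL.
Qed.

(** Dirichlet's hyperbola method for [\sum divsum n / sqrt n] up to [T ^ 2]: apart from bounded
    terms only [2 T] times a partial sum of [L(1, chi)] remains. *)
Lemma hyperbola_upper (R : realType) (B C : R) (chi : nat -> R) (T : nat) : real_char B chi ->
  (forall k, (0 < k)%N -> `|hsum R k - 2 * sq R k - C| <= (sq R k)^-1) -> (0 < T)%N ->
  `|\sum_(1 <= d < (T ^ 2).+1) \sum_(1 <= m < (T ^ 2 %/ d).+1) chi d * (sq R (d * m))^-1
    - 2 * T%:R * Lpart chi T| <= 2 * B * `|C| + 6 + 4 * B.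
Proof.
move=> hc hC T0; have B0 := real_char_B0 hc; have [_ _ _ hB] := hc.
have sT : 0 < sq R T by apply: sq_gt0.
have isq0 k : 0 <= (sq R k)^-1 by rewrite invr_ge0 sq_ge0.
rewrite (@big_cat_nat _ _ _ T.+1 1 (T ^ 2).+1)//=; last by rewrite ltnS; nia.
set S1 := (X in `|X + _ - _|); set S2 := (X in `|_ + X - _|).
have h2 : `|S2| <= 4 * B.
  rewrite /S2 exchange_hyperbola; apply: le_trans (ler_norm_sum _ _ _) _.
  apply: (@le_trans _ _ (\sum_(1 <= m < T.+1) (sq R m)^-1 * (2 * B * (sq R T)^-1))).
    apply: ler_sum_nat => m /andP[m0 mT].
    under eq_bigr do rewrite sqM invfM mulrA mulrC.
    rewrite -mulr_sumr normrM ger0_norm//; apply: ler_wpM2l => //.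
    have [le|gt] := leqP T.+1 (T ^ 2 %/ m).+1; last first.
      by rewrite big_geq ?normr0 ?mulr_ge0//; exact: ltnW.
    apply: le_trans (@abel_bound R chi (fun d => (sq R d)^-1) B T.+1 _ hB _ isq0 le) _.
      by move=> n Tn; apply: isq_le => //; apply: leq_ltn_trans Tn.
    by rewrite ler_wpM2l ?mulr_ge0// isq_le.
  rewrite -mulr_suml; have := hsum_le R T; rewrite /hsum => h.
  apply: (@le_trans _ _ (2 * sq R T * (2 * B * (sq R T)^-1))).
    by rewrite ler_wpM2r ?mulr_ge0.
  by rewrite (_ : _ * _ = 4 * B)//; field; rewrite gt_eqF.
have h1 : `|S1 - 2 * T%:R * Lpart chi T - C * \sum_(1 <= d < T.+1) chi d * (sq R d)^-1| <= 6.
  rewrite /S1 /Lpart !mulr_sumr -!sumrB; apply: le_trans (ler_norm_sum _ _ _) _.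
  apply: (@le_trans _ _ (\sum_(1 <= d < T.+1) (sq R d)^-1 * (3 * (sq R T)^-1))).
    apply: ler_sum_nat => d /andP[d0 dT].
    under eq_bigr do rewrite sqM invfM mulrA.
    rewrite -mulr_sumr -/(hsum R _); set k := (T ^ 2 %/ d)%N.
    have kT : (T <= k)%N by rewrite leq_divRL// -mulnn leq_mul.
    have k0 : (0 < k)%N by apply: leq_trans kT.
    have sd : 0 < sq R d by apply: sq_gt0.
    have dE : d%:R^-1 = (sq R d)^-1 * (sq R d)^-1 by rewrite -invfM -expr2 sqK.
    rewrite (_ : _ - _ - _ = chi d * (sq R d)^-1 * (hsum R k - 2 * (T%:R * (sq R d)^-1) - C)); last by rewrite dE; ring.
    rewrite normrM; apply: ler_pM => //.
      by rewrite normrM (ger0_norm (isq0 _)) ler_piMl// (real_char_le1 _ hc).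
    have hk := hC _ k0.
    have kd : sq R k * sq R d <= T%:R.
      by rewrite -sqM -sqX2; apply: sq_le; apply: leq_trunc_div.
    have kd1 : T%:R <= sq R k.+1 * sq R d.
      by rewrite -sqM -sqX2; apply: sq_le; rewrite ltnW// ltn_ceil.
    have a1 : sq R k <= T%:R * (sq R d)^-1 by rewrite ler_pdivlMr.
    have a2 : T%:R * (sq R d)^-1 <= sq R k.+1 by rewrite ler_pdivrMr.
    have [_ /(_ k0) a3] := sq_step R k.
    have a4 : (sq R k)^-1 <= (sq R T)^-1 by apply: isq_le.
    have a5 := isq0 T.
    by move: hk; rewrite !ler_norml => /andP[? ?]; apply/andP; split; lra.
  rewrite -mulr_suml; have := hsum_le R T; rewrite /hsum => h.
  apply: (@le_trans _ _ (2 * sq R T * (3 * (sq R T)^-1))).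
    by rewrite ler_wpM2r ?mulr_ge0.
  by rewrite (_ : _ * _ = 6)//; field; rewrite gt_eqF.
have h3 : `|\sum_(1 <= d < T.+1) chi d * (sq R d)^-1| <= 2 * B.
  have i1 : (sq R 1)^-1 = 1 by rewrite -[1%N]/(1 ^ 2)%N sqX2 invr1.
  have := @abel_bound R chi (fun d => (sq R d)^-1) B 1 T.+1 hB _ isq0 isT.
  by rewrite i1 mulr1; apply => n n0; apply: isq_le.
set Z := \sum_(_ <= d < _) _ in h1 h3.
rewrite (_ : _ - _ = (S1 - 2 * T%:R * Lpart chi T - C * Z) + C * Z + S2); last by ring.
apply: le_trans (ler_normD _ _) _; apply: lerD => //.
apply: le_trans (ler_normD _ _) _; rewrite addrC; apply: lerD => //.
by rewrite normrM mulrC ler_wpM2r.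
Qed.

(** If [L(1, chi)] were zero, its partial sums would be [O(1 / T)], and the upper bound of the
    hyperbola method would be bounded while the lower bound grows like [ln T]. *)
Lemma L_neq0 (R : realType) (B L : R) (chi : nat -> R) : real_char B chi ->
  (forall n, `|Lpart chi n - L| <= 2 * B / n.+1%:R) -> L != 0.
Proof.
move=> hc hL; apply/eqP => L0; have B0 := real_char_B0 hc.
have [C hC] := hsum_asymp R.
pose K := 2 * B * `|C| + 6 + 8 * B.
pose T := (Num.truncn (expR K)).+1.
have := hyperbola_upper hc hC (isT : 0 < T)%N.
have := hyperbola_lower T hc.
have TK : K < ln T.+1%:R.
  rewrite -[K]expRK ltr_ln ?posrE ?expR_gt0 ?ltr0n//.
  apply: lt_trans (truncnS_gt (expR K)) _; by rewrite ltr_nat.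
have hT : `|2 * T%:R * Lpart chi T| <= 4 * B.
  have := hL T; rewrite L0 subr0 => h.
  rewrite normrM ger0_norm ?mulr_ge0//.
  apply: (@le_trans _ _ (2 * T%:R * (2 * B / T.+1%:R))); first by rewrite ler_wpM2l ?mulr_ge0.
  rewrite (_ : _ * _ = (T%:R / T.+1%:R) * (4 * B)); last by ring.
  rewrite -[leRHS]mul1r ler_wpM2r ?mulr_ge0// ler_pdivrMr ?ltr0n// mul1r ler_nat //.
set S := \sum_(_ <= d < _) _ => h1 h2.
move: hT h2; rewrite !ler_norml => /andP[? ?] /andP[? ?].
by rewrite /K in TK; lra.
Qed.

(** * Chebyshev and Mertens bounds *)

Lemma primes_prod_dvd (s : seq nat) (n : nat) : uniq s -> all prime s ->
  all (fun p => p %| n)%N s -> (\prod_(p <- s) p %| n)%N.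
Proof.
elim: s => [|p s IH] /=; first by rewrite big_nil dvd1n.
move=> /andP[ps us] /andP[pp sp] /andP[pn sn].
by rewrite big_cons Gauss_dvd ?coprime_primes_prod// pn IH.
Qed.

Lemma prime_dvd_fact (p m : nat) : prime p -> (p %| m`!)%N -> (p <= m)%N.
Proof.
move=> pp; elim: m => [|m IH]; first by rewrite fact0 dvdn1 => /eqP p1; rewrite p1 in pp.
rewrite factS Euclid_dvdM// => /orP[/dvdn_leq->//|/IH]; exact: leqW.
Qed.

Lemma central_bin_dvd (m p : nat) : prime p -> (m < p)%N -> (p <= m.*2)%N -> (p %| 'C(m.*2, m))%N.
Proof.
move=> pp mp p2m.
have E := bin_fact (leq_addr m m); rewrite addnK addnn in E.
have : (p %| (m.*2)`!)%N by rewrite dvdn_fact// prime_gt0.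
rewrite -E !Euclid_dvdM// => /orP[//|]; rewrite orbb => /(prime_dvd_fact pp).
by rewrite leqNgt mp.
Qed.

(** Chebyshev's function. *)
Definition theta (R : realType) (N : nat) : R := \sum_(1 <= p < N.+1 | prime p) ln p%:R.

Lemma ln_le_pred (R : realType) (n : nat) : (0 < n)%N -> ln (n%:R : R) <= n%:R - 1.
Proof.
move=> n0; rewrite (_ : ln n%:R = ln (1 + (n%:R - 1))); last by congr ln; ring.
by apply: le_ln1Dx; rewrite ltrBDr addrC subrr ltr0n.
Qed.

Lemma ln_nat_ge0 (R : realType) (n : nat) : 0 <= ln (n%:R : R).
Proof. by case: n => [|n]; [rewrite ln0|apply: ln_ge0; rewrite ler1n]. Qed.

Lemma prod_seq_gt0 (s : seq nat) : all (fun p => 0 < p)%N s -> (0 < \prod_(p <- s) p)%N.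
Proof.
elim: s => [|p s IH] /=; first by rewrite big_nil.
by move=> /andP[p0 s0]; rewrite big_cons muln_gt0 p0 IH.
Qed.

Lemma ln_prod_seq (R : realType) (s : seq nat) : all (fun p => 0 < p)%N s ->
  ln ((\prod_(p <- s) p)%N%:R : R) = \sum_(p <- s) ln p%:R.
Proof.
elim: s => [|p s IH] /=; first by rewrite !big_nil ln1.
move=> /andP[p0 s0]; rewrite !big_cons natrM lnM ?posrE ?ltr0n// ?IH//.
exact: prod_seq_gt0.
Qed.

(** The primes between [m] and [2 m] divide the central binomial coefficient, which is at most
    [4 ^ m]. *)
Lemma theta_double (R : realType) (m : nat) : theta R m.*2 <= theta R m + 3 * m%:R.
Proof.
rewrite /theta (@big_cat_nat _ _ _ m.+1 1 m.*2.+1)//=; last by rewrite ltnS -addnn leq_addr.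
rewrite lerD2l -big_filter -ln_prod_seq; last first.
  by apply/allP => p; rewrite mem_filter => /andP[/prime_gt0].
set s := [seq _ <- _ | _].
have d : (\prod_(p <- s) p %| 'C(m.*2, m))%N.
  apply: primes_prod_dvd; rewrite ?filter_uniq ?iota_uniq//.
    by apply/allP => p; rewrite mem_filter => /andP[].
  apply/allP => p; rewrite mem_filter mem_index_iota => /and3P[pp mp p2].
  by apply: central_bin_dvd.
have le : (\prod_(p <- s) p <= 4 ^ m)%N.
  apply: leq_trans (dvdn_leq _ d) _; first by rewrite bin_gt0 -addnn leq_addr.
  have := expnDn 1 1 m.*2; rewrite addn1 => h.
  rewrite -[4%N]/(2 ^ 2)%N -expnM mul2n h (bigD1 (inord m : 'I_m.*2.+1))//= inordK; last by rewrite ltnS -addnn leq_addr.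
  by rewrite !exp1n !muln1 leq_addr.
have s0 : (0 < \prod_(p <- s) p)%N.
  by apply: prod_seq_gt0; apply/allP => p; rewrite mem_filter => /andP[/prime_gt0].
apply: (@le_trans _ _ (ln ((4 ^ m)%N%:R : R))).
  by rewrite ler_ln ?posrE ?ltr0n ?expn_gt0// ler_nat.
rewrite natrX lnXn ?ltr0n// -[ln _ *+ m]mulr_natr ler_wpM2r//.
by have := @ln_le_pred R 4 isT; lra.
Qed.

Lemma theta_le (R : realType) (n : nat) : theta R n <= 12 * n%:R.
Proof.
elim/ltn_ind: n => n IH; case: n IH => [|n] IH; first by rewrite /theta big_geq// mulr0.
set m := (n.+1)./2; have mn : (m < n.+1)%N by rewrite /m; lia.
have h2 : theta R m.*2 <= 15 * m%:R by have := theta_double R m; have := IH _ mn; lra.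
have m0 : 0 <= (m%:R : R) by [].
have [od|ev] := boolP (odd n.+1).
  have nE : n.+1 = m.*2.+1 by rewrite -[LHS]odd_double_half od.
  rewrite nE {1}/theta big_mkcond big_nat_recr//= -big_mkcond -/(theta R m.*2).
  have : (if prime m.*2.+1 then ln (m.*2.+1%:R : R) else 0) <= m.*2%:R.
    have := @ln_le_pred R m.*2.+1 isT; rewrite -natr1 addrK => h.
    by case: ifP.
  have -> : (m.*2.+1%:R : R) = 2 * m%:R + 1 by rewrite -natr1 -muln2 natrM mulrC.
  have -> : (m.*2%:R : R) = 2 * m%:R by rewrite -muln2 natrM mulrC.
  by move: (if _ then _ else _) => u; lra.
have nE : n.+1 = m.*2 by rewrite -[LHS]odd_double_half (negbTE ev).
by rewrite nE -muln2 natrM muln2; lra.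
Qed.

(** The logarithm as the sum of von Mangoldt's function over the divisors. *)
Lemma ln_factor (R : realType) (n N : nat) : (0 < n)%N -> (n <= N)%N ->
  ln (n%:R : R) = \sum_(1 <= p < N.+1 | prime p) \sum_(1 <= k < N.+1 | (p ^ k %| n)%N) ln p%:R.
Proof.
move=> n0 nN.
have nE : n = (\prod_(1 <= p < N.+1) p ^ logn p n)%N.
  rewrite -[LHS](partnT n0) (widen_partn _ nN) (eq_bigl predT)//.
  by rewrite big_ltn_cond//= [logn 0 n]lognE expn0 mul1n.
rewrite {1}nE -(big_map (fun p => p ^ logn p n)%N predT id) /= ln_prod_seq; last first.
  apply/allP => _ /mapP[p + ->]; rewrite mem_index_iota => /andP[p0 _].
  by rewrite expn_gt0 p0.
rewrite big_map [RHS]big_mkcond; apply: eq_big_nat => p /andP[p0 _].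
case: ifP => pp; last first.
  by rewrite [logn _ _](_ : _ = 0%N) ?expn0 ?ln1//; move: pp; rewrite lognE => ->.
have le : (logn p n <= N)%N by apply: leq_trans nN; rewrite ltnW// ltn_logl.
rewrite natrX lnXn ?ltr0n//.
rewrite (eq_bigl (fun k => (k < (logn p n).+1)%N)); last by move=> k; rewrite ltnS pfactor_dvdn.
by rewrite -(big_nat_widen 1 (logn p n).+1 N.+1 predT)// sumr_const_nat subn1.
Qed.

Lemma sum_ln_factor (R : realType) (f : nat -> R) (N : nat) :
  \sum_(1 <= n < N.+1) f n * ln n%:R =
  \sum_(1 <= p < N.+1 | prime p) ln p%:R *
    \sum_(1 <= k < N.+1) \sum_(1 <= m < (N %/ p ^ k).+1) f (p ^ k * m)%N.
Proof.
transitivity (\sum_(1 <= n < N.+1) \sum_(1 <= p < N.+1 | prime p) \sum_(1 <= k < N.+1)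
   (if (p ^ k %| n)%N then ln p%:R * f n else 0)).
  apply: eq_big_nat => n /andP[n0 nN]; rewrite (@ln_factor _ n N)// mulr_sumr.
  apply: eq_bigr => p _; rewrite big_mkcond mulr_sumr; apply: eq_bigr => k _.
  by case: ifP; rewrite ?mulr0// mulrC.
rewrite exchange_big_nat/=; apply: eq_bigr => p pp.
rewrite exchange_big_nat/= mulr_sumr; apply: eq_bigr => k _.
by rewrite -big_mkcond sum_dvd ?expn_gt0 ?prime_gt0// mulr_sumr.
Qed.

Lemma geom_tail_le (R : realType) (p N : nat) : (1 < p)%N ->
  0 <= \sum_(2 <= k < N.+1) ((p ^ k)%N%:R : R)^-1 <= 2 * (p%:R ^+ 2)^-1.
Proof.
move=> p1; set x : R := p%:R^-1.
have p2 : (2 : R) <= p%:R by rewrite ler_nat.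
have x0 : 0 < x by rewrite invr_gt0; lra.
have x2 : x <= 2^-1 by rewrite lef_pV2 ?posrE//; lra.
have -> : \sum_(2 <= k < N.+1) ((p ^ k)%N%:R : R)^-1 = \sum_(2 <= k < N.+1) x ^+ k.
  by apply: eq_bigr => k _; rewrite natrX exprVn.
have -> : (p%:R ^+ 2)^-1 = x ^+ 2 by rewrite exprVn.
apply/andP; split; first by apply: sumr_ge0 => k _; rewrite exprn_ge0// ltW.
have h : \sum_(2 <= k < N.+1) x ^+ k * (1 - x) <= x ^+ 2.
  case: N => [|N]; first by rewrite big_geq// exprn_ge0// ltW.
  have -> : \sum_(2 <= k < N.+2) x ^+ k * (1 - x) = x ^+ 2 - x ^+ N.+2.
    elim: N => [|N IH]; first by rewrite big_geq// subrr.
    by rewrite big_nat_recr//= IH [x ^+ N.+3]exprS; ring.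
  by rewrite gerBl exprn_ge0// ltW.
rewrite -mulr_suml in h; set S := \sum_(_ <= k < _) _ in h *.
have S0 : 0 <= S by apply: sumr_ge0 => k _; rewrite exprn_ge0// ltW.
by nra.
Qed.

Lemma ln_le_sq (R : realType) (n : nat) : (0 < n)%N -> ln (n%:R : R) <= 2 * sq R n.
Proof.
move=> n0; rewrite -sqK lnXn ?sq_gt0// mulr_natl ler_pMn2r//.
by rewrite ltW// ln_sublinear// sq_gt0.
Qed.

(** The partial sums are dominated by the telescoping bound [4 - 4 / sqrt N]. *)
Lemma sum_ln_div_sqr (R : realType) (N : nat) :
  \sum_(1 <= n < N.+1) ln (n%:R : R) * (n%:R ^+ 2)^-1 <= 4.
Proof.
case: N => [|N]; first by rewrite big_geq.
suff : \sum_(1 <= n < N.+2) ln (n%:R : R) * (n%:R ^+ 2)^-1 <= 4 - 4 * (sq R N.+1)^-1.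
  by have : 0 <= (sq R N.+1)^-1; [rewrite invr_ge0 sq_ge0|lra].
elim: N => [|N IH]; first by rewrite big_nat1 ln1 mul0r -[1%N]/(1 ^ 2)%N sqX2 invr1 mulr1 subrr.
rewrite big_nat_recr//=.
rewrite (_ : 4 - 4 / sq R N.+2 = (4 - 4 / sq R N.+1) + (4 * (sq R N.+1)^-1 - 4 * (sq R N.+2)^-1)); last by ring.
apply: lerD => //.
have hy : 0 < sq R N.+2 by apply: sq_gt0.
have hx : 0 < sq R N.+1 by apply: sq_gt0.
have := sqK R N.+2; have := sqK R N.+1; have := @ln_le_sq R N.+2 isT.
have := @sq_le R N.+1 N.+2 (leqnSn _).
set x := sq R N.+1 in hx *; set y := sq R N.+2 in hy * => xy hl ex ey.
have yx1 : (y - x) * (x + y) = 1.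
  by rewrite (_ : _ * _ = y ^+ 2 - x ^+ 2); [rewrite ey ex -natrB// subSnn|ring].
apply: (@le_trans _ _ (2 * y * (N.+2%:R ^+ 2)^-1)).
  by rewrite ler_wpM2r// invr_ge0 exprn_ge0.
rewrite -ey -exprM.
have -> : 2 * y * (y ^+ (2 * 2))^-1 = 2 * (y ^+ 3)^-1.
  by rewrite (exprS y 3); field; rewrite gt_eqF.
have -> : 4 * x^-1 - 4 * y^-1 = 4 * ((x + y) * (x * y))^-1.
  have E : y - x = (x + y)^-1.
    by apply: (mulIf (_ : x + y != 0)); rewrite ?yx1 ?mulVf// gt_eqF// addr_gt0.
  rewrite invfM -E; field; by rewrite !gt_eqF.
rewrite (_ : 2 * (y ^+ 3)^-1 = 4 * (2 * y ^+ 3)^-1); last by field; rewrite gt_eqF.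
rewrite ler_wpM2l// lef_pV2 ?posrE ?mulr_gt0 ?exprn_gt0 ?addr_gt0//.
have : x * y <= y ^+ 2 by nra.
have : x + y <= 2 * y by lra.
move=> h1 h2; rewrite (_ : 2 * y ^+ 3 = (2 * y) * y ^+ 2); last by ring.
by apply: ler_pM => //; rewrite ?mulr_ge0 ?addr_ge0 ?ltW.
Qed.

Lemma prime_powers_le (R : realType) (N : nat) :
  \sum_(1 <= p < N.+1 | prime p) ln (p%:R : R) * \sum_(2 <= k < N.+1) ((p ^ k)%N%:R)^-1 <= 8.
Proof.
apply: (@le_trans _ _ (\sum_(1 <= n < N.+1) 2 * (ln (n%:R : R) * (n%:R ^+ 2)^-1))).
  rewrite big_mkcond; apply: ler_sum_nat => p /andP[p0 _]; case: ifP => pp.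
    rewrite mulrCA; apply: ler_wpM2l; first exact: ln_nat_ge0.
    by have /andP[] := geom_tail_le R N (prime_gt1 pp).
  by rewrite !mulr_ge0 ?ln_nat_ge0// invr_ge0 exprn_ge0.
by rewrite -mulr_sumr; have := sum_ln_div_sqr R N; lra.
Qed.

(** The weights of Mertens' theorem. *)
Definition psum (R : realType) (g : nat -> R) (N : nat) : R :=
  \sum_(1 <= p < N.+1 | prime p) g p * (ln p%:R * p%:R^-1).

(** The lower half of Mertens' estimate, from [ln (N!)]: Stirling's lower bound on one side, the
    factorization on the other. *)
Lemma mertens_lower (R : realType) (N : nat) : (0 < N)%N -> ln (N%:R : R) - 9 <= psum (fun=> 1) N.
Proof.
move=> N0.
have l1 : N%:R * ln (N%:R : R) - N%:R <= \sum_(1 <= n < N.+1) 1 * ln n%:R.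
  under eq_bigr do rewrite mul1r.
  elim: N {N0} => [|N IH]; first by rewrite big_geq// mul0r subrr.
  rewrite big_nat_recr//=; case: N IH => [|N] IH.
    by rewrite big_geq// ln1 mulr0 add0r addr0; lra.
  have -> : ln (N.+2%:R : R) = ln N.+1%:R + ln (1 + N.+1%:R^-1).
    rewrite -lnM ?posrE ?ltr0n ?addr_gt0 ?invr_gt0//; congr ln.
    by rewrite mulrDr mulr1 mulfV ?pnatr_eq0// natr1.
  have : ln (1 + (N.+1%:R : R)^-1) <= N.+1%:R^-1.
    by apply: le_ln1Dx; apply: (@lt_trans _ _ 0); rewrite ?ltrN10// invr_gt0.
  rewrite -(ler_pM2l (_ : 0 < N.+1%:R)) ?mulfV ?pnatr_eq0// => h.
  by move: IH h; rewrite -[N.+2%:R]natr1; lra.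
have l2 : \sum_(1 <= n < N.+1) 1 * ln n%:R <= N%:R * (psum (fun=> 1) N + 8 : R).
  rewrite (sum_ln_factor (fun=> 1)).
  have := prime_powers_le R N; set S := BIG_F => hS.
  apply: (@le_trans _ _ (N%:R * (psum (fun=> 1) N + \sum_(1 <= p < N.+1 | prime p) ln (p%:R : R) * \sum_(2 <= k < N.+1) ((p ^ k)%N%:R)^-1))); last first.
    by rewrite ler_wpM2l// lerD2l.
  rewrite /psum -big_split /= mulr_sumr; apply: ler_sum => p pp.
  rewrite mul1r -mulrDr mulrCA; apply: ler_wpM2l; first exact: ln_nat_ge0.
  rewrite big_ltn// expn1 mulrDr; apply: lerD.
    rewrite sumr_const_nat subn1 /= ler_pdivlMr ?ltr0n ?prime_gt0// -natrM ler_nat.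
    exact: leq_trunc_div.
  rewrite mulr_sumr; apply: ler_sum => k _.
  rewrite sumr_const_nat subn1 /= ler_pdivlMr ?ltr0n ?expn_gt0 ?prime_gt0// -natrM ler_nat.
  exact: leq_trunc_div.
have Np : 0 < (N%:R : R) by rewrite ltr0n.
by rewrite -(ler_pM2l Np); lra.
Qed.

(** * Shapiro's estimate *)

Lemma ln2_ge (R : realType) : 2^-1 <= ln (2 : R).
Proof.
have := @le_ln1Dx R (- 2^-1).
have -> : 1 + - 2^-1 = (2 : R)^-1 by field.
rewrite lnV ?posrE//; lra.
Qed.

Lemma ln_div_decr (R : realType) (n : nat) : (4 <= n)%N ->
  ln (n.+1%:R : R) * n.+1%:R^-1 <= ln n%:R * n%:R^-1.
Proof.
move=> n4; have n0 : (0 < n)%N by apply: leq_trans n4.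
have p0 : 0 < (n%:R : R) by rewrite ltr0n.
have p1 : 0 < (n.+1%:R : R) by rewrite ltr0n.
rewrite ler_pdivrMr// mulrAC ler_pdivlMr//.
have l4 : 1 <= ln (n%:R : R).
  apply: (@le_trans _ _ (ln (2 ^+ 2 : R))).
    by rewrite lnXn ?ltr0n//; have := ln2_ge R; rewrite [ln 2 *+ 2]mulr2n; lra.
  by rewrite -natrX ler_ln ?posrE ?ltr0n// ler_nat.
have -> : ln (n.+1%:R : R) = ln n%:R + ln (1 + n%:R^-1).
  rewrite -lnM ?posrE// ?addr_gt0 ?invr_gt0//; congr ln.
  by rewrite mulrDr mulr1 mulfV ?gt_eqF// natr1.
have : ln (1 + (n%:R : R)^-1) <= n%:R^-1.
  by apply: le_ln1Dx; apply: (@lt_trans _ _ 0); rewrite ?ltrN10// invr_gt0.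
rewrite -(ler_pM2l p0) mulfV ?gt_eqF// => h.
by rewrite -natr1; lra.
Qed.

(** Partial summation from [n = 4] on, where [ln n / n] decreases; the first terms are bounded
    one by one. *)
Lemma twisted_log_sum_le (R : realType) (B : R) (chi : nat -> R) (N : nat) : real_char B chi ->
  `|\sum_(1 <= n < N.+1) (chi n * n%:R^-1) * ln n%:R| <= 3 + 2 * B.
Proof.
move=> hc; have B0 := real_char_B0 hc; have [_ _ _ hB] := hc.
have h1 n : `|chi n * n%:R^-1 * ln n%:R| <= 1.
  rewrite -mulrA normrM -[leRHS]mulr1; apply: ler_pM => //; first exact: (real_char_le1 _ hc).
  rewrite ger0_norm ?mulr_ge0 ?invr_ge0 ?ln_nat_ge0//.
  case: n => [|n]; first by rewrite invr0 mul0r ler01.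
  rewrite mulrC ler_pdivrMr ?ltr0n// mul1r ltW// ln_sublinear// ltr0n.
have small M : (M <= 4)%N -> `|\sum_(1 <= n < M) (chi n * n%:R^-1) * ln n%:R| <= 3.
  move=> M4; apply: le_trans (ler_norm_sum _ _ _) _.
  apply: (@le_trans _ _ (\sum_(1 <= n < M) 1)); first by apply: ler_sum.
  by rewrite sumr_const_nat -[3]/(3%:R) ler_nat; lia.
have [N4|N4] := leqP N.+1 4; first by have := small _ N4; lra.
rewrite (@big_cat_nat _ _ _ 4 1 N.+1)//=; last exact: ltnW.
apply: le_trans (ler_normD _ _) _; apply: lerD; first exact: small.
under eq_bigr do rewrite -mulrA [_^-1 * _]mulrC.
have := @abel_bound R chi (fun n => ln n%:R * n%:R^-1) B 4 N.+1 hB.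
move=> /(_ (@ln_div_decr R)) /(_ _ (ltnW N4)) h.
apply: le_trans (h _) _; first by move=> n; rewrite mulr_ge0 ?invr_ge0 ?ln_nat_ge0.
rewrite ler_piMr ?mulr_ge0// ler_pdivrMr ?ltr0n// mul1r ltW// ln_sublinear// ltr0n.
Qed.

Lemma Lpart_bound (R : realType) (B : R) (chi : nat -> R) (N : nat) : real_char B chi ->
  `|Lpart chi N| <= 2 * B.
Proof.
move=> hc; have B0 := real_char_B0 hc; have [_ _ _ hB] := hc.
have := @abel_bound R chi (fun n => n%:R^-1) B 1 N.+1 hB.
rewrite invr1 mulr1; apply => //.
by move=> n n0; rewrite lef_pV2 ?posrE ?ltr0n// ler_nat.
Qed.

(** Expand [\sum chi n * ln n / n], which is bounded, over the prime powers dividing [n]: the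
    primes give [L(1, chi) * psum chi N] up to an error that Chebyshev's bound controls, and
    higher prime powers converge. Since [L(1, chi) != 0], one can divide. *)
Lemma shapiro (R : realType) (B : R) (chi : nat -> R) : real_char B chi ->
  exists C : R, forall N, `|psum chi N| <= C.
Proof.
move=> hc; have B0 := real_char_B0 hc; have [c1 cM _ hB] := hc.
have [L hL] := L_exists hc; have L0 := L_neq0 hc hL.
exists ((3 + 2 * B + 24 * B + 16 * B) / `|L|) => N.
rewrite ler_pdivlMr ?normr_gt0// -normrM.
have [->|N0] := posnP N.
  by rewrite /psum big_geq// mul0r normr0; rewrite ?addr_ge0 ?mulr_ge0.
have hS := twisted_log_sum_le N hc.
rewrite (sum_ln_factor (fun n => chi n * n%:R^-1)) in hS.
have E p : prime p -> ln (p%:R : R) * (\sum_(1 <= k < N.+1) \sum_(1 <= m < (N %/ p ^ k).+1) chi (p ^ k * m)%N * (p ^ k * m)%:R^-1) =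
   chi p * (ln p%:R * p%:R^-1) * L + (ln p%:R * (chi p * p%:R^-1 * (Lpart chi (N %/ p) - L))
   + ln p%:R * \sum_(2 <= k < N.+1) chi (p ^ k)%N * (p ^ k)%:R^-1 * Lpart chi (N %/ p ^ k)).
  move=> pp.
  have -> : \sum_(1 <= k < N.+1) \sum_(1 <= m < (N %/ p ^ k).+1) chi (p ^ k * m)%N * (p ^ k * m)%:R^-1
     = \sum_(1 <= k < N.+1) chi (p ^ k)%N * (p ^ k)%:R^-1 * Lpart chi (N %/ p ^ k).
    apply: eq_bigr => k _; rewrite /Lpart mulr_sumr; apply: eq_bigr => m _.
    by rewrite cM natrM invfM; ring.
  by rewrite big_ltn// expn1; ring.
rewrite (eq_bigr _ E) !big_split /= -mulr_suml in hS.
rewrite -/(psum chi N) in hS.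
set E1 := (X in _ + (X + _)) in hS; set E2 := (X in _ + (_ + X)) in hS.
have h1 : `|E1| <= 24 * B.
  apply: le_trans (ler_norm_sum _ _ _) _.
  apply: (@le_trans _ _ (\sum_(1 <= p < N.+1 | prime p) ln (p%:R : R) * (2 * B / N%:R))).
    apply: ler_sum => p pp; rewrite normrM (ger0_norm (ln_nat_ge0 _ _)).
    apply: ler_wpM2l; first exact: ln_nat_ge0.
    rewrite normrM normrM normfV normr_nat.
    apply: (@le_trans _ _ (1 * p%:R^-1 * (2 * B / (N %/ p).+1%:R))).
      by apply: ler_pM => //; rewrite ?mulr_ge0// ler_wpM2r// (real_char_le1 _ hc).
    rewrite mul1r mulrCA ler_wpM2l ?mulr_ge0// -invfM -natrM lef_pV2 ?posrE ?ltr0n ?muln_gt0 ?(prime_gt0 pp)//.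
    by rewrite ler_nat ltnW// mulnC ltn_ceil// prime_gt0.
  rewrite -mulr_suml; have := theta_le R N; rewrite /theta => h.
  have Np : 0 < (N%:R : R) by rewrite ltr0n.
  apply: (@le_trans _ _ (12 * N%:R * (2 * B / N%:R))).
    by rewrite ler_wpM2r// divr_ge0// mulr_ge0.
  by rewrite (_ : _ * _ = 24 * B)//; field; rewrite gt_eqF.
have h2 : `|E2| <= 16 * B.
  apply: le_trans (ler_norm_sum _ _ _) _.
  have := prime_powers_le R N => h.
  apply: (@le_trans _ _ (8 * (2 * B))); last lra.
  apply: le_trans (ler_wpM2r _ h); last by rewrite mulr_ge0.
  rewrite mulr_suml; apply: ler_sum => p pp.
  rewrite normrM (ger0_norm (ln_nat_ge0 _ _)) -mulrA.
  apply: ler_wpM2l; first exact: ln_nat_ge0.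
  apply: le_trans (ler_norm_sum _ _ _) _; rewrite mulr_suml; apply: ler_sum => k _.
  rewrite normrM; apply: ler_pM => //; last exact: (Lpart_bound _ hc).
  by rewrite normrM normfV normr_nat ler_piMl ?invr_ge0// (real_char_le1 _ hc).
have -> : psum chi N * L = (psum chi N * L + (E1 + E2)) - E1 - E2 by ring.
apply: le_trans (ler_normB _ _) _; apply: lerD => //.
by apply: le_trans (ler_normB _ _) _; apply: lerD.
Qed.

(** * Primes with prescribed quadratic symbols *)

(** The basic real characters: the tags 4 and 8 stand for [chi4] and [chi8], an odd prime for
    its Legendre symbol. *)
Definition bch (q n : nat) : int :=
  if q == 4 then chi4 n else if q == 8 then chi8 n else leg q n.

(** The basic characters of conductor dividing [modulus s]. *)
Definition tags (s : seq nat) : seq nat := [:: 4, 8 & s].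

Definition modulus (s : seq nat) : nat := (8 * \prod_(p <- s) p)%N.

Definition odd_primes (s : seq nat) : Prop := uniq s /\ all (fun p => prime p && odd p) s.

Lemma odd_primesP (s : seq nat) (p : nat) : odd_primes s -> p \in s -> prime p /\ odd p.
Proof. by case=> _ /allP h /h/andP. Qed.

Lemma bch_prime (p n : nat) : prime p -> bch p n = leg p n.
Proof. by move=> pp; rewrite /bch; case: eqP => [p4|_]; [rewrite p4 in pp|case: eqP => // p8; rewrite p8 in pp]. Qed.

Lemma bch_ind (s : seq nat) (q : nat) (P : nat -> Prop) : odd_primes s -> q \in tags s ->
  P 4 -> P 8 -> (forall p, p \in s -> prime p -> odd p -> P p) -> P q.
Proof.
move=> os; rewrite !inE => /or3P[/eqP->//|/eqP->//|qs] _ _ h.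
by have [pq oq] := odd_primesP os qs; apply: h.
Qed.

Lemma bchM (s : seq nat) (q m n : nat) : odd_primes s -> q \in tags s ->
  bch q (m * n) = bch q m * bch q n.
Proof.
move=> os qs; pattern q; apply: (bch_ind os qs); [exact: chi4M|exact: chi8M|].
by move=> p _ pp op; rewrite !bch_prime// PoszM legM.
Qed.

Lemma bch_cases (q n : nat) : [\/ bch q n = 0, bch q n = 1 | bch q n = -1].
Proof.
rewrite /bch; case: ifP => _.
  by rewrite /chi4; case: ifP => _; [constructor 2|case: ifP => _; [constructor 3|constructor 1]].
case: ifP => _; last exact: leg_cases.
by rewrite /chi8; case: ifP => _; [constructor 2|case: ifP => _; [constructor 3|constructor 1]].
Qed.

Lemma bch1 (s : seq nat) (q : nat) : odd_primes s -> q \in tags s -> bch q 1 = 1.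
Proof.
move=> os qs; pattern q; apply: (bch_ind os qs) => // p _ pp op.
by rewrite bch_prime// leg1.
Qed.

Lemma dvd_modulus (s : seq nat) (p : nat) : p \in s -> (p %| modulus s)%N.
Proof. by move=> ps; rewrite /modulus (big_rem _ ps)/= dvdn_mull// dvdn_mulr. Qed.

Lemma bch_mod (s : seq nat) (q m n : nat) : odd_primes s -> q \in tags s ->
  m = n %[mod modulus s] -> bch q m = bch q n.
Proof.
move=> os qs e; have em d : (d %| modulus s)%N -> m = n %[mod d].
  by move=> dN; rewrite -(modn_dvdm m dN) e modn_dvdm.
pattern q; apply: (bch_ind os qs).
- by rewrite /bch/= /chi4 em// /modulus dvdn_mulr.
- by rewrite /bch/= /chi8 em// /modulus dvdn_mulr.
move=> p ps pp op; rewrite !bch_prime//; apply: leg_mod => //.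
have := em p (dvd_modulus ps); move/eqP; rewrite -eqz_mod_dvd /= => /eqP h.
by apply/eqP; rewrite !modz_nat h.
Qed.

Lemma modulus_gt0 (s : seq nat) : odd_primes s -> (0 < modulus s)%N.
Proof.
move=> os; rewrite muln_gt0 /= prod_seq_gt0//; apply/allP => p /(odd_primesP os)[/prime_gt0//].
Qed.

Lemma coprime_prod_seq (n : nat) (s : seq nat) : all (coprime n) s -> coprime n (\prod_(p <- s) p).
Proof.
by elim: s => [|p s IH] /=; rewrite ?big_nil ?coprimen1// big_cons coprimeMr => /andP[-> /IH].
Qed.

Lemma odd_mod4 (n : nat) : odd n = odd (n %% 4).
Proof. by rewrite {1}(divn_eq n 4) oddD oddM andbF. Qed.

Lemma chi4_odd (n : nat) : chi4 n != 0 -> odd n.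
Proof.
rewrite odd_mod4 /chi4; have : (n %% 4 < 4)%N by rewrite ltn_pmod.
by case: (n %% 4)%N => [|[|[|[|]]]].
Qed.

Lemma sqr1_neq0 (x : int) : x ^+ 2 = 1 -> x != 0.
Proof. by move=> x1; apply/eqP => x0; rewrite x0 in x1. Qed.

Lemma bch_coprime (s : seq nat) (n : nat) : odd_primes s ->
  (forall q, q \in tags s -> bch q n != 0) -> coprime n (modulus s).
Proof.
move=> os h; rewrite /modulus coprimeMr -[8%N]/(2 ^ 3)%N coprime_pexpr// coprimen2.
rewrite (chi4_odd (h 4%N (mem_head _ _))) /=.
apply: coprime_prod_seq; apply/allP => p ps; have [pp op] := odd_primesP os ps.
have := h p; rewrite !inE ps !orbT bch_prime// leg_eq0// dvdzE /= => /(_ isT).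
by rewrite coprime_sym prime_coprime.
Qed.

Lemma coprime_bch (s : seq nat) (q n : nat) : odd_primes s -> q \in tags s ->
  coprime n (modulus s) -> bch q n != 0.
Proof.
move=> os qs co; have [on cn] : odd n /\ forall p, p \in s -> ~~ (p %| n)%N.
  split; first by move: co; rewrite /modulus coprimeMr -[8%N]/(2 ^ 3)%N coprime_pexpr// coprimen2 => /andP[].
  move=> p ps; have [pp _] := odd_primesP os ps; rewrite -prime_coprime// coprime_sym.
  exact: coprime_dvdr (dvd_modulus ps) co.
pattern q; apply: (bch_ind os qs).
- exact: sqr1_neq0 (chi4_sign on).
- exact: sqr1_neq0 (chi8_sign on).
by move=> p ps pp op; rewrite bch_prime// leg_eq0// dvdzE /= cn.
Qed.

(** Values at 4 and 8 are fixed by a class modulo 8, the others are added by the Chinese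
    remainder theorem. *)
Lemma bch_crt (s : seq nat) (e : nat -> int) : odd_primes s ->
  (forall q, e q = 1 \/ e q = -1) ->
  exists n, forall q, q \in tags s -> bch q n = e q.
Proof.
move=> os he; elim: s os => [|p s IH] [us hs].
  pose n := if e 4 == 1 then (if e 8 == 1 then 1 else 5)%N else (if e 8 == 1 then 7 else 3)%N.
  exists n => q; rewrite !inE => /orP[]/eqP ->; rewrite /n;
  by case: (he 4%N) => ->; case: (he 8%N) => ->.
move: us hs => /= /andP[ps us] /andP[/andP[pp op] hs].
have os : odd_primes s by split.
have [n hn] := IH os.
have [r hr] : exists r : nat, leg p r = e p.
  case: (he p) => ->; first by exists 1%N; exact: leg1.
  by have [r [_ hr]] := leg_nonres pp op; exists r.
have co : coprime (modulus s) p.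
  rewrite coprime_sym prime_coprime// /modulus Euclid_dvdM// negb_or.
  rewrite -[8%N]/(2 ^ 3)%N Euclid_dvdX// dvdn_prime2//.
  rewrite -[X in _ && X]prime_coprime// coprime_primes_prod//; last first.
    by apply: sub_all hs => x /andP[].
  by case: eqP op => // ->.
exists (chinese (modulus s) p n r) => q; rewrite !inE.
have [->|qp] := eqVneq q p.
  move=> _; rewrite bch_prime// -hr; apply: leg_mod => //.
  by rewrite -eqz_mod_dvd !modz_nat chinese_modr.
move=> /= qs; rewrite -hn ?inE//; apply: bch_mod os _ _; first by rewrite !inE.
by rewrite chinese_modl.
Qed.

(** The products of basic characters; for a nonempty duplicate-free [t] such a product is
    non-principal. *)
Definition bchs (R : realType) (t : seq nat) (n : nat) : R := (\prod_(q <- t) bch q n)%:~R.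

Lemma bchsM (R : realType) (s t : seq nat) (m n : nat) : odd_primes s -> {subset t <= tags s} ->
  bchs R t (m * n) = bchs R t m * bchs R t n.
Proof.
move=> os ts; rewrite /bchs -rmorphM/= -big_split/=; congr (_%:~R).
by apply: eq_big_seq => q /ts qs; rewrite (bchM _ _ os qs).
Qed.

Lemma bchs_mod (R : realType) (s t : seq nat) (m n : nat) : odd_primes s -> {subset t <= tags s} ->
  m = n %[mod modulus s] -> bchs R t m = bchs R t n.
Proof.
move=> os ts e; rewrite /bchs; congr (_%:~R).
by apply: eq_big_seq => q /ts qs; rewrite (bch_mod os qs e).
Qed.

Lemma bchs_cases (R : realType) (t : seq nat) (n : nat) :
  [\/ bchs R t n = 0, bchs R t n = 1 | bchs R t n = -1].
Proof.
rewrite /bchs; elim: t => [|q t IH]; first by rewrite big_nil; constructor 2.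
rewrite big_cons rmorphM/=; case: (bch_cases q n) => ->; case: IH => ->;
rewrite ?mul0r ?mulr0 ?mul1r ?mulr1 ?mulN1r ?mulrNN ?opprK ?mulr1;
by [constructor 1|constructor 2|constructor 3].
Qed.

(** By [bch_crt] some [n0] prime to the modulus has the value -1; multiplication by [n0]
    permutes the residues and changes the sign of the sum. *)
Lemma bchs_period_sum (R : realType) (s t : seq nat) : odd_primes s -> uniq t ->
  {subset t <= tags s} -> t != [::] -> \sum_(i < modulus s) bchs R t i = 0.
Proof.
move=> os ut ts; case: t ut ts => // q0 t /= /andP[q0t ut] ts _.
pose e q : int := if q == q0 then -1 else 1.
have [n0 hn] := @bch_crt s e os (fun q => ltac:(rewrite /e; case: ifP => _; by [right|left])).
have co : coprime n0 (modulus s).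
  by apply: bch_coprime => // q qs; rewrite hn// /e; case: ifP.
have chin : bchs R (q0 :: t) n0 = -1.
  rewrite /bchs big_cons big1_seq ?mulr1; last first.
    move=> q /andP[_ qt]; rewrite hn; last by rewrite ts// inE qt orbT.
    by rewrite /e; case: eqP => // E; rewrite -E qt in q0t.
  by rewrite hn ?ts ?mem_head// /e eqxx.
have N0 := modulus_gt0 os; set N := modulus s in N0 co *.
pose f (i : 'I_N) := Ordinal (ltn_pmod (n0 * i) N0).
have fi : injective f.
  move=> i j /(congr1 val) /= /eqP e1; apply: val_inj => /=.
  wlog le : i j e1 / (i <= j)%N.
    by move=> W; case/orP: (leq_total i j) => ?; [apply: W|apply/esym/W; rewrite // eq_sym].
  rewrite eq_sym eqn_mod_dvd ?leq_mul2l ?le ?orbT// -mulnBr Gauss_dvdr in e1; last by rewrite coprime_sym.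
  have [/eqP|jp] := posnP (j - i); first by rewrite subn_eq0 => ji; apply/eqP; rewrite eqn_leq le.
  by have := dvdn_leq jp e1; rewrite leqNgt (leq_ltn_trans (leq_subr _ _) (ltn_ord j)).
set S := \sum_(i < N) _; suff : S = - S by lra.
rewrite {1}/S (reindex_inj fi) /= /S -sumrN; apply: eq_bigr => i _.
by rewrite (bchs_mod R os ts (modn_mod (n0 * i) N)) (bchsM R n0 i os ts) chin mulN1r.
Qed.

Lemma bchs_real_char (R : realType) (s t : seq nat) : odd_primes s -> uniq t ->
  {subset t <= tags s} -> t != [::] -> real_char ((modulus s)%:R : R) (bchs R t).
Proof.
move=> os ut ts t0; split.
- rewrite /bchs big1_seq// => q /andP[_ /ts qs]; exact: bch1 qs.
- by move=> m n; apply: bchsM os ts.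
- by move=> n; apply: bchs_cases.
have le1 n : `|bchs R t n| <= 1 by case: (bchs_cases R t n) => ->; rewrite ?normr0 ?normrN ?normr1 ?ler01.
set N := modulus s; have N0 := modulus_gt0 os.
have shift k r : \sum_(0 <= i < k * N + r) bchs R t i = \sum_(0 <= i < r) bchs R t i.
  elim: k => [|k IH]; first by rewrite mul0n.
  rewrite mulSn -addnA (@big_cat_nat _ _ _ N 0)//= ?leq_addr// big_mkord bchs_period_sum// add0r.
  rewrite -{1}[N]add0n big_addn addKn -IH; apply: eq_big_nat => i _.
  by apply: bchs_mod os ts _; rewrite modnDr.
move=> n; rewrite (divn_eq n N) shift.
apply: le_trans (ler_norm_sum _ _ _) _.
apply: (@le_trans _ _ (\sum_(0 <= i < n %% N) 1)); first by apply: ler_sum.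
by rewrite sumr_const_nat subn0 ler_nat ltnW// ltn_pmod.
Qed.

Definition bdd_psum (R : realType) (g : nat -> R) : Prop := exists C : R, forall N, `|psum g N| <= C.

Lemma bdd_psumD (R : realType) (g h k : nat -> R) (c : R) : bdd_psum g -> bdd_psum h ->
  (forall n, k n = g n + c * h n) -> bdd_psum k.
Proof.
move=> [C hC] [D hD] hk; exists (C + `|c| * D) => N.
have -> : psum k N = psum g N + c * psum h N.
  by rewrite /psum mulr_sumr -big_split/=; apply: eq_bigr => p _; rewrite hk; ring.
by apply: le_trans (ler_normD _ _) _; rewrite normrM lerD// ler_wpM2l.
Qed.

(** Expanding the product over [s] gives the characters indexed by the sublists of [s]. *)
Lemma bdd_expand (R : realType) (e : nat -> int) (s t : seq nat) :
  (forall u, subseq u s -> bdd_psum (bchs R (t ++ u))) ->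
  bdd_psum (fun n => bchs R t n * \prod_(q <- s) (1 + (e q * bch q n)%:~R)).
Proof.
elim: s t => [|q s IH] t H.
  have [C hC] := H [::] isT; exists C => N; have := hC N; rewrite cats0.
  by congr (`|_| <= _); apply: eq_bigr => p _; rewrite big_nil mulr1.
have h1 : bdd_psum (fun n => bchs R t n * \prod_(q <- s) (1 + (e q * bch q n)%:~R)).
  by apply: IH => u us; apply: H; apply: subseq_trans us (subseq_cons _ _).
have h2 : bdd_psum (fun n => bchs R (rcons t q) n * \prod_(q <- s) (1 + (e q * bch q n)%:~R)).
  by apply: IH => u us; rewrite cat_rcons; apply: H; rewrite /= eqxx.
apply: (bdd_psumD (c := (e q)%:~R) h1 h2) => n.
by rewrite big_cons /bchs big_rcons /= !rmorphM/=; ring.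
Qed.

(** The same with the empty sublist, the principal character, removed. *)
Lemma bdd_expand1 (R : realType) (e : nat -> int) (s : seq nat) :
  (forall u, subseq u s -> u != [::] -> bdd_psum (bchs R u)) ->
  bdd_psum (fun n => \prod_(q <- s) (1 + (e q * bch q n)%:~R) - 1 : R).
Proof.
elim: s => [|q s IH] H.
  by exists 0 => N; rewrite /psum big1 ?normr0// => p _; rewrite big_nil subrr mul0r.
have h1 := IH (fun u us => H u (subseq_trans us (subseq_cons _ _))).
have h2 : bdd_psum (fun n => bchs R [:: q] n * \prod_(q <- s) (1 + (e q * bch q n)%:~R)).
  by apply: bdd_expand => u us; apply: H; rewrite //= eqxx.
apply: (bdd_psumD (c := (e q)%:~R) h1 h2) => n.
by rewrite big_cons /bchs big_seq1 rmorphM/=; ring.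
Qed.

(** The product of [1 + e q * bch q n] over the tags detects the wanted sign pattern. Expanding
    it, the principal term contributes at least [ln N - 9] by Mertens, the other characters are
    bounded by [shapiro], so the product cannot vanish at all large primes. *)
Lemma dirichlet_signs (R : realType) (s : seq nat) (e : nat -> int) (b : nat) : odd_primes s ->
  (forall q, e q = 1 \/ e q = -1) ->
  exists r, [/\ prime r, (b < r)%N & forall q, q \in tags s -> bch q r = e q].
Proof.
move=> os he.
wlog bN : b / (modulus s <= b)%N.
  move=> W; have [r [pr br hr]] := W _ (leq_maxr b (modulus s)).
  by exists r; split=> //; apply: leq_ltn_trans br; apply: leq_maxl.
apply: contrapT => nex.
have ut : uniq (tags s).
  have ns q : ~~ prime q -> q \notin s by apply: contra => /(odd_primesP os)[].
  by case: os => us _; rewrite /= !inE /= !ns.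
have [C hC] : bdd_psum (fun n => \prod_(q <- tags s) (1 + (e q * bch q n)%:~R) - 1 : R).
  apply: bdd_expand1 => u us u0.
  have := @bchs_real_char R s u os (subseq_uniq us ut) (mem_subseq us) u0.
  exact: shapiro.
set g := fun n => _ in hC.
have gb p : prime p -> (b < p)%N -> g p + 1 = 0.
  move=> pp bp; rewrite /g subrK; apply/eqP; rewrite prodf_seq_eq0.
  apply: contrapT => /negP/hasPn h; apply: nex; exists p; split=> // q qs.
  have := h q qs; rewrite /= -(rmorph1 (intmul (1 : R))) -rmorphD/= intr_eq0.
  have co : coprime p (modulus s).
    rewrite prime_coprime//; apply/negP => /(dvdn_leq (modulus_gt0 os)).
    by rewrite leqNgt (leq_ltn_trans bN bp).
  have := coprime_bch os qs co.
  by case: (bch_cases q p) => ->; case: (he q) => ->.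
pose G := psum (fun n => g n + 1) b.
have GE N : (b <= N)%N -> psum (fun n => g n + 1) N = G.
  move=> bN'; rewrite /G /psum (@big_cat_nat _ _ _ b.+1 1 N.+1)//= [X in _ + X]big1_seq ?addr0//.
  by move=> p /andP[pp]; rewrite mem_index_iota => /andP[bp _]; rewrite gb// mul0r.
pose K := `|G| + C + 9.
pose N := (b + (Num.truncn (expR K)).+1)%N.
have N0 : (0 < N)%N by rewrite /N addnS.
have lnK : K < ln N%:R.
  rewrite -[K]expRK ltr_ln ?posrE ?expR_gt0 ?ltr0n//.
  by apply: lt_le_trans (truncnS_gt (expR K)) _; rewrite ler_nat leq_addl.
have := mertens_lower R N0.
have := GE N (leq_addr _ _).
have -> : psum (fun n => g n + 1) N = psum g N + psum (fun=> 1) N.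
  by rewrite /psum -big_split/=; apply: eq_bigr => p _; ring.
have := hC N; rewrite ler_norml => /andP[h1 h2] h3 h4.
have := ler_norm G; rewrite /K in lnK; lra.
Qed.

(** * Legendre symbols as products of basic characters *)

(** The units of the integers, as an explicit disjunction for case analysis. *)
Definition is_sign (x : int) : Prop := x = 1 \/ x = -1.

Lemma is_signM x y : is_sign x -> is_sign y -> is_sign (x * y).
Proof. by case=> ->; case=> ->; rewrite ?mul1r ?mulr1 ?mulrNN ?mulr1; [left|right|right|left]. Qed.

Lemma is_signX x n : is_sign x -> is_sign (x ^+ n).
Proof. by move=> sx; elim: n => [|n IH]; [left|rewrite exprS; apply: is_signM]. Qed.

Lemma is_sign_sqr x : is_sign x -> x * x = 1.
Proof. by case=> ->. Qed.

Lemma sign_prod (s : seq nat) (P : pred nat) (f : nat -> int) : (forall p, p \in s -> is_sign (f p)) ->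
  is_sign (\prod_(p <- s | P p) f p).
Proof.
move=> h; rewrite big_seq_cond; elim/big_ind: _ => //; first by left.
- exact: is_signM.
- by move=> p /andP[/h].
Qed.

Lemma bch_sign (s : seq nat) (q n : nat) : odd_primes s -> q \in tags s -> coprime n (modulus s) ->
  is_sign (bch q n).
Proof.
move=> os qs co; have := coprime_bch os qs co.
by case: (bch_cases q n) => -> // _; [left|right].
Qed.

Lemma exp_xorb (x : int) (i j : bool) : is_sign x -> x ^+ i * x ^+ j = x ^+ (i (+) j).
Proof. by case=> ->; case: i; case: j. Qed.

(** A character modulo 8, given by its exponents on [chi4] and [chi8] and evaluated on abstract
    values of these. *)
Definition psi (i j : bool) (x4 x8 : int) : int := x4 ^+ i * x8 ^+ j.

(** The shape that [leg_factor] gives to a Legendre symbol as a function of its lower argument.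
    *)
Definition rch (i j : bool) (P : pred nat) (s : seq nat) (n : nat) : int :=
  psi i j (bch 4 n) (bch 8 n) * \prod_(p <- s | P p) bch p n.

Lemma psiM i j x4 x8 y4 y8 : psi i j (x4 * y4) (x8 * y8) = psi i j x4 x8 * psi i j y4 y8.
Proof. by rewrite /psi !exprMn; ring. Qed.

Lemma psi_sign i j x4 x8 : is_sign x4 -> is_sign x8 -> is_sign (psi i j x4 x8).
Proof. by move=> h4 h8; apply: is_signM; apply: is_signX. Qed.

Lemma rchM i j P s m n : odd_primes s -> rch i j P s (m * n) = rch i j P s m * rch i j P s n.
Proof.
move=> os; rewrite /rch !(bchM _ _ os) ?inE ?eqxx ?orbT// psiM.
have -> : \prod_(p <- s | P p) bch p (m * n) = \prod_(p <- s | P p) bch p m * \prod_(p <- s | P p) bch p n.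
  rewrite -big_split big_seq_cond [RHS]big_seq_cond; apply: eq_bigr => p /andP[ps _].
  by rewrite (bchM _ _ os)// !inE ps !orbT.
by ring.
Qed.

Lemma rch1 i j P s : odd_primes s -> rch i j P s 1 = 1.
Proof.
move=> os; rewrite /rch !(bch1 os) ?inE ?eqxx ?orbT// /psi !expr1n !mul1r.
rewrite big_seq_cond big1// => p /andP[ps _]; rewrite (bch1 os)// !inE ps !orbT//.
Qed.

Lemma rch_sign i j P s n : odd_primes s -> coprime n (modulus s) -> is_sign (rch i j P s n).
Proof.
move=> os co; apply: is_signM.
  by apply: psi_sign; apply: (bch_sign os) => //; rewrite !inE ?eqxx ?orbT.
by apply: sign_prod => p ps; apply: (bch_sign os) => //; rewrite !inE ps !orbT.
Qed.

Lemma rch_prod i j P s (t : seq nat) : odd_primes s ->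
  rch i j P s (\prod_(l <- t) l) = \prod_(l <- t) rch i j P s l.
Proof.
by move=> os; elim: t => [|l t IH]; rewrite ?big_nil ?rch1// !big_cons rchM// IH.
Qed.

Definition oddp (n : nat) : seq nat := [seq p <- primes n | odd p].

Lemma prod_even_primes (t : seq nat) : uniq t -> all prime t ->
  (\prod_(p <- t | ~~ odd p) p = 2 ^ (2%N \in t))%N.
Proof.
elim: t => [|p t IH] /=; first by rewrite big_nil.
move=> /andP[pt ut] /andP[pp ht]; rewrite big_cons IH// inE.
have [op|ep] := boolP (odd p) => /=; first by case: eqP => // p2; rewrite -p2 in op.
have p2 : p = 2%N by apply/eqP; rewrite eq_sym -dvdn_prime2// dvdn2.
by move: pt; rewrite p2 => /negbTE ->.
Qed.

Lemma sqf_oddp (n : nat) : sqf n -> exists j : bool, n = (2 ^ j * \prod_(p <- oddp n) p)%N.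
Proof.
move=> sn; exists (2%N \in primes n); rewrite {1}(sqf_prod sn) (bigID odd) /= mulnC /oddp big_filter.
by rewrite prod_even_primes ?primes_uniq ?all_prime_primes.
Qed.

(** Reciprocity for each factor; the powers of [chi4] are collected in one exponent. *)
Lemma leg_prod_recip (t : seq nat) : odd_primes t ->
  exists i : bool, forall l, prime l -> odd l -> l \notin t ->
    leg l (\prod_(p <- t) p)%N = chi4 l ^+ i * \prod_(p <- t) leg p l.
Proof.
elim: t => [|p t IH].
  by move=> _; exists false => l pl _ _; rewrite !big_nil leg1.
move=> [/= /andP[pt ut] /andP[/andP[pp op] ht]].
have [i hi] := IH (conj ut ht).
exists (i (+) (chi4 p == -1)) => l pl ol; rewrite inE negb_or => /andP[lp lt].
rewrite !big_cons PoszM legM// hi//.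
have rec := leg_recip pp op pl ol; rewrite eq_sym lp legM// in rec.
have := rec isT; rewrite -(exp_xorb i _ (x := chi4 l)); last first.
  by have := chi4_sign ol; rewrite /is_sign; move/eqP; rewrite sqrf_eq1 => /orP[]/eqP ->; [left|right].
have : is_sign (chi4 p).
  by have := chi4_sign op; rewrite /is_sign; move/eqP; rewrite sqrf_eq1 => /orP[]/eqP ->; [left|right].
case=> -> /=; first by rewrite leg1// mul1r expr0 mulr1 => ->; ring.
rewrite leg_m1// expr1 => <-.
rewrite (_ : chi4 l ^+ i * chi4 l * _ = (chi4 l) ^+ 2 * (leg l p * (chi4 l ^+ i * \prod_(j <- t) leg j l))); last by ring.
by rewrite chi4_sign// mul1r.
Qed.

Lemma chi4_is_sign n : odd n -> is_sign (chi4 n).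
Proof. by move/chi4_sign/eqP; rewrite sqrf_eq1 => /orP[]/eqP ->; [left|right]. Qed.

(** Quadratic reciprocity: as a function of its lower argument, the Legendre symbol of a
    squarefree [a] is a real character. The exponents [i] and [j] record the sign and the parity
    of [a] together with the signs of reciprocity. *)
Lemma leg_factor (a : int) (s : seq nat) : odd_primes s -> sqf `|a| ->
  (forall p, prime p -> odd p -> (p %| a)%Z -> p \in s) ->
  exists i j : bool, forall l, prime l -> odd l -> ~~ (l %| a)%Z ->
    leg l a = rch i j (fun p => p %| `|a|)%N s l.
Proof.
move=> os sa hs; have a0 : (0 < `|a|)%N by case/andP: sa.
have ot : odd_primes (oddp `|a|).
  split; first by rewrite filter_uniq// primes_uniq.
  by apply/allP => p; rewrite mem_filter mem_primes => /andP[-> /andP[->]].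
have [i hi] := leg_prod_recip ot.
have [j hj] := sqf_oddp sa.
exists (i (+) (a < 0)), j => l pl ol la.
have lt : l \notin oddp `|a|.
  by rewrite mem_filter mem_primes !negb_and ; move: la; rewrite dvdzE /= => ->; rewrite !orbT.
have s4 := chi4_is_sign ol.
have aE : a = (if a < 0 then -1 else 1) * (2 ^+ j * (\prod_(p <- oddp `|a|) p)%N%:Z).
  have -> : (2 : int) ^+ j = (2 ^ j)%N by case: (j).
  rewrite -PoszM -hj; case: ifP => h; first by rewrite mulN1r ltz0_abs// opprK.
  by rewrite mul1r gez0_abs// leNgt h.
rewrite [in LHS]aE !legM// hi//.
rewrite /rch /psi /bch /= -exp_xorb//.
have -> : leg l (if a < 0 then -1 else 1) = chi4 l ^+ (a < 0)%R.
  by case: (a < 0); rewrite ?leg_m1 ?leg1.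
have -> : leg l (2 ^+ j) = chi8 l ^+ j.
  by case: j {hj aE}; rewrite ?expr1 ?expr0 ?leg_2 ?leg1.
have -> : \prod_(p <- oddp `|a|) leg p l = \prod_(p <- s | (p %| `|a|)%N) (if p == 4 then chi4 l else if p == 8 then chi8 l else leg p l).
  rewrite -[RHS]big_filter; rewrite (perm_big [seq p <- s | (p %| `|a|)%N]).
    apply: eq_big_seq => p; rewrite mem_filter => /andP[_ /(odd_primesP os)[pp op]].
    by have := bch_prime l pp; rewrite /bch => ->.
  apply: uniq_perm; rewrite ?filter_uniq ?primes_uniq//; first by case: os.
  move=> p; rewrite !mem_filter mem_primes a0 /=; apply/and3P/andP => [[op pp pa]|[pa ps]].
    by split=> //; apply: hs.
  by have [pp op] := odd_primesP os ps; split.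
by ring.
Qed.

(** * Completely multiplicative sign functions *)

(** The completely multiplicative extension of a function on primes. *)
Definition cmul (f : nat -> int) (n : nat) : int := \prod_(l <- primes n) f l ^+ logn l n.

Lemma cmul_widen (f : nat -> int) (n N : nat) : (0 < n)%N -> (n <= N)%N ->
  cmul f n = \prod_(1 <= l < N.+1) f l ^+ logn l n.
Proof.
move=> n0 nN; rewrite /cmul [RHS](bigID (mem (primes n)))/= [X in _ * X]big1 ?mulr1.
  rewrite -[RHS]big_filter; apply: perm_big; apply: uniq_perm; rewrite ?primes_uniq ?filter_uniq ?iota_uniq//.
  move=> l; rewrite mem_filter mem_index_iota; have [li|//] := boolP (l \in primes n).
  move: li; rewrite mem_primes => /and3P[pl _ ln]; rewrite /= prime_gt0//= ltnS.
  by rewrite (leq_trans (dvdn_leq n0 ln)).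
by move=> l nl; rewrite (_ : logn l n = 0%N) ?expr0//; apply/eqP; rewrite -leqn0 leqNgt logn_gt0.
Qed.

Lemma cmulM (f : nat -> int) (m n : nat) : (0 < m)%N -> (0 < n)%N ->
  cmul f (m * n) = cmul f m * cmul f n.
Proof.
move=> m0 n0; have mn0 : (0 < m * n)%N by rewrite muln_gt0 m0.
rewrite !(@cmul_widen f _ (m * n)) ?leq_pmulr ?leq_pmull// -big_split /=.
by apply: eq_bigr => l _; rewrite lognM// exprD.
Qed.

Lemma cmul_eq1 (f : nat -> int) (n : nat) : (forall l, prime l -> (l %| n)%N -> f l = 1) -> cmul f n = 1.
Proof.
move=> h; rewrite /cmul big1_seq// => l /andP[_]; rewrite mem_primes => /and3P[pl _ ln].
by rewrite h// expr1n.
Qed.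

Lemma cmul_sqf (f : nat -> int) (n : nat) : sqf n -> cmul f n = \prod_(l <- primes n) f l.
Proof.
move=> /andP[_ /allP h]; rewrite /cmul; apply: eq_big_seq => l /h /eqP ->.
by rewrite expr1.
Qed.

Lemma cmul_rch i j P s n : odd_primes s -> (0 < n)%N -> cmul (rch i j P s) n = rch i j P s n.
Proof.
move=> os n0; rewrite {2}(prod_prime_decomp n0) prime_decompE big_map /cmul /=.
have h t : rch i j P s (\prod_(l <- t) l ^ logn l n)%N = \prod_(l <- t) rch i j P s l ^+ logn l n.
  elim: t => [|l t IH]; rewrite ?big_nil ?rch1// !big_cons rchM// IH; congr (_ * _).
  by elim: (logn l n) => [|k IHk]; rewrite ?expn0 ?expr0 ?rch1// expnS exprS rchM// IHk.
by rewrite h.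
Qed.

Lemma eq_cmul (f g : nat -> int) (n : nat) : (forall l, prime l -> (l %| n)%N -> f l = g l) ->
  cmul f n = cmul g n.
Proof.
move=> h; apply: eq_big_seq => l; rewrite mem_primes => /and3P[pl _ ln].
by rewrite h.
Qed.

Lemma cmul_sign (f : nat -> int) (n : nat) : (forall l, prime l -> (l %| n)%N -> is_sign (f l)) ->
  is_sign (cmul f n).
Proof.
move=> h; apply: sign_prod => l; rewrite mem_primes => /and3P[pl _ ln].
by apply: is_signX; apply: h.
Qed.

Lemma logn_prod_primes (t : seq nat) (l : nat) : prime l -> all prime t ->
  logn l (\prod_(p <- t) p) = count_mem l t.
Proof.
move=> pl; elim: t => [|p t IH] /=; first by rewrite big_nil logn1.
move=> /andP[pp ht]; rewrite big_cons lognM ?(prime_gt0 pp)//.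
  by rewrite IH// logn_prime// eq_sym.
by apply: prod_seq_gt0; apply: sub_all ht => x /prime_gt0.
Qed.

Lemma sqf_prod_primes (t : seq nat) : uniq t -> all prime t -> sqf (\prod_(p <- t) p).
Proof.
move=> ut ht; apply/andP; split.
  by apply: prod_seq_gt0; apply: sub_all ht => x /prime_gt0.
apply/allP => l; rewrite -logn_gt0 => l0.
have pl : prime l by move: l0; rewrite lognE; case: (prime l).
by move: l0; rewrite logn_prod_primes// count_uniq_mem//; case: (l \in t).
Qed.

Lemma dvd_prod_primes (t : seq nat) (l : nat) : prime l -> all prime t ->
  (l %| \prod_(p <- t) p)%N -> l \in t.
Proof.
move=> pl ht ld; rewrite -has_pred1 has_count -logn_prod_primes// logn_gt0 mem_primes pl ld.
by rewrite prod_seq_gt0//; apply: sub_all ht => x /prime_gt0.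
Qed.

Lemma legendre_seq (a : int) (t : seq nat) : sqf `|a| -> uniq t -> all (fun p => prime p && odd p) t ->
  (forall l, l \in t -> leg l a = 1) ->
  (forall q, prime q -> odd q -> (q %| a)%Z -> leg q (\prod_(p <- t) p)%N = 1) ->
  nrm a%:~R (\prod_(p <- t) p)%N%:R.
Proof.
move=> sa ut ht Ha Hq.
have pt : all prime t by apply: sub_all ht => x /andP[].
apply: legendre => //; first exact: sqf_prod_primes.
  elim: (t) ht => [|p t' IH] /=; first by rewrite big_nil.
  by move=> /andP[/andP[_ op] /IH h]; rewrite big_cons oddM op.
by move=> l pl ld; apply: Ha; apply: dvd_prod_primes ld.
Qed.

(** * Products of norms: the squarefree case *)

(** [c] is a product of norms from the three quadratic subfields of the biquadratic field. *)
Definition normG (a b : int) (c : rat) : Prop :=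
  exists n1 n2 n3, [/\ nrm a%:~R n1, nrm b%:~R n2, nrm (a * b)%:~R n3 & c = n1 * n2 * n3].

Lemma normGM (a b : int) (c d : rat) : normG a b c -> normG a b d -> normG a b (c * d).
Proof.
move=> [x [y [z [hx hy hz ->]]]] [u [v [w [hu hv hw ->]]]].
exists (x * u), (y * v), (z * w); split; by [apply: nrmM|ring].
Qed.

Lemma normGV (a b : int) (c : rat) : normG a b c -> normG a b c^-1.
Proof.
move=> [x [y [z [hx hy hz ->]]]].
by exists x^-1, y^-1, z^-1; split; [apply: nrmV|apply: nrmV|apply: nrmV|rewrite !invfM].
Qed.

Lemma nrm1 (a : rat) : nrm a 1.
Proof. by rewrite -(expr1n _ 2); apply: nrm_sqr. Qed.

Lemma normG_a (a b : int) (c : rat) : nrm a%:~R c -> normG a b c.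
Proof. by move=> h; exists c, 1, 1; split; rewrite ?mulr1//; apply: nrm1. Qed.

Lemma normG_b (a b : int) (c : rat) : nrm b%:~R c -> normG a b c.
Proof. by move=> h; exists 1, c, 1; split; rewrite ?mulr1 ?mul1r//; apply: nrm1. Qed.

Lemma normG_ab (a b : int) (c : rat) : nrm (a * b)%:~R c -> normG a b c.
Proof. by move=> h; exists 1, 1, c; split; rewrite ?mulr1 ?mul1r//; apply: nrm1. Qed.

Lemma normG_sqr (a b : int) (k : rat) : normG a b (k ^+ 2).
Proof. by apply: normG_a; apply: nrm_sqr. Qed.

Lemma normG_cancel (a b : int) (c d : rat) : d != 0 -> normG a b (c * d) -> normG a b d -> normG a b c.
Proof.
by move=> d0 h1 h2; rewrite -(mulfK d0 c); apply: normGM => //; apply: normGV.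
Qed.

Lemma normG_sym (a b : int) (c : rat) : normG a b c -> normG b a c.
Proof.
move=> [x [y [z [hx hy hz ->]]]]; exists y, x, z; split=> //; last by ring.
by rewrite mulrC.
Qed.

Lemma dirichlet_signs_in (R : realType) (s : seq nat) (e : nat -> int) (b : nat) : odd_primes s ->
  (forall q, q \in tags s -> is_sign (e q)) ->
  exists r, [/\ prime r, (b < r)%N & forall q, q \in tags s -> bch q r = e q].
Proof.
move=> os he; pose e' q : int := if e q == -1 then -1 else 1.
have he' q : e' q = 1 \/ e' q = -1 by rewrite /e'; case: ifP => _; [right|left].
have [r [pr br hr]] := @dirichlet_signs R s e' b os he'.
exists r; split=> // q qs; rewrite hr// /e'.
by case: (he q qs) => ->.
Qed.

(** The conditions modulo 8 on the two auxiliary primes of [normG_core]: whatever the two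
    characters modulo 8 are, they can be met for at least one value [f] of the sign [phi]. *)
Lemma sign_choice (ia ja ib jb : bool) (x4 x8 : int) : is_sign x4 -> is_sign x8 ->
  exists f m4 m8 n4 n8 : int,
    [/\ is_sign f, is_sign m4 /\ is_sign m8, is_sign n4 /\ is_sign n8,
      psi ia ja m4 m8 = 1 /\ psi ib jb m4 m8 = f &
      psi ib jb n4 n8 = 1 /\ psi ia ja n4 n8 = psi ia ja x4 x8 * psi ib jb x4 x8 * f].
Proof.
have p : is_sign 1 by left.
have n : is_sign (-1) by right.
rewrite /psi; case=> -> [] ->; case: ia; case: ja; case: ib; case: jb;
first [ by exists 1, 1, 1, 1, 1 | by exists 1, 1, 1, 1, (-1) | by exists 1, 1, 1, (-1), 1
  | by exists 1, 1, 1, (-1), (-1) | by exists (-1), (-1), 1, 1, 1 | by exists (-1), 1, (-1), 1, 1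
  | by exists (-1), (-1), (-1), 1, 1 ].
Qed.

(** Extended multiplicatively, this is the character of [b] on the part of an integer made of
    primes split in Q(sqrt a). *)
Definition split_inert (a b : int) (l : nat) : int := if leg l a == 1 then leg l b else 1.

(** The sign of [c] on which the choice of the auxiliary primes depends: the character of [b] on
    the part of [c] made of primes split in Q(sqrt a), times the symbols of [c] at the primes
    dividing [b] only. *)
Definition phi (a b : int) (s : seq nat) (n : nat) : int :=
  cmul (split_inert a b) n * \prod_(p <- s | (p %| `|b|)%N && ~~ (p %| `|a|)%N) bch p n.

Definition bad_primes (a b : int) (s : seq nat) : Prop :=
  odd_primes s /\ forall p, prime p -> odd p -> (p \in s) = (p %| `|a|)%N || (p %| `|b|)%N.

Lemma leg_is_sign (l : nat) (a : int) : prime l -> ~~ (l %| a)%Z -> is_sign (leg l a).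
Proof. by move=> pl; rewrite -leg_eq0//; case: (leg_cases l a) => -> // _; [left|right]. Qed.

Lemma coprime_bad (a b : int) (s : seq nat) (n l : nat) : bad_primes a b s -> coprime n (modulus s) ->
  prime l -> (l %| n)%N -> [/\ odd l, ~~ (l %| a)%Z & ~~ (l %| b)%Z].
Proof.
move=> [os hs] co pl ln; have cl : coprime l (modulus s) by apply: coprime_dvdl co.
have ol : odd l.
  by move: cl; rewrite /modulus coprimeMr -[8%N]/(2 ^ 3)%N coprime_pexpr// coprimen2 => /andP[].
have ls : l \notin s.
  by apply/negP => /dvd_modulus; apply/negP; rewrite -prime_coprime.
by rewrite hs// negb_or in ls; move/andP: ls => [? ?]; split.
Qed.

Lemma sqfP (n : nat) : reflect ((0 < n)%N /\ forall p, (logn p n <= 1)%N) (sqf n).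
Proof.
apply: (iffP andP) => -[n0 h]; split=> //.
  move=> p; have [pi|npi] := boolP (p \in primes n); first by have /eqP -> := allP h p pi.
  by move: npi; rewrite -logn_gt0 -leqNgt leqn0 => /eqP ->.
by apply/allP => p; rewrite -logn_gt0 => ?; rewrite eqn_leq h.
Qed.

Lemma dvd_logn (p n : nat) : prime p -> (0 < n)%N -> (p %| n)%N = (0 < logn p n)%N.
Proof. by move=> pp n0; rewrite logn_gt0 mem_primes pp n0. Qed.

(** The squarefree part [e] of [a b], which generates the same quadratic field as [a b]; its
    primes are those dividing exactly one of [a] and [b]. *)
Lemma sqf_lcm_core (a b : int) : sqf `|a| -> sqf `|b| ->
  exists e g : int, [/\ a * b = e * g ^+ 2, g != 0, sqf `|e| &
    forall p, prime p -> (p %| e)%Z = ((p %| a)%Z != (p %| b)%Z)].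
Proof.
move=> /sqfP[a0 ha] /sqfP[b0 hb]; set g := gcdn `|a| `|b|.
have g0 : (0 < g)%N by rewrite gcdn_gt0 a0.
have /dvdzP[a1 aE] : (g %| a)%Z by rewrite dvdzE /= dvdn_gcdl.
have /dvdzP[b1 bE] : (g %| b)%Z by rewrite dvdzE /= dvdn_gcdr.
have aA : `|a|%N = (`|a1| * g)%N by rewrite aE abszM.
have bB : `|b|%N = (`|b1| * g)%N by rewrite bE abszM.
have a10 : (0 < `|a1|)%N by move: a0; rewrite aA muln_gt0 => /andP[].
have b10 : (0 < `|b1|)%N by move: b0; rewrite bB muln_gt0 => /andP[].
have e0 : (0 < `|(a1 * b1)%R|)%N by rewrite abszM muln_gt0 a10.
have co : gcdn `|a1| `|b1| = 1%N.
  by apply/eqP; rewrite -(eqn_pmul2r g0) mul1n muln_gcdl -aA -bB.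
have disj p : prime p -> logn p `|a1| = 0%N \/ logn p `|b1| = 0%N.
  move=> pp; have [->|la] := posnP (logn p `|a1|); first by left.
  have [->|lb] := posnP (logn p `|b1|); first by right.
  have : (p %| gcdn `|a1| `|b1|)%N by rewrite dvdn_gcd !dvd_logn// la lb.
  by rewrite co dvdn1 => /eqP p1; rewrite p1 in pp.
have le p : logn p `|(a1 * b1)%R| = (logn p `|a1| + logn p `|b1|)%N by rewrite abszM lognM.
have lA p : (logn p `|a1| + logn p g <= 1)%N by rewrite -lognM// -aA.
have lB p : (logn p `|b1| + logn p g <= 1)%N by rewrite -lognM// -bB.
exists (a1 * b1), g%:Z; split.
- by rewrite aE bE; ring.
- by rewrite -lt0n.
- apply/sqfP; split=> // p; rewrite le.
  have [pp|npp] := boolP (prime p); last by have l0 n : logn p n = 0%N; rewrite ?l0// lognE (negbTE npp).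
  by case: (disj p pp) => ->; [have := lB p|have := lA p]; case: (logn p _) => [|[|]].
move=> p pp; rewrite !dvdzE/= !dvd_logn// le aA bB !lognM//.
have := lA p; have := lB p; case: (disj p pp) => ->; case: (logn p g) => [|[|]] //;
by case: (logn p _) => [|[|]].
Qed.

Lemma sign_solve (pa x z : int) : is_sign x -> pa * x = z -> pa = z * x.
Proof. by move=> sx <-; rewrite -mulrA is_sign_sqr// mulr1. Qed.

(** Legendre's theorem requires of [r] and [t] that [r * ca], [t * cb] and [r * t * ce] be
    squares modulo the relevant odd primes of [a b], and that [r] and [t] split in Q(sqrt a) and
    Q(sqrt b). The former prescribes the symbols of [r] and [t] at the bad primes. By
    reciprocity the latter then prescribes characters modulo 8 of [r / ca] and [t / cb], with
    values 1 or involving [phi c]; the parameters [m4], [m8], [n4] and [n8] stand for the values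
    of [chi4] and [chi8] at these ratios. *)
Lemma normG_core (R : realType) (a b : int) (s : seq nat) (ia ja ib jb : bool) (c : nat)
    (m4 m8 n4 n8 : int) :
  bad_primes a b s -> sqf `|a| -> sqf `|b| ->
  (forall l, prime l -> odd l -> ~~ (l %| a)%Z -> leg l a = rch ia ja (fun p => p %| `|a|)%N s l) ->
  (forall l, prime l -> odd l -> ~~ (l %| b)%Z -> leg l b = rch ib jb (fun p => p %| `|b|)%N s l) ->
  sqf c -> coprime c (modulus s) ->
  is_sign m4 /\ is_sign m8 -> is_sign n4 /\ is_sign n8 ->
  psi ia ja m4 m8 = 1 /\ psi ib jb m4 m8 = phi a b s c ->
  psi ib jb n4 n8 = 1 /\
    psi ia ja n4 n8 = psi ia ja (bch 4 c) (bch 8 c) * psi ib jb (bch 4 c) (bch 8 c) * phi a b s c ->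
  normG a b c%:R.
Proof.
move=> bs sa sb Fa Fb sc coc [sm4 sm8] [sn4 sn8] [pm1 pm2] [pn1 pn2].
have [os hs] := bs.
have [e [g [abE g0 se he]]] := sqf_lcm_core sa sb.
pose A l := leg l a == 1; pose B l := leg l b == 1.
pose PA p := (p %| `|a|)%N; pose PB p := (p %| `|b|)%N.
pose ta := [seq l <- primes c | A l].
pose tb := [seq l <- primes c | ~~ A l && B l].
pose te := [seq l <- primes c | ~~ A l && ~~ B l].
pose ca := (\prod_(l <- ta) l)%N; pose cb := (\prod_(l <- tb) l)%N; pose ce := (\prod_(l <- te) l)%N.
have cE : c = (ca * cb * ce)%N.
  rewrite {1}(sqf_prod sc) /ca /cb /ce !big_filter -mulnA (bigID A)/=; congr (_ * _)%N.
  by rewrite (bigID B)/=.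
have hc l : l \in primes c -> [/\ prime l, odd l, ~~ (l %| a)%Z & ~~ (l %| b)%Z].
  by rewrite mem_primes => /and3P[pl _ lc]; have [? ? ?] := coprime_bad bs coc pl lc.
have sA l : l \in primes c -> is_sign (leg l a) by move=> /hc[pl _ la _]; apply: leg_is_sign.
have sB l : l \in primes c -> is_sign (leg l b) by move=> /hc[pl _ _ lb]; apply: leg_is_sign.
have co3 : [/\ coprime ca (modulus s), coprime cb (modulus s) & coprime ce (modulus s)].
  by move: coc; rewrite cE !coprimeMl -andbA => /and3P[].
have [coa cob coe] := co3.
have c_gt0 : (0 < c)%N by case/andP: sc.
(* values of the two characters on the three parts of [c] *)
have rA t : {subset t <= primes c} -> rch ia ja PA s (\prod_(l <- t) l) = \prod_(l <- t) leg l a.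
  by move=> h; rewrite rch_prod//; apply: eq_big_seq => l /h/hc[pl ol la _]; rewrite Fa.
have rB t : {subset t <= primes c} -> rch ib jb PB s (\prod_(l <- t) l) = \prod_(l <- t) leg l b.
  by move=> h; rewrite rch_prod//; apply: eq_big_seq => l /h/hc[pl ol _ lb]; rewrite Fb.
have sub_ta : {subset ta <= primes c} by apply: mem_subseq; apply: filter_subseq.
have sub_tb : {subset tb <= primes c} by apply: mem_subseq; apply: filter_subseq.
have sub_te : {subset te <= primes c} by apply: mem_subseq; apply: filter_subseq.
have rAa : rch ia ja PA s ca = 1.
  by rewrite rA// big1_seq// => l /andP[_]; rewrite mem_filter => /andP[/eqP].
have rBb : rch ib jb PB s cb = 1.
  by rewrite rB// big1_seq// => l /andP[_]; rewrite mem_filter => /andP[/andP[_ /eqP]].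
have rBa : rch ib jb PB s ca = cmul (split_inert a b) c.
  rewrite rB// cmul_sqf// big_filter [RHS](bigID A)/= [X in _ * X]big1 ?mulr1.
    by apply: eq_bigr => l; rewrite /split_inert /A => ->.
  by move=> l; rewrite /split_inert /A => /negbTE ->.
have rABe : rch ia ja PA s ce = rch ib jb PB s ce.
  rewrite rA// rB//; apply: eq_big_seq => l; rewrite mem_filter /A /B => /andP[/andP[nA nB] lc].
  by case: (sA l lc) nA => ->; case: (sB l lc) nB => ->.
pose Xa n := \prod_(p <- s | PA p && ~~ PB p) bch p n.
pose Xb n := \prod_(p <- s | PB p && ~~ PA p) bch p n.
have phiE : phi a b s c = rch ib jb PB s ca * Xb c by rewrite rBa.
have bsign q n : q \in tags s -> coprime n (modulus s) -> is_sign (bch q n).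
  by move=> qs co; apply: bch_sign qs co.
have stag q : q \in s -> q \in tags s by rewrite !inE => ->; rewrite !orbT.
(* the first auxiliary prime: the characters of [ca], changed modulo 8 by [m4] and [m8], and by
   the symbols of [c] at the primes dividing [b] only *)
pose er q := if q == 4 then bch 4 ca * m4 else if q == 8 then bch 8 ca * m8 else
   bch q ca * (if PB q && ~~ PA q then bch q c else 1).
have ns4 : (4 \in s) = false by apply/negP => /(odd_primesP os)[].
have ns8 : (8 \in s) = false by apply/negP => /(odd_primesP os)[].
have er_s q : q \in s -> er q = bch q ca * (if PB q && ~~ PA q then bch q c else 1).
  by rewrite /er; case: eqP => [->|_]; [rewrite ns4|case: eqP => [->|//]; rewrite ns8].
have her q : q \in tags s -> is_sign (er q).
  move=> qs; rewrite /er; case: eqP => [_|_].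
    by apply: is_signM => //; apply: bsign; rewrite ?inE.
  case: eqP => [_|_]; first by apply: is_signM => //; apply: bsign; rewrite ?inE.
  apply: is_signM; first exact: bsign.
  by case: ifP => _; [apply: bsign|left].
have [r [pr rbig hr]] := dirichlet_signs_in R (c + modulus s) os her.
(* the second auxiliary prime, with the roles of [a] and [b] exchanged *)
pose et q := if q == 4 then bch 4 cb * n4 else if q == 8 then bch 8 cb * n8 else
   bch q cb * (if PA q && ~~ PB q then bch q c else 1).
have et_s q : q \in s -> et q = bch q cb * (if PA q && ~~ PB q then bch q c else 1).
  by rewrite /et; case: eqP => [->|_]; [rewrite ns4|case: eqP => [->|//]; rewrite ns8].
have het q : q \in tags s -> is_sign (et q).
  move=> qs; rewrite /et; case: eqP => [_|_].
    by apply: is_signM => //; apply: bsign; rewrite ?inE.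
  case: eqP => [_|_]; first by apply: is_signM => //; apply: bsign; rewrite ?inE.
  apply: is_signM; first exact: bsign.
  by case: ifP => _; [apply: bsign|left].
have [t [pt tbig ht]] := dirichlet_signs_in R (r + c + modulus s) os het.
have cor : coprime r (modulus s).
  rewrite prime_coprime//; apply/negP => /(dvdn_leq (modulus_gt0 os)).
  by rewrite leqNgt (leq_ltn_trans (leq_addl _ _) rbig).
have cot : coprime t (modulus s).
  rewrite prime_coprime//; apply/negP => /(dvdn_leq (modulus_gt0 os)).
  by rewrite leqNgt (leq_ltn_trans (leq_addl _ _) tbig).
have c_r : (c < r)%N by apply: leq_ltn_trans rbig; apply: leq_addr.
have r_t : (r < t)%N by apply: leq_ltn_trans tbig; rewrite -addnA leq_addr.
have [oddr ra rb] := coprime_bad bs cor pr (dvdnn r).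
have [oddt ta' tb'] := coprime_bad bs cot pt (dvdnn t).
have split_prod (P Q : pred nat) n f :
   \prod_(p <- s | P p) (bch p n * (if Q p && P p then f p else 1)) =
   \prod_(p <- s | P p) bch p n * \prod_(p <- s | Q p && P p) f p :> int.
  rewrite big_split/=; congr (_ * _); rewrite big_mkcond [RHS]big_mkcond.
  by apply: eq_bigr => p _; case: (P p); rewrite ?andbT ?andbF.
(* [r] and [t] split in both fields, by reciprocity *)
have rra : leg r a = 1.
  rewrite Fa// /rch !hr ?inE ?eqxx ?orbT// /er /= psiM pm1 mulr1.
  rewrite -[RHS]rAa /rch; congr (_ * _).
  rewrite big_seq_cond [RHS]big_seq_cond; apply: eq_bigr => p /andP[ps pA].
  by rewrite hr ?stag// er_s// /PA pA andbF mulr1.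
have rrb : leg r b = 1.
  rewrite Fb// /rch !hr ?inE ?eqxx ?orbT// /er /= psiM pm2 phiE.
  have -> : \prod_(p <- s | (p %| `|b|)%N) bch p r = \prod_(p <- s | PB p) bch p ca * Xb c.
    rewrite /Xb; under [X in _ * X]eq_bigl do rewrite andbC.
    rewrite -(split_prod PB (fun p => ~~ PA p) ca (fun p => bch p c)).
    rewrite big_seq_cond [RHS]big_seq_cond; apply: eq_bigr => p /andP[ps pB].
    by rewrite hr ?stag// er_s// andbC.
  rewrite (_ : _ * _ = (rch ib jb PB s ca * Xb c) * (rch ib jb PB s ca * Xb c)); last first.
    by rewrite /rch; ring.
  apply: is_sign_sqr; apply: is_signM; first exact: rch_sign.
  by apply: sign_prod => p ps; apply: bsign; rewrite ?stag.
have ttb : leg t b = 1.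
  rewrite Fb// /rch !ht ?inE ?eqxx ?orbT// /et /= psiM pn1 mulr1.
  rewrite -[RHS]rBb /rch; congr (_ * _).
  rewrite big_seq_cond [RHS]big_seq_cond; apply: eq_bigr => p /andP[ps pB].
  by rewrite ht ?stag// et_s// /PB pB andbF mulr1.
have tta : leg t a = 1.
  pose Y := \prod_(p <- s | PA p && PB p) bch p c.
  have YA : \prod_(p <- s | PA p) bch p c = Xa c * Y.
    by rewrite (bigID PB) /= mulrC.
  have YB : \prod_(p <- s | PB p) bch p c = Xb c * Y.
    by rewrite (bigID PA) /= mulrC; congr (_ * _); apply: eq_bigl => p; rewrite andbC.
  pose u := rch ia ja PA s cb; pose v := rch ib jb PB s ca; pose X := rch ib jb PB s ce.
  pose pa := psi ia ja (bch 4 c) (bch 8 c); pose pb := psi ib jb (bch 4 c) (bch 8 c).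
  have ea : pa * (Xa c * Y) = u * X.
    have : rch ia ja PA s c = u * X by rewrite {1}cE !rchM// rAa rABe mul1r.
    by rewrite /rch YA.
  have eb : pb * (Xb c * Y) = v * X.
    have : rch ib jb PB s c = v * X by rewrite {1}cE !rchM// rBb mulr1.
    by rewrite /rch YB.
  have su : is_sign u by apply: rch_sign.
  have sv : is_sign v by apply: rch_sign.
  have sX : is_sign X by apply: rch_sign.
  have sx n P : coprime n (modulus s) -> is_sign (\prod_(p <- s | P p) bch p n).
    by move=> co; apply: sign_prod => p ps; apply: bsign; rewrite ?stag.
  have sxa : is_sign (Xa c) by apply: sx.
  have sxb : is_sign (Xb c) by apply: sx.
  have sY : is_sign Y by apply: sx.
  rewrite Fa// /rch !ht ?inE ?eqxx ?orbT// /et /= psiM pn2 phiE -/pa -/pb -/v.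
  have -> : \prod_(p <- s | (p %| `|a|)%N) bch p t = \prod_(p <- s | PA p) bch p cb * Xa c.
    rewrite /Xa; under [X in _ * X]eq_bigl do rewrite andbC.
    rewrite -(split_prod PA (fun p => ~~ PB p) cb (fun p => bch p c)).
    rewrite big_seq_cond [RHS]big_seq_cond; apply: eq_bigr => p /andP[ps pB].
    by rewrite ht ?stag// et_s// andbC.
  rewrite (_ : _ * _ = u * Xa c * (pa * pb * (v * Xb c))); last by rewrite /u /rch; ring.
  clearbody u v X pa pb Y; move: (Xa c) (Xb c) ea eb sxa sxb => xa xb ea eb sxa sxb.
  rewrite (sign_solve (is_signM sxa sY) ea) (sign_solve (is_signM sxb sY) eb).
  rewrite (_ : _ * _ = (u * u) * (v * v) * (X * X) * (xa * xa) * (xb * xb) * (Y * Y)); last by ring.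
  by rewrite (is_sign_sqr su) (is_sign_sqr sv) (is_sign_sqr sX) (is_sign_sqr sxa) (is_sign_sqr sxb) (is_sign_sqr sY).
have small l : l \in primes c -> (l <= c)%N.
  by rewrite mem_primes => /and3P[_ _ /dvdn_leq]; apply.
have prim l : l \in primes c -> prime l && odd l by move=> /hc[-> ->].
have rl l : l \in primes c -> l != r by move=> /small lc; rewrite neq_ltn (leq_ltn_trans lc c_r).
have tl l : l \in primes c -> l != t by move=> /small lc; rewrite neq_ltn (leq_ltn_trans lc (ltn_trans c_r r_t)).
have uf P : uniq [seq l <- primes c | P l] by rewrite filter_uniq ?primes_uniq.
(* the three applications of Legendre's theorem *)
have na : nrm a%:~R (r * ca)%N%:R.
  have := @legendre_seq a (r :: ta); rewrite big_cons; apply=> //.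
  - by rewrite /= uf andbT; apply/negP => /sub_ta/rl; rewrite eqxx.
  - by rewrite /= pr oddr; apply/allP => l /sub_ta/prim.
  - move=> l; rewrite inE => /orP[/eqP->//|]; rewrite mem_filter => /andP[/eqP] //.
  move=> q pq oq qa; have qs : q \in s by rewrite hs// -[(q %| `|a|)%N]/(q %| a)%Z qa.
  rewrite -bch_prime// (bchM _ _ os) ?stag// hr ?stag// er_s// /PA -[(q %| `|a|)%N]/(q %| a)%Z qa andbF mulr1.
  by apply: is_sign_sqr; apply: bsign; rewrite ?stag.
have nb : nrm b%:~R (t * cb)%N%:R.
  have := @legendre_seq b (t :: tb); rewrite big_cons; apply=> //.
  - by rewrite /= uf andbT; apply/negP => /sub_tb/tl; rewrite eqxx.
  - by rewrite /= pt oddt; apply/allP => l /sub_tb/prim.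
  - move=> l; rewrite inE => /orP[/eqP->//|]; rewrite mem_filter => /andP[/andP[_ /eqP]] //.
  move=> q pq oq qb; have qs : q \in s by rewrite hs// -[(q %| `|b|)%N]/(q %| b)%Z qb orbT.
  rewrite -bch_prime// (bchM _ _ os) ?stag// ht ?stag// et_s// /PB -[(q %| `|b|)%N]/(q %| b)%Z qb andbF mulr1.
  by apply: is_sign_sqr; apply: bsign; rewrite ?stag.
have lege l : prime l -> odd l -> ~~ (l %| a)%Z -> ~~ (l %| b)%Z -> leg l a * leg l b = 1 -> leg l e = 1.
  move=> pl ol la lb; rewrite -legM// abE legM// leg_sqr ?mulr1//.
  apply/negP => lg; have : (l %| a * b)%Z by rewrite abE expr2 !dvdz_mull.
  by rewrite -leg_eq0// legM// mulf_eq0 !leg_eq0// (negbTE la) (negbTE lb).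
have nab : nrm (a * b)%:~R (r * (t * ce))%N%:R.
  have : nrm e%:~R (r * (t * ce))%N%:R.
    have := @legendre_seq e [:: r, t & te]; rewrite !big_cons; apply=> //.
    - rewrite /= uf !inE !negb_or andbT -andbA; apply/and3P; split.
      + by rewrite neq_ltn r_t.
      + by apply/negP => /sub_te/rl; rewrite eqxx.
      + by apply/negP => /sub_te/tl; rewrite eqxx.
    - by rewrite /= pr oddr pt oddt; apply/allP => l /sub_te/prim.
    - move=> l; rewrite !inE => /or3P[/eqP->|/eqP->|].
      + by apply: lege; rewrite ?rra ?rrb.
      + by apply: lege; rewrite ?tta ?ttb.
      + rewrite mem_filter => /andP[/andP[nA nB] lc]; have [pl ol la lb] := hc l lc.
        by apply: lege => //; case: (sA l lc) nA; rewrite /A => -> //; case: (sB l lc) nB; rewrite /B => ->.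
    move=> q pq oq; rewrite he// => qe.
    have qs : q \in s.
      rewrite hs// -[(q %| `|a|)%N]/(q %| a)%Z -[(q %| `|b|)%N]/(q %| b)%Z.
      by move: qe; do 2!case: (_ \in _).
    have qt := stag q qs.
    rewrite -bch_prime// !(bchM _ _ os)// hr// er_s// ht// et_s//.
    have [s1 s2 s3] : [/\ is_sign (bch q ca), is_sign (bch q cb) & is_sign (bch q ce)] by split; apply: bsign.
    have cq : bch q c = bch q ca * bch q cb * bch q ce by rewrite {1}cE !(bchM _ _ os).
    rewrite /PA /PB -[(q %| `|a|)%N]/(q %| a)%Z -[(q %| `|b|)%N]/(q %| b)%Z cq.
    move: qe; case: (_ \in _); case: (_ \in _) => //= _;
    by case: s1 => ->; case: s2 => ->; case: s3 => ->.
  move=> [x [y xy]]; exists x, (y / g%:~R); rewrite abE xy rmorphM rmorphXn/=.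
  have g0' : (g%:~R : rat) != 0 by rewrite intr_eq0.
  by field.
exists (r * ca)%N%:R, (t * cb)%N%:R, ((r * (t * ce))%N%:R * ((r * t)%N%:R^-1) ^+ 2); split=> //.
  by apply: nrmM => //; apply: nrm_sqr.
have r0 : (r%:R : rat) != 0 by rewrite pnatr_eq0 -lt0n prime_gt0.
have t0 : (t%:R : rat) != 0 by rewrite pnatr_eq0 -lt0n prime_gt0.
by rewrite {1}cE !natrM; field; rewrite r0 t0.
Qed.

(** * Changing the sign and removing the bad primes *)

Lemma nrm_int (al x y : int) (n : nat) : n%:Z = x ^+ 2 - al * y ^+ 2 -> nrm al%:~R n%:R.
Proof.
by move=> h; exists x%:~R, y%:~R; rewrite pmulrn h rmorphB/= rmorphXn/= rmorphM/= rmorphXn.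
Qed.

Lemma modn_of_dvdz (m n d : nat) : (d %| m%:Z - n%:Z)%Z -> m = n %[mod d].
Proof. by rewrite -eqz_mod_dvd !modz_nat => /eqP[]. Qed.

Lemma coprime_of_mod1 (m d : nat) : m = 1 %[mod d] -> coprime m d.
Proof. by move=> h; rewrite -coprime_modl h coprime_modl coprime1n. Qed.

Lemma dvd_norm_sub1 (W x al : int) : (W %| x - 1)%Z -> (W %| x ^+ 2 - al * W ^+ 2 - 1)%Z.
Proof.
move=> h; rewrite (_ : _ - 1 = (x - 1) * (x + 1) + W * (- al * W)); last by ring.
by rewrite rpredD// dvdz_mulr.
Qed.

(** A large power [x] of [p], congruent to 1 modulo [W], makes [x ^ 2 - al * W ^ 2] positive,
    exactly divisible by [p] and congruent to 1 modulo [W]. An odd prime dividing the cofactor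
    [m] but not [W] splits in Q(sqrt al). *)
Lemma prime_norm (al : int) (p W : nat) : prime p -> sqf `|al| -> (p %| al)%Z -> coprime p W ->
  (0 < W)%N -> exists m : nat, [/\ (0 < m)%N, coprime m p, (p * m)%N = 1 %[mod W],
    nrm al%:~R (p * m)%N%:R &
    forall l, prime l -> odd l -> (l %| m)%N -> ~~ (l %| W)%N -> leg l al = 1].
Proof.
move=> pp /sqfP[al0 sal] pal co W0.
have p0 := prime_gt0 pp.
pose K := (`|al| * W ^ 2).+1; pose E := (totient W * K)%N.
have tW : (0 < totient W)%N by rewrite totient_gt0.
have E0 : (0 < E)%N by rewrite muln_gt0 tW.
(* the exponent is a multiple of [totient W], and large *)
pose x := (p ^ E)%N.
have xK : (K < x)%N.
  apply: leq_trans (ltn_expl K (prime_gt1 pp)) _.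
  by rewrite leq_exp2l ?prime_gt1// leq_pmull.
have x1 : x = 1 %[mod W].
  by rewrite /x expnM -modnXm (Euler_exp_totient co) modnXm exp1n.
have /dvdzP[al1 alE] := pal.
have pal1 : ~~ (p %| al1)%Z.
  apply/negP => /dvdzP[al2 al1E]; have := sal p.
  rewrite alE al1E -mulrA -PoszM abszM /= lognM; last by rewrite muln_gt0 p0.
    have l1 : logn p p = 1%N by rewrite logn_prime// eqxx.
    by rewrite lognM// l1; lia.
  by move: al0; rewrite alE al1E !abszM !muln_gt0 -andbA => /andP[].
pose m' : int := p%:Z * (p ^ E.-1)%N%:Z ^+ 2 - al1 * W%:Z ^+ 2.
have vE : p%:Z * m' = x%:Z ^+ 2 - al * W%:Z ^+ 2.
  have -> : x%:Z = p%:Z * (p ^ E.-1)%N%:Z by rewrite -PoszM -expnS prednK.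
  by rewrite /m' alE; ring.
have vpos : 0 < p%:Z * m'.
  rewrite vE subr_gt0.
  apply: (@le_lt_trans _ _ (`|al|%N%:Z * (W ^ 2)%N%:Z)).
    rewrite (_ : (W ^ 2)%N%:Z = W%:Z ^+ 2); last by rewrite -mulnn expr2.
    by rewrite ler_wpM2r// ?sqr_ge0// abszE ler_norm.
  rewrite -PoszM; apply: (@lt_le_trans _ _ x%:Z); first by rewrite ltz_nat; apply: leq_trans xK; rewrite /K leqnSn.
  by rewrite expr2 -PoszM lez_nat leq_pmulr// expn_gt0 p0.
have m'0 : 0 < m' by move: vpos; rewrite pmulr_rgt0 ?ltz_nat.
have mE : m' = `|m'|%N by rewrite gtz0_abs.
have pm : ~~ (p %| `|m'|)%N.
  rewrite -[(p %| `|m'|)%N]/(p %| m')%Z /m' rpredBl; last by apply: dvdz_mulr.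
  rewrite dvdzE abszM abszX Euclid_dvdM// Euclid_dvdX// negb_or pal1 /= negb_and orbF.
  by rewrite -prime_coprime.
exists `|m'|%N; split.
- by rewrite absz_gt0 gt_eqF.
- by rewrite coprime_sym prime_coprime.
- apply: modn_of_dvdz; rewrite PoszM -mE vE.
  by apply: dvd_norm_sub1; rewrite -eqz_mod_dvd !modz_nat x1.
- by apply: (@nrm_int al x W); rewrite PoszM -mE.
move=> l pl ol lm lW.
have lp : l != p by apply/eqP => lp; move/negP: pm; apply; rewrite -lp.
have lx : ~~ (l %| x%:Z)%Z by rewrite dvdzE /= Euclid_dvdX// dvdn_prime2// negb_and lp.
have lv : (l %| x%:Z ^+ 2 - al * W%:Z ^+ 2)%Z by rewrite -vE dvdz_mull.
have := leg_mod pl lv; rewrite leg_sqr// legM// leg_sqr ?mulr1//.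
Qed.

Lemma sqr_mod8 (n : nat) : odd n -> (n ^ 2 = 8 * (n ^ 2 %/ 8) + 1)%N.
Proof.
move=> on; rewrite {1}(divn_eq (n ^ 2) 8) mulnC; congr (_ + _)%N.
rewrite -modnXm.
have : odd (n %% 8) by move: on; rewrite {1}(divn_eq n 8) oddD oddM andbF.
have : (n %% 8 < 8)%N by rewrite ltn_pmod.
by case: (n %% 8)%N => [|[|[|[|[|[|[|[|]]]]]]]].
Qed.

(** An odd number, congruent to 1 modulo [W], at which the norm form with second argument [W] is
    positive. *)
Lemma big_square (al : int) (W : nat) : (0 < W)%N ->
  al * W%:Z ^+ 2 < (1 + 2 * W * (`|al| + 1))%N%:Z ^+ 2.
Proof.
move=> W0; apply: (@le_lt_trans _ _ (`|al|%N%:Z * W%:Z ^+ 2)).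
  by rewrite ler_wpM2r// ?sqr_ge0// abszE ler_norm.
move: `|al|%N => A; rewrite -subr_gt0.
rewrite (_ : _ - _ = 1 + 4 * W%:Z * (A%:Z + 1) + W%:Z ^+ 2 * (4 * A%:Z ^+ 2 + 7 * A%:Z + 4)); last first.
  by rewrite !PoszD !PoszM; ring.
have h1 : 0 <= 4 * W%:Z * (A%:Z + 1) by rewrite !mulr_ge0// addr_ge0.
have h2 : 0 <= W%:Z ^+ 2 * (4 * A%:Z ^+ 2 + 7 * A%:Z + 4).
  by rewrite mulr_ge0 ?sqr_ge0// !addr_ge0// mulr_ge0// sqr_ge0.
by rewrite -addrA ltr_pwDl// addr_ge0.
Qed.

(** For odd [x] and [W] the value [x ^ 2 - al * W ^ 2] is 2 modulo 4. *)
Lemma two_norm_3mod4 (al : int) (W : nat) : odd W -> (4 %| al - 3)%Z ->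
  exists m, [/\ (0 < m)%N, odd m, coprime m W & nrm al%:~R (2 * m)%N%:R].
Proof.
move=> oW /dvdzP[t alE].
have W0 : (0 < W)%N by case: (W) oW.
set x := (1 + 2 * W * (`|al| + 1))%N.
have ox : odd x by rewrite /x oddD !oddM.
have := big_square al W0; rewrite -/x -subr_gt0.
have e1 := sqr_mod8 ox; have e2 := sqr_mod8 oW.
set s1 := (x ^ 2 %/ 8)%N in e1; set s2 := (W ^ 2 %/ 8)%N in e2.
have E1 : x%:Z ^+ 2 = 8 * s1%:Z + 1 by rewrite expr2 -PoszM mulnn e1.
have E2 : W%:Z ^+ 2 = 8 * s2%:Z + 1 by rewrite expr2 -PoszM mulnn e2.
pose m' : int := 2 * (2 * s1%:Z - 6 * s2%:Z - t * (8 * s2%:Z + 1)) - 1.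
have aE : al = t * 4 + 3 by rewrite -alE subrK.
have vE : x%:Z ^+ 2 - al * W%:Z ^+ 2 = 2 * m' by rewrite E1 E2 aE /m'; ring.
rewrite vE pmulr_rgt0// => m0.
have mE : m' = `|m'|%N by rewrite gtz0_abs.
have xW : (W %| 2 * m' - 1)%Z.
  rewrite -vE; apply: dvd_norm_sub1.
  by rewrite /x PoszD [X in (_ %| X)%Z]addrC addKr !PoszM dvdz_mulr// dvdz_mull.
exists `|m'|%N; split.
- by rewrite absz_gt0 gt_eqF.
- by move: mE; rewrite /m'; move: (2 * s1%:Z - _ - _) => z; lia.
- have : coprime (2 * `|m'|) W.
    by apply: coprime_of_mod1; apply: modn_of_dvdz; rewrite PoszM -mE.
  by rewrite coprimeMl => /andP[].
by apply: (@nrm_int al x W); rewrite PoszM -mE vE.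
Qed.

(** For odd [x] and [W] the value [x ^ 2 - al * W ^ 2] is divisible by 8; replacing [x] by [x +
    4 W] if necessary, the quotient is odd, and 8 is 2 times a square. *)
Lemma two_norm_1mod8 (al : int) (W : nat) : odd W -> (8 %| al - 1)%Z ->
  exists m, [/\ (0 < m)%N, odd m, coprime m W & nrm al%:~R (2 * m)%N%:R].
Proof.
move=> oW /dvdzP[t alE].
have W0 : (0 < W)%N by case: (W) oW.
have aE : al = t * 8 + 1 by rewrite -alE subrK.
set x := (1 + 2 * W * (`|al| + 1))%N.
have ox : odd x by rewrite /x oddD !oddM.
have xbig := big_square al W0; rewrite -/x in xbig.
have e1 := sqr_mod8 ox; have e2 := sqr_mod8 oW.
set s1 := (x ^ 2 %/ 8)%N in e1; set s2 := (W ^ 2 %/ 8)%N in e2.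
have E1 : x%:Z ^+ 2 = 8 * s1%:Z + 1 by rewrite expr2 -PoszM mulnn e1.
have E2 : W%:Z ^+ 2 = 8 * s2%:Z + 1 by rewrite expr2 -PoszM mulnn e2.
have xW1 : (W %| x%:Z - 1)%Z.
  by rewrite /x PoszD [X in (_ %| X)%Z]addrC addKr !PoszM dvdz_mulr// dvdz_mull.
suff [y [m' [m0 om yW yE]]] : exists (y : nat) (m' : int),
    [/\ 0 < m', odd `|m'|, (W %| y%:Z - 1)%Z & y%:Z ^+ 2 - al * W%:Z ^+ 2 = 8 * m'].
  have mE : m' = `|m'|%N by rewrite gtz0_abs.
  exists `|m'|%N; split=> //.
  - by rewrite absz_gt0 gt_eqF.
  - have : coprime (8 * `|m'|) W.
      apply: coprime_of_mod1; apply: modn_of_dvdz; rewrite PoszM -mE -yE.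
      exact: dvd_norm_sub1.
    by rewrite coprimeMl => /andP[].
  have : nrm al%:~R (8 * `|m'|)%N%:R by apply: (@nrm_int al y W); rewrite PoszM -mE yE.
  move/nrmM => /(_ _ (nrm_sqr al%:~R (2^-1))).
  by rewrite !natrM (_ : _ * _ = 2 * `|m'|%:R)//; field.
pose m1 : int := s1%:Z - s2%:Z - t * W%:Z ^+ 2.
have v1 : x%:Z ^+ 2 - al * W%:Z ^+ 2 = 8 * m1.
  rewrite E1 aE; transitivity (8 * s1%:Z + 1 - W%:Z ^+ 2 - 8 * (t * W%:Z ^+ 2)); first by ring.
  by rewrite {1}E2 /m1; ring.
have m10 : 0 < m1 by rewrite -(pmulr_rgt0 m1 (_ : 0 < 8)) // -v1 subr_gt0.
have [om|em] := boolP (odd `|m1|); first by exists x, m1.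
exists (x + 4 * W)%N, (m1 + W%:Z * x%:Z + 2 * W%:Z ^+ 2); split.
- by rewrite addr_gt0 ?mulr_gt0 ?exprn_gt0 ?ltz_nat// addr_gt0// mulr_gt0 ?ltz_nat.
- have : m1 + W%:Z * x%:Z + 2 * W%:Z ^+ 2 = (`|m1| + W * x + 2 * W ^ 2)%N%:Z.
    by rewrite !PoszD !PoszM gtz0_abs//; ring.
  by move=> ->; rewrite absz_nat !oddD !oddM (negbTE em) oW ox.
- by rewrite PoszD PoszM addrAC rpredD// dvdz_mull.
rewrite mulrDr mulrDr -v1 PoszD PoszM; ring.
Qed.

Lemma modulus_rem (s : seq nat) (p : nat) : p \in s -> modulus s = (p * modulus (rem p s))%N.
Proof. by move=> ps; rewrite /modulus (perm_big _ (perm_to_rem ps)) big_cons mulnCA. Qed.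

Lemma odd_primes_rem (s : seq nat) (p : nat) : odd_primes s -> odd_primes (rem p s).
Proof.
case=> us hs; split; first exact: rem_uniq.
by apply/allP => q /mem_rem qs; apply: (allP hs).
Qed.

Lemma coprime_modulus_rem (s : seq nat) (p : nat) : odd_primes s -> p \in s ->
  coprime p (modulus (rem p s)).
Proof.
move=> os ps; have [pp op] := odd_primesP os ps.
rewrite /modulus coprimeMr -[8%N]/(2 ^ 3)%N coprime_pexpr// coprimen2 op /=.
apply: coprime_primes_prod => //; first by case: os => us _; rewrite mem_rem_uniqF.
by apply/allP => q /mem_rem qs; have [] := odd_primesP os qs.
Qed.

(** Take norms [p * ma] from Q(sqrt a) and [p * me] from Q(sqrt (a b)), both congruent to 1
    modulo 8 and the other bad primes, and put [h = ma * me]. All primes of [ma] split in Q(sqrt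
    a), those of [me] contribute nothing, and reciprocity gives [phi h = leg p b = -1]. *)
Lemma phi_flip (a b : int) (s : seq nat) (ib jb : bool) (p : nat) : bad_primes a b s ->
  sqf `|a| -> sqf `|b| ->
  (forall l, prime l -> odd l -> ~~ (l %| b)%Z -> leg l b = rch ib jb (fun p => p %| `|b|)%N s l) ->
  prime p -> odd p -> (p %| a)%Z -> ~~ (p %| b)%Z -> leg p b = -1 ->
  exists h, [/\ (0 < h)%N, coprime h (modulus s), normG a b h%:R,
    bch 4 h = 1 /\ bch 8 h = 1 & phi a b s h = -1].
Proof.
move=> bs sa sb Fb pp op pa pb lpb.
have [os hs] := bs.
have [e [g [abE g0 se he]]] := sqf_lcm_core sa sb.
have ps : p \in s by rewrite hs// -[(p %| `|a|)%N]/(p %| a)%Z pa.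
have pe : (p %| e)%Z by rewrite he// pa (negbTE pb).
set W := modulus (rem p s).
have oW : odd_primes (rem p s) by apply: odd_primes_rem.
have coW : coprime p W by apply: coprime_modulus_rem.
have W0 : (0 < W)%N by apply: modulus_gt0.
have sW : modulus s = (p * W)%N by apply: modulus_rem.
have [ma [ma0 cma ma1 nma lma]] := prime_norm pp sa pa coW W0.
have [me [me0 cme me1 nme lme]] := prime_norm pp se pe coW W0.
have coM m : coprime m p -> (p * m)%N = 1 %[mod W] -> coprime m (modulus s).
  move=> cm /coprime_of_mod1; rewrite coprimeMl => /andP[_ cW].
  by rewrite sW coprimeMr cm.
have coma := coM _ cma ma1; have come := coM _ cme me1.
have p0 : (p%:R : rat) != 0 by rewrite pnatr_eq0 -lt0n prime_gt0.
have bp m q : (p * m)%N = 1 %[mod W] -> q \in tags (rem p s) -> bch q p * bch q m = 1.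
  by move=> m1 qs; rewrite -(bchM _ _ oW)// (bch_mod oW qs m1) (bch1 oW).
have bh q : q \in tags (rem p s) -> bch q (ma * me) = 1.
  move=> qs; rewrite (bchM _ _ oW)//.
  have sp : is_sign (bch q p) by apply: bch_sign qs coW.
  have := bp _ _ ma1 qs; have := bp _ _ me1 qs.
  case: sp => ->; first by rewrite !mul1r => -> ->.
  by rewrite !mulN1r => /(canRL (@opprK _)) -> /(canRL (@opprK _)) ->.
exists (ma * me)%N; split.
- by rewrite muln_gt0 ma0.
- by rewrite coprimeMl coma.
- apply: (@normG_cancel _ _ _ (p%:R ^+ 2)); [by rewrite expf_neq0| |exact: normG_sqr].
  rewrite (_ : _ * _ = (p * ma)%N%:R * (p * me)%N%:R); last by rewrite !natrM; ring.
  apply: normGM; first exact: normG_a.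
  apply: normG_ab; rewrite abE; move: nme => [x [y ->]].
  have g0' : (g%:~R : rat) != 0 by rewrite intr_eq0.
  by exists x, (y / g%:~R); rewrite rmorphM/= rmorphXn/=; field.
- by split; apply: bh; rewrite !inE.
rewrite /phi [X in _ * X]big_seq_cond [X in _ * X]big1 ?mulr1; last first.
  move=> q /and3P[qs qb qa]; apply: bh; rewrite !inE.
  have qp : q != p by apply: contra qa => /eqP ->; move: pa; rewrite dvdzE.
  by rewrite (rem_mem qp qs) !orbT.
rewrite cmulM//.
have -> : cmul (split_inert a b) me = 1.
  apply: cmul_eq1 => l pl lm; rewrite /split_inert; case: eqP => // la1.
  have [ol la lb] := coprime_bad bs come pl lm.
  have lW : ~~ (l %| W)%N.
    by rewrite -prime_coprime//; apply: coprime_dvdl lm _; move: come; rewrite sW coprimeMr => /andP[].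
  have lg : ~~ (l %| g)%Z.
    apply/negP => lg; have : (l %| a * b)%Z by rewrite abE expr2 !dvdz_mull.
    by rewrite -leg_eq0// legM// mulf_eq0 !leg_eq0// (negbTE la) (negbTE lb).
  have : leg l (a * b) = 1 by rewrite abE legM// lme// leg_sqr.
  by rewrite legM// la1 mul1r.
rewrite mulr1.
have -> : cmul (split_inert a b) ma = cmul (rch ib jb (fun p => p %| `|b|)%N s) ma.
  apply: eq_cmul => l pl lm; have [ol la lb] := coprime_bad bs coma pl lm.
  have lW : ~~ (l %| W)%N.
    by rewrite -prime_coprime//; apply: coprime_dvdl lm _; move: coma; rewrite sW coprimeMr => /andP[].
  by rewrite /split_inert lma// eqxx Fb.
rewrite cmul_rch//.
have : rch ib jb (fun p => p %| `|b|)%N s p * rch ib jb (fun p => p %| `|b|)%N s ma = 1.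
  rewrite -rchM// /rch (bchM _ _ oW) ?inE ?eqxx ?orbT// (bchM _ _ oW) ?inE ?eqxx ?orbT//.
  rewrite !(bp _ _ ma1) ?inE ?eqxx ?orbT// /psi !expr1n !mul1r big_seq_cond big1//.
  move=> q /andP[qs qb]; have qp : q != p by apply: contraNneq pb => <-; rewrite dvdzE.
  by rewrite (bchM _ _ os) ?inE ?qs ?orbT// bp// !inE (rem_mem qp qs) !orbT.
by rewrite -Fb// lpb mulN1r => /(canRL (@opprK _)).
Qed.

Lemma sqf_part (n : nat) : (0 < n)%N -> exists m k : nat, n = (m * k ^ 2)%N /\ sqf m.
Proof.
move=> n0.
exists (\prod_(p <- primes n) p ^ (odd (logn p n)))%N, (\prod_(p <- primes n) p ^ (logn p n)./2)%N.
split.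
  rewrite {1}(prod_prime_decomp n0) prime_decompE big_map /=.
  rewrite -mulnn -!big_split /=; apply: eq_bigr => p _.
  by rewrite -!expnD addnn odd_double_half.
have -> : (\prod_(p <- primes n) p ^ (odd (logn p n)) = \prod_(p <- [seq p <- primes n | odd (logn p n)]) p)%N.
  rewrite big_filter [RHS]big_mkcond; apply: eq_bigr => p _.
  by case: (odd _); rewrite ?expn1 ?expn0.
apply: sqf_prod_primes; first by rewrite filter_uniq ?primes_uniq.
by apply/allP => p; rewrite mem_filter mem_primes => /and3P[_ ->].
Qed.

(** [c] becomes a product of norms after multiplication by an integer prime to the bad primes
    and to 2. *)
Definition good_multiple (a b : int) (s : seq nat) (c : nat) : Prop :=
  exists m, [/\ (0 < m)%N, coprime m (modulus s) & normG a b (c * m)%N%:R].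

Lemma good_multipleM a b s c d : good_multiple a b s c -> good_multiple a b s d ->
  good_multiple a b s (c * d).
Proof.
move=> [m [m0 cm gm]] [n [n0 cn gn]]; exists (m * n)%N; split.
- by rewrite muln_gt0 m0.
- by rewrite coprimeMl cm.
by rewrite mulnACA natrM; apply: normGM.
Qed.

(** If [a] or [b] is even, 2 ramifies; otherwise one of [a], [b], [a * b] is 3 modulo 4 or 1
    modulo 8. *)
Lemma good_multiple_2 (a b : int) (s : seq nat) : odd_primes s -> sqf `|a| -> sqf `|b| ->
  good_multiple a b s 2.
Proof.
move=> os sa sb; set W := (\prod_(p <- s) p)%N.
have oW : odd W.
  rewrite /W; elim: (s) os => [|p s' IH] os; first by rewrite big_nil.
  have [pp op] := odd_primesP os (mem_head _ _).
  rewrite big_cons oddM op IH//; case: os => /= /andP[_ us] /andP[_ hs]; split=> //.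
have W0 : (0 < W)%N by case: (W) oW.
have co m : coprime m 2 -> coprime m W -> coprime m (modulus s).
  by move=> c1 c2; rewrite /modulus coprimeMr c2 andbT -[8%N]/(2 ^ 3)%N coprime_pexpr.
have fin al : (exists m, [/\ (0 < m)%N, odd m, coprime m W & nrm al%:~R (2 * m)%N%:R]) ->
   (forall c, nrm al%:~R c -> normG a b c) -> good_multiple a b s 2.
  by move=> [m [m0 om cm nm]] h; exists m; split; [|apply: co; rewrite ?coprimen2|apply: h].
have even al : sqf `|al| -> (2 %| al)%Z -> (forall c, nrm al%:~R c -> normG a b c) -> good_multiple a b s 2.
  move=> sal eal; apply: fin.
  have [|m [m0 cm m1 nm _]] := prime_norm (isT : prime 2) sal eal (W := W) _ W0; first by rewrite coprime2n.
  exists m; split=> //; first by rewrite -coprimen2.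
  by have := coprime_of_mod1 m1; rewrite coprimeMl => /andP[].
have [ea|oa] := boolP (2 %| a)%Z; first exact: (even a) (@normG_a a b).
have [eb|ob] := boolP (2 %| b)%Z; first exact: (even b) (@normG_b a b).
have m4 (x : int) : ~~ (2 %| x)%Z -> (4 %| x - 3)%Z \/ (8 %| x - 1)%Z \/ (8 %| x - 5)%Z.
  clear; have := divz_eq x 8; set q := (x %/ 8)%Z; have : 0 <= (x %% 8)%Z by rewrite modz_ge0.
  have : (x %% 8)%Z < 8 by rewrite ltz_pmod.
  case: (x %% 8)%Z => // n.
  do 8?[case: n => [|n]] => // _ _ -> h.
  - by exfalso; move/negP: h; apply; apply/dvdzP; exists (q * 4); ring.
  - by right; left; apply/dvdzP; exists q; ring.
  - by exfalso; move/negP: h; apply; apply/dvdzP; exists (q * 4 + 1); ring.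
  - by left; apply/dvdzP; exists (q * 2); ring.
  - by exfalso; move/negP: h; apply; apply/dvdzP; exists (q * 4 + 2); ring.
  - by right; right; apply/dvdzP; exists q; ring.
  - by exfalso; move/negP: h; apply; apply/dvdzP; exists (q * 4 + 3); ring.
  - by left; apply/dvdzP; exists (q * 2 + 1); ring.
have [a3|[a1|a5]] := m4 a oa.
- exact: (fin a (two_norm_3mod4 oW a3) (@normG_a a b)).
- exact: (fin a (two_norm_1mod8 oW a1) (@normG_a a b)).
have [b3|[b1|b5]] := m4 b ob.
- exact: (fin b (two_norm_3mod4 oW b3) (@normG_b a b)).
- exact: (fin b (two_norm_1mod8 oW b1) (@normG_b a b)).
have ab1 : (8 %| a * b - 1)%Z.
  move/dvdzP: a5 => [x xE]; move/dvdzP: b5 => [y yE].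
  rewrite -(subrK 5 a) -(subrK 5 b) xE yE; apply/dvdzP; exists (8 * x * y + 5 * x + 5 * y + 3); ring.
exact: (fin (a * b) (two_norm_1mod8 oW ab1) (@normG_ab a b)).
Qed.

(** Prime by prime: a bad prime ramifies in Q(sqrt a) or Q(sqrt b), any other odd prime is
    multiplied by itself. *)
Lemma good_multiple_all (a b : int) (s : seq nat) (c : nat) : bad_primes a b s ->
  sqf `|a| -> sqf `|b| -> (0 < c)%N -> good_multiple a b s c.
Proof.
move=> bs sa sb; have [os hs] := bs.
elim/ltn_ind: c => c IH c0.
have [->|c1] := eqVneq c 1%N.
  by exists 1%N; split; rewrite ?coprime1n// muln1; apply: normG_a; apply: nrm1.
have c2 : (1 < c)%N by rewrite ltn_neqAle eq_sym c1.
have pp := pdiv_prime c2; set p := pdiv c in pp.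
have cE : c = (p * (c %/ p))%N by rewrite mulnC divnK// pdiv_dvd.
have d0 : (0 < c %/ p)%N by rewrite divn_gt0 ?prime_gt0// pdiv_leq.
rewrite cE; apply: good_multipleM; last first.
  by apply: IH => //; rewrite ltn_Pdiv// prime_gt1.
have [/eqP p2|np2] := boolP (p == 2%N); first by rewrite p2; apply: good_multiple_2.
have op : odd p by apply: contraR np2 => /(prime_oddPn pp) ->.
have [ps|ps] := boolP (p \in s); last first.
  exists p; split; first exact: prime_gt0.
    rewrite prime_coprime// /modulus Euclid_dvdM// negb_or -[8%N]/(2 ^ 3)%N Euclid_dvdX// dvdn_prime2// (negbTE np2) /=.
    rewrite -prime_coprime//; apply: coprime_primes_prod => //.
    by apply/allP => q /(odd_primesP os)[].
  by rewrite mulnn natrX; apply: normG_sqr.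
have gen al : sqf `|al| -> (p %| al)%Z -> (forall c, nrm al%:~R c -> normG a b c) -> good_multiple a b s p.
  move=> sal pal h; have coW := coprime_modulus_rem os ps.
  have W0 := modulus_gt0 (odd_primes_rem p os).
  have [m [m0 cm m1 nm _]] := prime_norm pp sal pal coW W0.
  exists m; split=> //; last exact: h.
  rewrite (modulus_rem ps) coprimeMr cm /=.
  by have := coprime_of_mod1 m1; rewrite coprimeMl => /andP[].
have := ps; rewrite hs// => /orP[pa|pb]; first exact: (gen a) (@normG_a a b).
exact: (gen b) (@normG_b a b).
Qed.

(** By [good_multiple_all], [c] is replaced by a squarefree [m'] prime to [2 a b]. If [phi m']
    is the sign [f] allowed by [sign_choice], then [normG_core] applies; otherwise it applies to
    the squarefree part of [m' * h] for the [h] of [phi_flip], which has the same characters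
    modulo 8. *)
Lemma normG_of_noncyclic_prime (R : realType) (a b : int) (p c : nat) :
  sqf `|a| -> sqf `|b| -> prime p -> odd p -> (p %| a)%Z -> ~~ (p %| b)%Z -> leg p b = -1 ->
  (0 < c)%N -> normG a b c%:R.
Proof.
move=> sa sb pp op pa pb lpb c0.
have a0 : (0 < `|a|)%N by case/andP: sa.
have b0 : (0 < `|b|)%N by case/andP: sb.
pose s := oddp (`|a| * `|b|).
have os : odd_primes s.
  split; first by rewrite filter_uniq// primes_uniq.
  by apply/allP => q; rewrite mem_filter mem_primes => /andP[-> /andP[->]].
have bs : bad_primes a b s.
  split=> // q pq oq; rewrite mem_filter oq mem_primes pq muln_gt0 a0 b0 /=.
  by rewrite Euclid_dvdM.
have [_ hs] := bs.
have [|ia [ja Fa]] := leg_factor os sa.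
  by move=> q pq oq; rewrite dvdzE /= hs// => ->.
have [|ib [jb Fb]] := leg_factor os sb.
  by move=> q pq oq; rewrite dvdzE /= hs// => ->; rewrite orbT.
have [m [m0 com gm]] := good_multiple_all bs sa sb c0.
suff Gm : normG a b m%:R.
  by apply: normG_cancel Gm; rewrite -?natrM// pnatr_eq0 -lt0n.
have [h [h0 coh Gh [h4 h8] ph]] := phi_flip bs sa sb Fb pp op pa pb lpb.
have [m' [k [mE sm']]] := sqf_part m0.
have com' : coprime m' (modulus s) by move: com; rewrite mE coprimeMl => /andP[].
have m'0 : (0 < m')%N by case/andP: sm'.
have k0 : (0 < k)%N by move: m0; rewrite mE muln_gt0 expn_gt0 => /andP[_]; rewrite orbF.
have natk0 (j : nat) : (0 < j)%N -> (j%:R : rat) != 0 by rewrite pnatr_eq0 -lt0n.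
suff Gm' : normG a b m'%:R.
  by rewrite mE natrM natrX; apply: normGM => //; apply: normG_sqr.
have sgn q n : q \in tags s -> coprime n (modulus s) -> is_sign (bch q n).
  by move=> qs; apply: bch_sign qs.
have t4 : 4 \in tags s by rewrite inE.
have t8 : 8 \in tags s by rewrite !inE orbT.
have [f [m4 [m8 [n4 [n8 [sf sm sn pm pn]]]]]] :=
  sign_choice ia ja ib jb (sgn 4 m' t4 com') (sgn 8 m' t8 com').
have core n : sqf n -> coprime n (modulus s) -> bch 4 n = bch 4 m' -> bch 8 n = bch 8 m' ->
    phi a b s n = f -> normG a b n%:R.
  move=> sqn con e4 e8 pf.
  by apply: (@normG_core R a b s ia ja ib jb n m4 m8 n4 n8); rewrite ?pf ?e4 ?e8.
have phiM x y : (0 < x)%N -> (0 < y)%N -> phi a b s (x * y) = phi a b s x * phi a b s y.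
  move=> x0 y0; rewrite /phi cmulM//.
  have -> : \prod_(q <- s | (q %| `|b|)%N && ~~ (q %| `|a|)%N) bch q (x * y) =
     \prod_(q <- s | (q %| `|b|)%N && ~~ (q %| `|a|)%N) bch q x * \prod_(q <- s | (q %| `|b|)%N && ~~ (q %| `|a|)%N) bch q y.
    rewrite -big_split big_seq_cond [RHS]big_seq_cond; apply: eq_bigr => q /andP[qs _].
    by rewrite (bchM _ _ os)// !inE qs !orbT.
  by ring.
have phi_sgn x : coprime x (modulus s) -> is_sign (phi a b s x).
  move=> cx; apply: is_signM.
    apply: cmul_sign => l pl lx; have [ol la lb] := coprime_bad bs cx pl lx.
    by rewrite /split_inert; case: ifP => _; [apply: leg_is_sign|left].
  by apply: sign_prod => q qs; apply: sgn => //; rewrite !inE qs !orbT.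
have [fE|fN] : phi a b s m' = f \/ phi a b s m' = - f.
  by case: (phi_sgn m' com') => ->; case: sf => ->; [left|right|right|left].
  exact: core.
have [m'' [k' [hE sm'']]] : exists m k : nat, (m' * h)%N = (m * k ^ 2)%N /\ sqf m.
  by apply: sqf_part; rewrite muln_gt0 m'0.
have m''0 : (0 < m'')%N by case/andP: sm''.
have k'0 : (0 < k')%N.
  have : (0 < m' * h)%N by rewrite muln_gt0 m'0.
  by rewrite hE muln_gt0 expn_gt0 => /andP[_]; rewrite orbF.
have co2 : coprime (m'' * k' ^ 2) (modulus s) by rewrite -hE coprimeMl com'.
have [com'' cok'] : coprime m'' (modulus s) /\ coprime k' (modulus s).
  by move: co2; rewrite coprimeMl => /andP[-> ]; rewrite -mulnn coprimeMl => /andP[].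
have bq q : q \in tags s -> bch q h = 1 -> bch q m'' = bch q m'.
  move=> qs qh; have : bch q (m' * h) = bch q (m'' * k' ^ 2) by rewrite hE.
  rewrite -mulnn !(bchM _ _ os)// qh mulr1 is_sign_sqr ?mulr1//; exact: sgn.
suff : normG a b (m' * h)%N%:R.
  by rewrite natrM => g; apply: normG_cancel Gh => //; apply: natk0.
rewrite hE natrM natrX; apply: normGM; last exact: normG_sqr.
apply: core => //; try exact: bq.
have : phi a b s (m' * h) = phi a b s (m'' * k' ^ 2) by rewrite hE.
rewrite -mulnn !phiM ?muln_gt0 ?k'0// ph fN mulrN1 opprK (is_sign_sqr (phi_sgn _ cok')) mulr1.
by move=> <-.
Qed.

(** * Periodic functions on boxes *)

Lemma sum_periodic (R : pzRingType) (g : nat -> R) (q k r : nat) :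
  (forall i, g i = g (i %% q)%N) ->
  \sum_(0 <= i < k * q + r) g i = k%:R * (\sum_(0 <= i < q) g i) + \sum_(0 <= i < r) g i.
Proof.
move=> hg; elim: k => [|k IH]; first by rewrite mul0n mul0r add0r.
rewrite mulSn -addnA (@big_cat_nat _ _ _ q 0)//= ?leq_addr//.
have -> : \sum_(q <= i < q + (k * q + r)) g i = \sum_(0 <= i < k * q + r) g i.
  rewrite -{1}[q]add0n big_addn addKn; apply: eq_big_nat => i _.
  by rewrite hg modnDr -hg.
by rewrite IH -natr1 mulrDl mul1r addrA [X in X + _]addrC.
Qed.

Definition periodic2 (T : Type) (q : nat) (f : nat -> nat -> T) : Prop :=
  forall i j, f i j = f (i %% q)%N (j %% q)%N.

Definition sum2 (R : nmodType) (q : nat) (f : nat -> nat -> R) : R :=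
  \sum_(0 <= i < q) \sum_(0 <= j < q) f i j.

Lemma periodic2_dvd (T : Type) (q Q : nat) (f : nat -> nat -> T) : (q %| Q)%N ->
  periodic2 q f -> periodic2 Q f.
Proof.
by move=> qQ h i j; rewrite h [RHS]h !modn_dvdm.
Qed.

(** Full periods contribute at most the mean value times the area, as the mean is nonnegative;
    the boundary strips contribute at most their area. *)
Lemma box_sum_le (R : realFieldType) (q X : nat) (f : nat -> nat -> R) : (0 < q)%N ->
  periodic2 q f -> (forall i j, `|f i j| <= 1) -> 0 <= sum2 q f ->
  sum2 X f <= X%:R ^+ 2 * (sum2 q f / q%:R ^+ 2) + 2 * (X * q)%:R.
Proof.
move=> q0 pf f1 S0.
set k := (X %/ q)%N; set r := (X %% q)%N.
have XE : X = (k * q + r)%N by apply: divn_eq.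
have rq : (r < q)%N by rewrite ltn_pmod.
have pj i : forall j, f i j = f i (j %% q)%N by move=> j; rewrite pf [RHS]pf modn_mod.
pose Rr i := \sum_(0 <= j < q) f i j; pose rho i := \sum_(0 <= j < r) f i j.
have pR : forall i, Rr i = Rr (i %% q)%N.
  by move=> i; apply: eq_bigr => j _; rewrite pf [RHS]pf modn_mod.
have E : sum2 X f = k%:R * (k%:R * sum2 q f + \sum_(0 <= i < r) Rr i) + \sum_(0 <= i < X) rho i.
  rewrite /sum2 (eq_bigr (fun i => k%:R * Rr i + rho i)); last first.
    by move=> i _; rewrite {1}XE (sum_periodic _ _ (pj i)).
  by rewrite big_split/= -mulr_sumr {1}XE (sum_periodic _ _ pR).
have hrho : \sum_(0 <= i < X) rho i <= (X * q)%:R.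
  apply: (@le_trans _ _ (\sum_(0 <= i < X) q%:R)).
    apply: ler_sum => i _; apply: (@le_trans _ _ (\sum_(0 <= j < r) 1)).
      by apply: ler_sum => j _; apply: le_trans (ler_norm _) (f1 _ _).
    by rewrite sumr_const_nat subn0 ler_nat ltnW.
  by rewrite sumr_const_nat subn0 -mulrnA mulnC.
have hR : \sum_(0 <= i < r) Rr i <= (q * q)%:R.
  apply: (@le_trans _ _ (\sum_(0 <= i < r) q%:R)).
    apply: ler_sum => i _; apply: (@le_trans _ _ (\sum_(0 <= j < q) 1)).
      by apply: ler_sum => j _; apply: le_trans (ler_norm _) (f1 _ _).
    by rewrite sumr_const_nat subn0.
  by rewrite sumr_const_nat subn0 -mulrnA ler_nat leq_mul2l (ltnW rq) orbT.
have k0 : 0 <= (k%:R : R) by [].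
have kX : k%:R * q%:R <= (X%:R : R) by rewrite -natrM ler_nat leq_trunc_div.
have q0' : 0 < (q%:R : R) by rewrite ltr0n.
rewrite E.
have h1 : k%:R * \sum_(0 <= i < r) Rr i <= (X * q)%:R.
  apply: (@le_trans _ _ (k%:R * (q * q)%:R)); first by rewrite ler_wpM2l.
  by rewrite !natrM mulrA ler_wpM2r.
have h2 : k%:R * (k%:R * sum2 q f) <= X%:R ^+ 2 * (sum2 q f / q%:R ^+ 2).
  rewrite (_ : k%:R * (k%:R * sum2 q f) = (k%:R * q%:R) ^+ 2 * (sum2 q f / q%:R ^+ 2)); last by field; rewrite gt_eqF.
  rewrite ler_wpM2r ?divr_ge0 ?exprn_ge0//.
  by rewrite ler_sqr ?nnegrE ?mulr_ge0.
by rewrite mulrDr; lra.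
Qed.

(** The Chinese remainder theorem. *)
Lemma sum_crt (R : nmodType) (q1 q2 : nat) (H : nat -> nat -> R) : (0 < q1)%N -> (0 < q2)%N ->
  coprime q1 q2 ->
  \sum_(0 <= i < q1 * q2) H (i %% q1)%N (i %% q2)%N =
  \sum_(0 <= i < q1) \sum_(0 <= j < q2) H i j.
Proof.
move=> h1 h2 co; rewrite !big_mkord.
under [RHS]eq_bigr do rewrite big_mkord.
rewrite pair_big /=.
pose h (i : 'I_(q1 * q2)) : 'I_q1 * 'I_q2 := (Ordinal (ltn_pmod i h1), Ordinal (ltn_pmod i h2)).
have hi : injective h.
  move=> i j [e1 e2]; apply: val_inj => /=.
  have /eqP : i = j %[mod q1 * q2] by apply/eqP; rewrite chinese_remainder// e1 e2 !eqxx.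
  by rewrite !modn_small ?ltn_ord// => /eqP.
have hb : bijective h by apply: inj_card_bij => //; rewrite card_prod !card_ord.
by rewrite (reindex h) //; apply: onW_bij.
Qed.

Lemma sum2_crt (R : comPzRingType) (q1 q2 : nat) (f g : nat -> nat -> R) : (0 < q1)%N -> (0 < q2)%N ->
  coprime q1 q2 -> periodic2 q1 f -> periodic2 q2 g ->
  sum2 (q1 * q2) (fun i j => f i j * g i j) = sum2 q1 f * sum2 q2 g.
Proof.
move=> h1 h2 co pf pg.
transitivity (\sum_(0 <= i < q1 * q2) \sum_(0 <= j1 < q1) \sum_(0 <= j2 < q2)
   f (i %% q1)%N j1 * g (i %% q2)%N j2).
  apply: eq_bigr => i _.
  rewrite -(@sum_crt _ q1 q2 (fun j1 j2 => f (i %% q1)%N j1 * g (i %% q2)%N j2))//.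
  by apply: eq_bigr => j _; rewrite pf pg.
rewrite (@sum_crt _ q1 q2 (fun i1 i2 => \sum_(0 <= j1 < q1) \sum_(0 <= j2 < q2) f i1 j1 * g i2 j2))//.
rewrite /sum2 mulr_suml; apply: eq_bigr => i1 _; rewrite mulr_sumr; apply: eq_bigr => i2 _.
by rewrite mulr_suml; apply: eq_bigr => j1 _; rewrite mulr_sumr.
Qed.

Lemma sum2_prod (R : comPzRingType) (s : seq nat) (f : nat -> nat -> nat -> R) : uniq s -> all prime s ->
  (forall p, p \in s -> periodic2 (p ^ 2) (f p)) ->
  periodic2 (\prod_(p <- s) p ^ 2)%N (fun i j => \prod_(p <- s) f p i j) /\
  sum2 (\prod_(p <- s) p ^ 2)%N (fun i j => \prod_(p <- s) f p i j) = \prod_(p <- s) sum2 (p ^ 2) (f p).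
Proof.
elim: s => [|p s IH].
  move=> _ _ _; split; first by move=> i j; rewrite !big_nil.
  by rewrite big_nil /sum2 !big_nat1 !big_nil.
move=> /= /andP[ps us] /andP[pp hs] H.
have [|IH1 IH2] := IH us hs; first by move=> q qs; apply: H; rewrite inE qs orbT.
have Hp := H p (mem_head _ _).
have co : coprime (p ^ 2) (\prod_(q <- s) q ^ 2).
  rewrite coprimeXl//.
  elim: (s) ps hs => [|q s' IHs]; first by rewrite big_nil coprimen1.
  rewrite inE negb_or big_cons coprimeMr => /andP[pq ps] /= /andP[pq' hs'].
  by rewrite IHs// andbT coprimeXr// prime_coprime// dvdn_prime2.
have Q0 : (0 < \prod_(q <- s) q ^ 2)%N.
  elim: (s) hs => [|q s' IHs] /=; first by rewrite big_nil.
  by move=> /andP[pq /IHs h]; rewrite big_cons muln_gt0 expn_gt0 prime_gt0.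
have p0 : (0 < p ^ 2)%N by rewrite expn_gt0 prime_gt0.
rewrite !big_cons -IH2 -sum2_crt//; split.
  move=> i j; rewrite !big_cons; congr (_ * _).
    by move: i j; apply: periodic2_dvd Hp; apply: dvdn_mulr.
  by move: i j; apply: periodic2_dvd IH1; apply: dvdn_mull.
by apply: eq_bigr => i _; apply: eq_bigr => j _; rewrite big_cons.
Qed.

Lemma sum_dvd_ind (R : pzRingType) (p k : nat) : (0 < p)%N ->
  \sum_(0 <= i < k * p) (p %| i)%N%:R = k%:R :> R.
Proof.
move=> p0; rewrite -[(k * p)%N]addn0 (@sum_periodic R (fun i => (p %| i)%N%:R) p k 0); last first.
  by move=> i; rewrite /dvdn modn_mod.
rewrite [\sum_(0 <= i < 0) _]big_geq// addr0 big_ltn// dvdn0 big1_seq ?addr0 ?mulr1//.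
move=> i; rewrite mem_index_iota => /andP[_ /andP[i0 ip]].
by rewrite gtnNdvd.
Qed.

Lemma sum_leg (R : pzRingType) (p k : nat) (e : int) : prime p -> odd p ->
  \sum_(0 <= i < k * p) (leg p (e * i%:Z))%:~R = 0 :> R.
Proof.
move=> pp op; rewrite -[(k * p)%N]addn0 (@sum_periodic R (fun i => (leg p (e * i%:Z))%:~R) p k 0); last first.
  move=> i; congr (_%:~R); apply: leg_mod => //; rewrite -mulrBr dvdz_mull//.
  by rewrite -eqz_mod_dvd !modz_nat modn_mod.
rewrite [\sum_(0 <= i < 0) _]big_geq// addr0.
rewrite (_ : \sum_(0 <= i < p) _ = 0) ?mulr0//.
have := sum_legF pp op; rewrite -(big_mkord xpredT (fun i => leg p i)) Fp_cast// => h.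
under eq_bigr do rewrite legM// rmorphM/=.
by rewrite -mulr_sumr -rmorph_sum/= h mulr0.
Qed.

(** * The sieve functions *)

(** [pz], [pd] and [pu] are the indicators of [p]-adic valuation at least 2, equal to 1 and
    equal to 0; [pl] is the Legendre symbol of [e * i]. *)
Definition pz (R : pzRingType) (p : nat) (i : nat) : R := (p ^ 2 %| i)%N%:R.
Definition pd (R : pzRingType) (p : nat) (i : nat) : R := ((p %| i) && ~~ (p ^ 2 %| i))%N%:R.
Definition pu (R : pzRingType) (p : nat) (i : nat) : R := (~~ (p %| i))%N%:R.
Definition pl (R : pzRingType) (p : nat) (e : int) (i : nat) : R := (leg p (e * i%:Z))%:~R.

(** The indicator of the classes modulo [p ^ 2] that contain no exceptional pair: [p ^ 2]
    divides [i], or [p] exactly divides one of the two while the other is a non-residue. *)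
Definition excluded (R : fieldType) (p : nat) (e f : int) (i j : nat) : R :=
  pz R p i + pd R p i * ((pu R p j - pl R p f j) / 2) + pd R p j * ((pu R p i - pl R p e i) / 2).

(** The function equal to [1 / p] off the excluded classes and constant on them, with mean value
    0. *)
Definition chi_p (R : fieldType) (p : nat) (e f : int) (i j : nat) : R :=
  p%:R^-1 - p%:R ^+ 2 / (p%:R ^+ 2 - p%:R + 1) * excluded R p e f i j.

Lemma sum_pz (R : comPzRingType) (p : nat) : prime p -> \sum_(0 <= i < p ^ 2) pz R p i = 1.
Proof.
by move=> pp; rewrite -[(p ^ 2)%N]mul1n sum_dvd_ind// expn_gt0 prime_gt0.
Qed.

Lemma sum_dvd_p2 (R : comPzRingType) (p : nat) : prime p -> \sum_(0 <= i < p ^ 2) (p %| i)%N%:R = p%:R :> R.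
Proof. by move=> pp; rewrite -mulnn sum_dvd_ind// prime_gt0. Qed.

Lemma sum_pd (R : comPzRingType) (p : nat) : prime p -> \sum_(0 <= i < p ^ 2) pd R p i = p%:R - 1.
Proof.
move=> pp; rewrite -[X in _ = X - _](sum_dvd_p2 R pp) -[X in _ = _ - X](sum_pz R pp) -sumrB; apply: eq_bigr => i _.
rewrite /pd /pz; have [p2|] := boolP (p ^ 2 %| i)%N; last by rewrite andbT subr0.
by rewrite (dvdn_trans (dvdn_exp2l p (isT : 1 <= 2)%N)) ?andbF ?subrr.
Qed.

Lemma sum_pu (R : comPzRingType) (p : nat) : prime p -> \sum_(0 <= i < p ^ 2) pu R p i = p%:R ^+ 2 - p%:R.
Proof.
move=> pp; rewrite -{2}(sum_dvd_p2 R pp) -natrX.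
rewrite (_ : (p ^ 2)%N%:R = \sum_(0 <= i < p ^ 2) 1); last by rewrite sumr_const_nat subn0.
rewrite -sumrB; apply: eq_bigr => i _.
by rewrite /pu; case: (p %| i)%N; rewrite ?subrr ?subr0.
Qed.

Lemma sum_pl (R : comPzRingType) (p : nat) (e : int) : prime p -> odd p ->
  \sum_(0 <= i < p ^ 2) pl R p e i = 0.
Proof. by move=> pp op; rewrite -mulnn; apply: sum_leg. Qed.

Lemma sum2_mul (R : comPzRingType) (q : nat) (f g : nat -> R) :
  sum2 q (fun i j => f i * g j) = (\sum_(0 <= i < q) f i) * (\sum_(0 <= i < q) g i).
Proof. by rewrite /sum2 mulr_suml; apply: eq_bigr => i _; rewrite mulr_sumr. Qed.

Lemma sum2D (R : nmodType) (q : nat) (f g : nat -> nat -> R) :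
  sum2 q (fun i j => f i j + g i j) = sum2 q f + sum2 q g.
Proof. by rewrite /sum2 -big_split; apply: eq_bigr => i _; rewrite big_split. Qed.

Lemma sum2Z (R : pzRingType) (q : nat) (c : R) (f : nat -> nat -> R) :
  sum2 q (fun i j => c * f i j) = c * sum2 q f.
Proof. by rewrite /sum2 mulr_sumr; apply: eq_bigr => i _; rewrite mulr_sumr. Qed.

Lemma sum2_const (R : pzRingType) (q : nat) (c : R) : sum2 q (fun _ _ => c) = (q ^ 2)%:R * c.
Proof. by rewrite /sum2 !sumr_const_nat !subn0 -mulrnA mulnn mulr_natl. Qed.

Lemma eq_sum2 (R : nmodType) (q : nat) (f g : nat -> nat -> R) : (forall i j, f i j = g i j) ->
  sum2 q f = sum2 q g.
Proof. by move=> h; apply: eq_bigr => i _; apply: eq_bigr => j _. Qed.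

(** The excluded proportion is [(p ^ 2 - p + 1) / p ^ 3], about [1 / p]. *)
Lemma sum2_excluded (R : realFieldType) (p : nat) (e f : int) : prime p -> odd p ->
  sum2 (p ^ 2) (excluded R p e f) = p%:R * (p%:R ^+ 2 - p%:R + 1).
Proof.
move=> pp op; rewrite /excluded.
rewrite (sum2D _ (fun i j => pz R p i + pd R p i * ((pu R p j - pl R p f j) / 2)) (fun i j => pd R p j * ((pu R p i - pl R p e i) / 2))).
rewrite (sum2D _ (fun i j => pz R p i)).
rewrite (eq_sum2 _ (g := fun i j => pz R p i * 1)); last by move=> i j; rewrite mulr1.
rewrite (eq_sum2 (f := fun i j => pd R p j * _) _ (g := fun i j => ((pu R p i - pl R p e i) / 2) * pd R p j)); last by move=> i j; rewrite mulrC.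
rewrite !sum2_mul sum_pz// sum_pd// sumr_const_nat subn0.
rewrite -!mulr_suml !sumrB !sum_pu// !sum_pl// natrX.
by field.
Qed.

Lemma excluded_cases (R : realFieldType) (p : nat) (e f : int) (i j : nat) : prime p ->
  is_sign e -> is_sign f -> excluded R p e f i j = 0 \/ excluded R p e f i j = 1.
Proof.
move=> pp se sf.
have half (g : int) k : is_sign g -> (pu R p k - pl R p g k) / 2 = 0 :> R \/ (pu R p k - pl R p g k) / 2 = 1 :> R.
  move=> sg; have := leg_eq0 (g * k%:Z) pp; rewrite dvdzE abszM.
  rewrite (_ : `|g|%N = 1%N) ?mul1n; last by case: sg => ->.
  rewrite /pu /pl; case: (leg_cases p (g * k)) => -> /= <- /=.
  - by left; rewrite subrr mul0r.
  - by left; rewrite subrr mul0r.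
  - by right; rewrite rmorphN1 opprK; field.
have half0 (g : int) k : (p %| k)%N -> (pu R p k - pl R p g k) / 2 = 0 :> R.
  move=> pk; rewrite /pu /pl pk /= (_ : leg p (g * k) = 0) ?subrr ?mul0r//.
  by apply/eqP; rewrite leg_eq0// dvdz_mull.
have p2p k : (p ^ 2 %| k)%N -> (p %| k)%N by apply: dvdn_trans; apply: dvdn_exp.
rewrite /excluded; have [pi|pi] := boolP (p %| i)%N.
  rewrite (half0 e i pi) mulr0 addr0 /pz /pd pi /=.
  case: (p ^ 2 %| i)%N => /=; first by right; rewrite mul0r addr0.
  by rewrite mul1r add0r; apply: half.
rewrite /pz /pd (negbTE pi) mul0r addr0.
have -> : (p ^ 2 %| i)%N = false by apply/negP => /p2p; apply/negP.
rewrite add0r; case: (_ && _); last by left; rewrite mul0r.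
by rewrite mul1r; apply: half.
Qed.

Lemma chi_p_sum (R : realFieldType) (p : nat) (e f : int) : prime p -> odd p ->
  sum2 (p ^ 2) (chi_p R p e f) = 0.
Proof.
move=> pp op; have p0 : (p%:R : R) != 0 by rewrite pnatr_eq0 -lt0n prime_gt0.
have p1 : 1 <= (p%:R : R) by rewrite ler1n prime_gt0.
have D0 : (p%:R ^+ 2 - p%:R + 1 : R) != 0 by rewrite gt_eqF//; nra.
rewrite /chi_p (eq_sum2 _ (g := fun i j => p%:R^-1 + (- (p%:R ^+ 2 / (p%:R ^+ 2 - p%:R + 1))) * excluded R p e f i j)); last first.
  by move=> i j; rewrite mulNr.
rewrite (sum2D _ (fun _ _ => p%:R^-1)) sum2_const sum2Z sum2_excluded// !natrX.
by field; rewrite D0 p0.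
Qed.

(** The mean of the square is [(p ^ 3 / (p ^ 2 - p + 1) - 1) / p ^ 2]. *)
Lemma chi_p_sqr_sum (R : realFieldType) (p : nat) (e f : int) : prime p -> odd p ->
  is_sign e -> is_sign f ->
  0 <= sum2 (p ^ 2) (fun i j => chi_p R p e f i j ^+ 2) <= ((p ^ 2) ^ 2)%:R / p%:R.
Proof.
move=> pp op se sf; have p0 : (p%:R : R) != 0 by rewrite pnatr_eq0 -lt0n prime_gt0.
have p1 : 1 <= (p%:R : R) by rewrite ler1n prime_gt0.
have D1 : 0 < (p%:R ^+ 2 - p%:R + 1 : R) by nra.
have D0 : (p%:R ^+ 2 - p%:R + 1 : R) != 0 by rewrite gt_eqF.
apply/andP; split; first by apply: sumr_ge0 => i _; apply: sumr_ge0 => j _; rewrite sqr_ge0.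
set w : R := p%:R ^+ 2 / (p%:R ^+ 2 - p%:R + 1).
rewrite (eq_sum2 _ (g := fun i j => (p%:R^-1) ^+ 2 + (w ^+ 2 - 2 * w / p%:R) * excluded R p e f i j)); last first.
  move=> i j; rewrite /chi_p -/w.
  have : excluded R p e f i j ^+ 2 = excluded R p e f i j by case: (excluded_cases R i j pp se sf) => ->; rewrite ?expr0n ?expr1n.
  move=> O2; transitivity (p%:R^-1 ^+ 2 - 2 * w / p%:R * excluded R p e f i j + w ^+ 2 * excluded R p e f i j ^+ 2); first by ring.
  by rewrite O2; ring.
rewrite (sum2D _ (fun _ _ => (p%:R^-1) ^+ 2)) sum2_const sum2Z sum2_excluded// !natrX.
rewrite /w; move: (p%:R : R) p0 p1 D0 D1 => x x0 x1 D0 D1.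
rewrite [leLHS](_ : _ = x ^+ 2 * (x ^+ 3 / (x ^+ 2 - x + 1) - 1)); last by field; rewrite D0 x0.
rewrite [leRHS](_ : _ = x ^+ 2 * x); last by field.
rewrite ler_wpM2l ?sqr_ge0// lerBlDr ler_pdivrMr//.
by rewrite (_ : (x + 1) * (x ^+ 2 - x + 1) = x ^+ 3 + 1); [lra|ring].
Qed.

Lemma chi_p_le1 (R : realFieldType) (p : nat) (e f : int) i j : prime p ->
  is_sign e -> is_sign f -> `|chi_p R p e f i j| <= 1.
Proof.
move=> pp se sf; have p1 : 1 <= (p%:R : R) by rewrite ler1n prime_gt0.
have D1 : 0 < (p%:R ^+ 2 - p%:R + 1 : R) by nra.
have p0 : 0 < (p%:R : R) by lra.
have i1 : 0 < (p%:R : R)^-1 <= 1 by rewrite invr_gt0 p0 /= invf_le1.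
rewrite /chi_p ler_norml; case: (excluded_cases R i j pp se sf) => ->.
  by rewrite mulr0 subr0; lra.
rewrite mulr1; set w := p%:R ^+ 2 / _.
have w0 : 0 <= w by rewrite divr_ge0 ?sqr_ge0// ltW.
have w1 : w <= p%:R^-1 + 1.
  rewrite ler_pdivrMr//; apply: (@le_trans _ _ ((p%:R ^+ 3 + 1) / p%:R)).
    by rewrite ler_pdivlMr// -exprSr lerDl.
  by rewrite (_ : _ / _ = (p%:R^-1 + 1) * (p%:R ^+ 2 - p%:R + 1))//; field; rewrite gt_eqF.
by lra.
Qed.

Lemma chi_p_periodic (R : fieldType) (p : nat) (e f : int) : prime p -> periodic2 (p ^ 2) (chi_p R p e f).
Proof.
move=> pp i j; rewrite /chi_p /excluded.
have d2 k : (p ^ 2 %| k %% p ^ 2)%N = (p ^ 2 %| k)%N by rewrite /dvdn modn_mod.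
have d1 k : (p %| k %% p ^ 2)%N = (p %| k)%N by rewrite /dvdn modn_dvdm// dvdn_exp.
have dl (g : int) k : leg p (g * (k %% p ^ 2)%N) = leg p (g * k).
  apply: leg_mod => //; rewrite -mulrBr dvdz_mull// -eqz_mod_dvd !modz_nat modn_dvdm//.
  by rewrite dvdn_exp.
by rewrite /pz /pd /pu /pl !d1 !d2 !dl.
Qed.

Definition chi_n (R : fieldType) (e f : int) (n i j : nat) : R := \prod_(p <- primes n) chi_p R p e f i j.

Lemma chi_n_le1 (R : realFieldType) (e f : int) (n i j : nat) : is_sign e -> is_sign f ->
  `|chi_n R e f n i j| <= 1.
Proof.
move=> se sf; rewrite /chi_n normr_prod.
have : all prime (primes n) by apply: all_prime_primes.
elim: (primes n) => [|p s IH]; first by rewrite big_nil.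
move=> /= /andP[pp /IH h]; rewrite big_cons -[leRHS]mulr1; apply: ler_pM => //.
  by apply: prodr_ge0.
exact: chi_p_le1.
Qed.

Lemma prod_sqr_nat (s : seq nat) : (\prod_(p <- s) p ^ 2 = (\prod_(p <- s) p) ^ 2)%N.
Proof. by rewrite -mulnn -big_split; apply: eq_bigr. Qed.

(** By the Chinese remainder theorem the mean of the product factors over primes, and a prime
    dividing only one of [m] and [n] gives a factor 0. *)
Lemma chi_n_orth (R : realFieldType) (e f : int) (m n X : nat) : is_sign e -> is_sign f ->
  sqf m -> odd m -> sqf n -> odd n ->
  sum2 X (fun i j => chi_n R e f m i j * chi_n R e f n i j) <=
    X%:R ^+ 2 * ((m == n)%:R / n%:R) + 2 * (X * (m * n) ^ 2)%:R.
Proof.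
move=> se sf sm om sn on.
have [m0 _] := sqfP m sm; have [n0 _] := sqfP n sn.
pose s := primes (m * n).
have ps : all prime s by apply: all_prime_primes.
have memS p : (p \in s) = (p \in primes m) || (p \in primes n) by apply: primesM.
(* the product of the two functions, prime by prime *)
pose g p i j : R := chi_p R p e f i j ^+ (p \in primes m) * chi_p R p e f i j ^+ (p \in primes n).
have sub k h : {subset primes k <= s} -> \prod_(p <- primes k) h p = \prod_(p <- s) h p ^+ (p \in primes k) :> R.
  move=> ks; rewrite [RHS](bigID (mem (primes k)))/= [X in _ * X]big1 ?mulr1; last by move=> p /negbTE ->.
  rewrite -[RHS]big_filter (perm_big [seq p <- s | p \in primes k]).
    by apply: eq_big_seq => p; rewrite mem_filter => /andP[-> _].
  apply: uniq_perm; rewrite ?filter_uniq ?primes_uniq// => p; rewrite mem_filter.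
  by have [pk|//] := boolP (p \in primes k); rewrite (ks p pk).
have gE i j : chi_n R e f m i j * chi_n R e f n i j = \prod_(p <- s) g p i j.
  rewrite /chi_n (sub m) ?(sub n) -?big_split//.
    by move=> p pn; rewrite memS pn orbT.
  by move=> p pm; rewrite memS pm.
have pg p : p \in s -> periodic2 (p ^ 2) (g p).
  by move=> /(allP ps) pp i j; rewrite /g chi_p_periodic.
have [per sumE] := sum2_prod (primes_uniq _) ps pg.
set q := (\prod_(p <- s) p ^ 2)%N in per sumE.
have rad0 : (0 < \prod_(p <- s) p)%N by apply: prod_seq_gt0; apply: sub_all ps => p /prime_gt0.
have q0 : (0 < q)%N by rewrite /q prod_sqr_nat expn_gt0 rad0.
have qle : (q <= (m * n) ^ 2)%N.
  rewrite /q prod_sqr_nat leq_sqr; apply: dvdn_leq; first by rewrite muln_gt0 m0.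
  by apply: primes_prod_dvd; rewrite ?primes_uniq//; apply/allP => p; rewrite mem_primes => /and3P[].
have op p : p \in s -> odd p.
  rewrite memS !mem_primes m0 n0 /= => /orP[] /andP[pp pd].
    by apply: contraLR om => /(prime_oddPn pp) p2; move: pd; rewrite p2 dvdn2.
  by apply: contraLR on => /(prime_oddPn pp) p2; move: pd; rewrite p2 dvdn2.
have S_bd : 0 <= sum2 q (fun i j => \prod_(p <- s) g p i j) /\
   sum2 q (fun i j => \prod_(p <- s) g p i j) / q%:R ^+ 2 <= (m == n)%:R / n%:R.
  have [mn|mn] := eqVneq m n; last first.
    have [p ps' [pm pp]] : exists2 p, p \in s & (p \in primes m) (+) (p \in primes n) /\ prime p.
      apply: contrapT => nex; move/negP: mn; apply; apply/eqP.
      rewrite (sqf_prod sm) (sqf_prod sn); apply: perm_big; apply: uniq_perm; rewrite ?primes_uniq// => p.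
      apply: contrapT => ne; apply: nex; exists p; last split.
      - by rewrite memS; case: (_ \in _) ne; case: (_ \in _).
      - by case: (_ \in _) ne; case: (_ \in _).
      - by apply: (allP ps); rewrite memS; case: (_ \in _) ne; case: (_ \in _).
    have -> : sum2 q (fun i j => \prod_(p <- s) g p i j) = 0.
      rewrite sumE (big_rem _ ps')/= (eq_sum2 _ (g := chi_p R p e f)).
        by rewrite chi_p_sum ?mul0r// op.
      by move=> i j; rewrite /g; case: (_ \in _) pm; case: (_ \in _) => //= _; rewrite ?mulr1 ?mul1r.
    by rewrite !mul0r.
  have s_n p : (p \in s) = (p \in primes n) by rewrite memS mn orbb.
  have gs p : p \in s -> sum2 (p ^ 2) (g p) = sum2 (p ^ 2) (fun i j => chi_p R p e f i j ^+ 2).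
    by move=> pS; apply: eq_sum2 => i j; rewrite /g mn -s_n pS /= !expr1 expr2.
  have ns : n = (\prod_(p <- s) p)%N.
    by rewrite {1}(sqf_prod sn); apply: perm_big; apply: uniq_perm; rewrite ?primes_uniq// => p; rewrite s_n.
  have qn : q%:R ^+ 2 / n%:R = \prod_(p <- s) (((p ^ 2) ^ 2)%:R / p%:R) :> R.
    rewrite prodf_div; congr (_ / _); last by rewrite {1}ns natr_prod.
    by rewrite -natrX -natr_prod /q; congr (_%:R); elim: (s) => [|p t IHt]; rewrite ?big_nil// !big_cons expnMn IHt.
  have bd : 0 <= sum2 q (fun i j => \prod_(p <- s) g p i j) <= q%:R ^+ 2 / n%:R.
    rewrite sumE qn big_seq [X in _ <= _ <= X]big_seq; apply/andP; split.
      by apply: prodr_ge0 => p pS; rewrite gs//; have /andP[] := chi_p_sqr_sum R (allP ps p pS) (op p pS) se sf.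
    apply: ler_prod => p pS; rewrite gs//; exact: chi_p_sqr_sum (allP ps p pS) (op p pS) se sf.
  move/andP: bd => [b0 b1]; split=> //.
  rewrite ler_pdivrMr; last by rewrite exprn_gt0// ltr0n.
  by rewrite mul1r mulrC.
rewrite (eq_sum2 _ gE); have [S0 S1] := S_bd.
have f1 i j : `|\prod_(p <- s) g p i j| <= 1.
  by rewrite -gE normrM -[leRHS]mulr1; apply: ler_pM => //; apply: chi_n_le1.
apply: le_trans (box_sum_le X q0 per f1 S0) _; apply: lerD.
  by rewrite ler_wpM2l// exprn_ge0.
by rewrite ler_wpM2l// ler_nat leq_mul2l qle orbT.
Qed.

(** * Counting the exceptional pairs *)

(** The condition at an odd prime under which [normG_of_noncyclic_prime] makes every [c] a
    product of norms. *)
Definition ramified (a b : int) : Prop :=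
  exists p : nat, [/\ prime p, odd p, (p %| a)%Z, ~~ (p %| b)%Z & leg p b = -1].

Definition exceptional (a b : int) : bool :=
  `[< [/\ sqf `|a|, sqf `|b|, ~ ramified a b & ~ ramified b a] >].

Lemma half_pl0 (R : fieldType) (p : nat) (e f : int) (i j : nat) : prime p -> odd p -> is_sign e ->
  ~ ramified (e * i%:Z) (f * j%:Z) -> (p %| i)%N -> is_sign f -> pu R p j - pl R p f j = 0.
Proof.
move=> pp op se nr pi sf.
have h := leg_eq0 (f * j%:Z) pp.
have dj : (p %| f * j%:Z)%Z = (p %| j)%N by rewrite dvdzE abszM; case: sf => ->; rewrite mul1n.
rewrite /pu /pl; rewrite dj in h.
case: (leg_cases p (f * j)) => hl; move: h; rewrite hl /= => h.
- by rewrite -h subrr.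
- by rewrite -h subrr.
exfalso; apply: nr; exists p; split=> //; first by rewrite dvdz_mull.
by rewrite dj -h.
Qed.

Lemma excluded_exceptional (R : realFieldType) (p : nat) (e f : int) (i j : nat) : prime p -> odd p ->
  is_sign e -> is_sign f -> exceptional (e * i%:Z) (f * j%:Z) -> excluded R p e f i j = 0.
Proof.
move=> pp op se sf /asboolP[si sj n1 n2].
have absE (g : int) k : is_sign g -> `|(g * k%:Z)%R|%N = k by rewrite abszM => -[] ->; rewrite mul1n.
rewrite absE// in si; rewrite absE// in sj.
have np2 k : sqf k -> (p ^ 2 %| k)%N = false.
  move=> /sqfP[k0 hk]; apply/negP; rewrite pfactor_dvdn// => h.
  by have := leq_trans h (hk p).
rewrite /excluded /pz np2// add0r /pd !np2// !andbT.
have -> : (p %| i)%N%:R * ((pu R p j - pl R p f j) / 2) = 0 :> R.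
  have [pi|] := boolP (p %| i)%N; last by rewrite mul0r.
  by rewrite (half_pl0 R pp op se n1 pi sf) mul0r mulr0.
have [pj|] := boolP (p %| j)%N; last by rewrite mul0r addr0.
by rewrite (half_pl0 R pp op sf n2 pj se) mul0r mulr0 addr0.
Qed.

Lemma chi_n_exceptional (R : realFieldType) (n : nat) (e f : int) (i j : nat) : sqf n -> odd n ->
  is_sign e -> is_sign f -> exceptional (e * i%:Z) (f * j%:Z) -> chi_n R e f n i j = n%:R^-1.
Proof.
move=> sn on se sf ex; rewrite [in RHS](sqf_prod sn) natr_prod -prodfV /chi_n.
apply: eq_big_seq => p; rewrite mem_primes => /and3P[pp n0 pn].
have op : odd p by apply: dvdn_odd pn on.
by rewrite /chi_p excluded_exceptional// mulr0 subr0.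
Qed.

Definition odd_sqf (n : nat) : bool := sqf n && odd n.

(** The value of the sum of the [chi_n] for odd squarefree [n <= D] at an exceptional pair. *)
Definition sifted_sum (R : fieldType) (D : nat) : R := \sum_(0 <= n < D.+1 | odd_sqf n) n%:R^-1.

(** Sum the square of [\sum chi_n] over the box: an exceptional pair contributes the square of
    [sifted_sum], and near-orthogonality leaves only the diagonal. *)
Lemma exceptional_sieve (R : realFieldType) (e f : int) (D X : nat) : is_sign e -> is_sign f ->
  sum2 X (fun i j => (exceptional (e * i%:Z) (f * j%:Z))%:R) * sifted_sum R D ^+ 2 <=
  X%:R ^+ 2 * sifted_sum R D + 2 * (X * D.+1 ^ 6)%:R.
Proof.
move=> se sf; set L := sifted_sum R D.
pose F i j := \sum_(0 <= n < D.+1 | odd_sqf n) chi_n R e f n i j.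
apply: (@le_trans _ _ (sum2 X (fun i j => F i j ^+ 2))).
  rewrite /sum2 mulr_suml; apply: ler_sum => i _; rewrite mulr_suml; apply: ler_sum => j _.
  have [ex|_] := boolP (exceptional _ _); last by rewrite mul0r sqr_ge0.
  rewrite mul1r /F /L /sifted_sum [leRHS](_ : _ = (\sum_(0 <= n < D.+1 | odd_sqf n) n%:R^-1) ^+ 2)//.
  by congr (_ ^+ 2); apply: eq_bigr => n /andP[sn on]; apply: chi_n_exceptional.
have -> : sum2 X (fun i j => F i j ^+ 2) =
    \sum_(0 <= m < D.+1 | odd_sqf m) \sum_(0 <= n < D.+1 | odd_sqf n)
      sum2 X (fun i j => chi_n R e f m i j * chi_n R e f n i j).
  rewrite /sum2; under [RHS]eq_bigr do rewrite exchange_big/=.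
  rewrite [RHS]exchange_big/=; apply: eq_bigr => i _.
  under [RHS]eq_bigr do rewrite exchange_big/=.
  rewrite [RHS]exchange_big/=; apply: eq_bigr => j _.
  rewrite expr2 {1}/F mulr_suml; apply: eq_bigr => m _.
  by rewrite /F mulr_sumr.
have step (m : nat) : (m < D.+1)%N -> odd_sqf m ->
    \sum_(0 <= n < D.+1 | odd_sqf n) sum2 X (fun i j => chi_n R e f m i j * chi_n R e f n i j) <=
    X%:R ^+ 2 * m%:R^-1 + 2 * (X * D.+1 ^ 5)%:R.
  move=> mD om; have /andP[sm om'] := om.
  apply: (@le_trans _ _ (\sum_(0 <= n < D.+1 | odd_sqf n) (X%:R ^+ 2 * ((m == n)%:R / n%:R) + 2 * (X * D.+1 ^ 4)%:R))).
    rewrite big_nat_cond [leRHS]big_nat_cond; apply: ler_sum => n /andP[/andP[_ nD] /andP[sn on]].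
    apply: le_trans (chi_n_orth R X se sf sm om' sn on) _.
    rewrite lerD2l ler_wpM2l// ler_nat leq_mul2l.
    by rewrite (_ : (D.+1 ^ 4 = (D.+1 * D.+1) ^ 2)%N) ?leq_sqr ?leq_mul ?orbT// 1?ltnW// mulnn -expnM.
  rewrite big_split/=; apply: lerD.
    rewrite -mulr_sumr ler_wpM2l ?exprn_ge0//.
    rewrite big_mkcond (bigD1_seq m) ?iota_uniq ?mem_index_iota//= om eqxx mul1r big1 ?addr0//.
    by move=> n /negbTE nm; rewrite eq_sym nm mul0r if_same.
  apply: (@le_trans _ _ (\sum_(0 <= n < D.+1) 2 * (X * D.+1 ^ 4)%:R)).
    rewrite [leRHS](bigID odd_sqf)/= lerDl; apply: sumr_ge0 => n _; exact: mulr_ge0.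
  rewrite sumr_const_nat subn0 -mulrnAr -mulrnA ler_wpM2l// ler_nat.
  by rewrite -mulnA -expnSr.
apply: (@le_trans _ _ (\sum_(0 <= m < D.+1 | odd_sqf m) (X%:R ^+ 2 * m%:R^-1 + 2 * (X * D.+1 ^ 5)%:R))).
  rewrite big_nat_cond [leRHS]big_nat_cond; apply: ler_sum => m /andP[/andP[_ mD] om].
  exact: step.
rewrite big_split/= -mulr_sumr lerD2l.
apply: (@le_trans _ _ (\sum_(0 <= n < D.+1) 2 * (X * D.+1 ^ 5)%:R)).
  rewrite [leRHS](bigID odd_sqf)/= lerDl; apply: sumr_ge0 => n _; exact: mulr_ge0.
rewrite sumr_const_nat subn0 -mulrnAr -mulrnA ler_wpM2l// ler_nat.
by rewrite -mulnA -expnSr.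
Qed.

(** Each odd term exceeds the even term after it. *)
Lemma harmonic_le_odd (R : realFieldType) (N : nat) :
  \sum_(1 <= k < N.+1) k%:R^-1 <= 2 * \sum_(1 <= k < N.+1 | odd k) k%:R^-1 :> R.
Proof.
pose g k : R := 2 * ((odd k)%:R * k%:R^-1) - k%:R^-1.
suff : 0 <= \sum_(1 <= k < N.+1) g k.
  rewrite /g sumrB subr_ge0 -mulr_sumr big_mkcond/= => /le_trans; apply.
  by rewrite ler_wpM2l// [leRHS]big_mkcond/=; apply: ler_sum => k _; case: (odd k); rewrite ?mul1r ?mul0r.
have even_case M : 0 <= \sum_(1 <= k < M.*2.+1) g k.
  elim: M => [|M IH]; first by rewrite big_geq.
  rewrite doubleS big_nat_recr//= big_nat_recr//= -addrA addr_ge0// /g /= odd_double /= mul0r mulr0 mul1r.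
  rewrite sub0r (_ : forall x : R, 2 * x - x = x); last by move=> x; ring.
  by rewrite subr_ge0 lef_pV2 ?posrE ?ltr0n// ler_nat.
rewrite -(odd_double_half N); case: (odd N); rewrite ?add0n//= add1n.
rewrite big_nat_recr//= addr_ge0// /g /= odd_double /= mul1r.
by rewrite (_ : forall x : R, 2 * x - x = x) ?invr_ge0//; move=> x; ring.
Qed.

Lemma sum_inv_sqr_le2 (R : realFieldType) (N : nat) : \sum_(1 <= k < N.+1) (k%:R ^+ 2)^-1 <= 2 :> R.
Proof.
case: N => [|N]; first by rewrite big_geq.
suff : \sum_(1 <= k < N.+2) (k%:R ^+ 2)^-1 <= 2 - N.+1%:R^-1 :> R.
  by move=> /le_trans; apply; rewrite gerDl oppr_le0 invr_ge0.
elim: N => [|N IH]; first by rewrite big_nat1 invr1 expr1n invr1; lra.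
rewrite big_nat_recr//=; apply: le_trans (lerD IH (lexx _)) _.
have n0 : 0 < (N.+1%:R : R) by rewrite ltr0n.
rewrite -[N.+2%:R]natr1; move: (N.+1%:R : R) n0 => x x0.
rewrite -subr_ge0.
have -> : 2 - (x + 1)^-1 - (2 - x^-1 + (x + 1) ^- 2) = (x * (x + 1) ^+ 2)^-1.
  by field; rewrite !gt_eqF//; lra.
by rewrite invr_ge0 mulr_ge0 ?sqr_ge0// ltW.
Qed.

(** Writing odd integers as odd squarefree numbers times squares costs at most the factor [\sum
    1 / k ^ 2 <= 2]. *)
Lemma sifted_sum_ge (R : realType) (D : nat) : ln D.+1%:R / 4 <= sifted_sum R D.
Proof.
have h1 := harmonic_ge_ln R D; have h2 := harmonic_le_odd R D.
suff h3 : \sum_(1 <= k < D.+1 | odd k) k%:R^-1 <= sifted_sum R D * 2 by lra.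
pose T m k n : R := (n == m * k ^ 2)%N%:R * (n%:R)^-1.
apply: (@le_trans _ _ (\sum_(1 <= n < D.+1 | odd n) \sum_(0 <= m < D.+1 | odd_sqf m) \sum_(1 <= k < D.+1) T m k n)).
  rewrite big_nat_cond [leRHS]big_nat_cond; apply: ler_sum => n /andP[/andP[n0 nD] on].
  have [m [k [nE sm]]] := sqf_part n0.
  have T0 a b : 0 <= T a b n by rewrite /T mulr_ge0// invr_ge0.
  have k0 : (0 < k)%N by case: k {T0} nE n0 => // ->; rewrite muln0.
  have m0 : (0 < m)%N by case/sqfP: sm.
  have kD : (k < D.+1)%N.
    apply: leq_ltn_trans nD; rewrite nE; apply: leq_trans (leq_pmull _ m0).
    by rewrite -{1}[k]muln1 -mulnn leq_mul2l k0 orbT.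
  have mD : (m < D.+1)%N.
    by apply: leq_ltn_trans nD; rewrite nE leq_pmulr// expn_gt0 k0.
  have om : odd_sqf m by rewrite /odd_sqf sm; move: on; rewrite nE oddM => /andP[].
  rewrite big_mkcond (bigD1_seq m) ?iota_uniq ?mem_index_iota//= om -[leLHS]addr0; apply: lerD; last first.
    by apply: sumr_ge0 => a _; case: ifP => // _; apply: sumr_ge0.
  rewrite (bigD1_seq k) ?iota_uniq ?mem_index_iota ?k0//= -[leLHS]addr0; apply: lerD; last first.
    by apply: sumr_ge0.
  by rewrite /T -nE eqxx mul1r.
rewrite exchange_big/= /sifted_sum mulr_suml big_nat_cond [leRHS]big_nat_cond.
apply: ler_sum => m /andP[/andP[_ mD] om].
rewrite exchange_big/=.
apply: (@le_trans _ _ (m%:R^-1 * \sum_(1 <= k < D.+1) (k%:R ^+ 2)^-1)); last first.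
  by rewrite ler_wpM2l ?invr_ge0// sum_inv_sqr_le2.
rewrite mulr_sumr; apply: ler_sum => k _.
have [mk|nmk] := boolP ((m * k ^ 2)%N \in index_iota 1 D.+1).
  rewrite big_mkcond/= (bigD1_seq (m * k ^ 2)%N)/= ?iota_uniq// big1 ?addr0.
    by rewrite /T eqxx mul1r -invfM -natrX -natrM; case: ifP => _; rewrite ?invr_ge0.
  by move=> n /negbTE nE; rewrite /T nE mul0r if_same.
rewrite big_seq_cond big1 ?mulr_ge0 ?invr_ge0 ?exprn_ge0// => n /andP[nI _].
rewrite /T; case: eqP => [nE|_]; last by rewrite mul0r.
by move: nmk; rewrite -nE nI.
Qed.

Lemma nat_root (r X : nat) : (0 < r)%N -> (0 < X)%N -> exists D, (0 < D)%N /\ (D ^ r <= X < D.+1 ^ r)%N.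
Proof.
move=> r0 X0; have ex : exists D, (D ^ r <= X)%N by exists 1%N; rewrite exp1n.
have bd D : (D ^ r <= X)%N -> (D <= X)%N.
  case: D => // D; apply: leq_trans; rewrite -{1}[D.+1]expn1; exact: leq_pexp2l.
case: (ex_maxnP ex bd) => D hD mx; exists D; split.
  by apply: mx; rewrite exp1n.
by rewrite hD ltnNge; apply/negP => /mx; rewrite ltnn.
Qed.

(** Take [D] to be the integer part of the sixth root of [X], so that the two terms of
    [exceptional_sieve] balance. *)
Lemma exceptional_count (R : realType) (e f : int) (X : nat) : is_sign e -> is_sign f -> (1 < X)%N ->
  sum2 X (fun i j => (exceptional (e * i%:Z) (f * j%:Z))%:R) * ln X%:R <= 3120 * X%:R ^+ 2 :> R.
Proof.
move=> se sf X1.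
have [D [D0 /andP[DX XD]]] := @nat_root 6 X isT (ltnW X1).
have hs := exceptional_sieve R D X se sf.
have hL := sifted_sum_ge R D.
set E := sum2 _ _ in hs *; set L := sifted_sum R D in hs hL.
have E0 : 0 <= E by apply: sumr_ge0 => i _; apply: sumr_ge0.
have x1 : 1 <= (X%:R : R) by rewrite ler1n ltnW.
have L1 : 1 <= L.
  rewrite /L /sifted_sum big_mkcond (bigD1_seq 1%N) ?iota_uniq//=; last by rewrite mem_index_iota.
  by rewrite invr1 lerDl; apply: sumr_ge0 => n _; case: ifP => // _; rewrite invr_ge0.
have d6 : (X * D.+1 ^ 6)%:R <= 64 * X%:R ^+ 2 :> R.
  rewrite -natrX -natrM ler_nat mulnC -mulnn mulnA leq_mul2r; apply/orP; right.
  rewrite (_ : 64 = 2 ^ 6)%N//; apply: leq_trans (leq_mul (leqnn _) DX); rewrite -expnMn leq_exp2r//.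
  by rewrite mul2n -addnn -add1n leq_add2r.
have hE : E * L <= 129 * X%:R ^+ 2.
  have : E * L * L <= 129 * X%:R ^+ 2 * L.
    by move: d6 hs; set u := (X * _)%:R; move: (X%:R ^+ 2) (exprn_ge0 2 (ler0n R X)) => y y0; nra.
  by rewrite ler_pM2r// (lt_le_trans _ L1).
have lX : ln X%:R <= 24 * L :> R.
  have : ln X%:R <= 6 * ln D.+1%:R :> R.
    rewrite mulr_natl -lnXn ?ltr0n// -natrX ler_ln ?posrE ?ltr0n ?expn_gt0 ?(ltnW X1)//.
    by rewrite ler_nat ltnW.
  by lra.
apply: le_trans (ler_wpM2l E0 lX) _; rewrite mulrCA; have := sqr_ge0 (X%:R : R); lra.
Qed.

(** * Euler's sum of inverse squares *)

(** By the mean value theorem [sin x = x * cos y] for some [y] between [0] and [x]. *)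
Lemma sin_between (R : realType) (x : R) : 0 < x < pi / 2 -> x * cos x <= sin x <= x.
Proof.
move=> /andP[x0 x2].
have [c cx] := MVT_segment (ltW x0) (fun y _ => is_derive_sin y) (continuous_subspaceT (@continuous_sin R)).
rewrite sin0 !subr0 => ->; move: cx; rewrite in_itv/= => /andP[c0 cx].
have hp := pi_gt0 R.
have : cos x <= cos c.
  have [->//|xc] := eqVneq c x.
  by rewrite ltW// ltr_cos ?in_itv/= ?c0 ?lt_neqAle ?xc ?cx//; apply/andP; split; lra.
by have := cos_le1 c => h1 h2; rewrite mulrC ler_pM2r// h2 /= -[leRHS]mul1r ler_pM2r.
Qed.

Lemma inv_sin_sqr_between (R : realType) (x : R) : 0 < x < pi / 2 ->
  (x ^+ 2)^-1 <= (sin x ^+ 2)^-1 <= (x ^+ 2)^-1 + 1.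
Proof.
move=> hx; have /andP[h1 h2] := sin_between hx; have s0 := sin_gt0_pihalf hx.
have /andP[x0 x2] := hx.
have c0 : 0 < cos x by apply: cos_gt0_pihalf; rewrite x2 andbT; lra.
apply/andP; split; first by rewrite lef_pV2 ?posrE ?exprn_gt0// ler_sqr ?nnegrE// ?(ltW s0) ?(ltW x0).
have -> : (sin x ^+ 2)^-1 = cos x ^+ 2 / sin x ^+ 2 + 1.
  transitivity ((cos x ^+ 2 + sin x ^+ 2) / sin x ^+ 2); first by rewrite cos2Dsin2 mul1r.
  by rewrite mulrDl divff// gt_eqF// exprn_gt0.
rewrite lerD2r ler_pdivrMr ?exprn_gt0// mulrC ler_pdivlMr ?exprn_gt0// -exprMn.
by rewrite [cos x * x]mulrC ler_sqr ?nnegrE// ?mulr_ge0// ?(ltW s0) ?(ltW x0) ?(ltW c0).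
Qed.

(** The duplication formula for the sine. *)
Lemma inv_sin_sqr_halve (R : realType) (x : R) : 0 < x < pi / 2 ->
  4 * (sin (2 * x) ^+ 2)^-1 = (sin x ^+ 2)^-1 + (sin (pi / 2 - x) ^+ 2)^-1.
Proof.
move=> hx; have s0 := sin_gt0_pihalf hx; have /andP[x0 x2] := hx.
have c0 : 0 < cos x by apply: cos_gt0_pihalf; rewrite x2 andbT; lra.
rewrite sinB cos_pihalf sin_pihalf mul0r subr0 mul1r [2 * x]mulr_natl sin_mulr2n.
have := cos2Dsin2 x; move: (cos x) (sin x) c0 s0 => c s c0 s0 e.
apply/eqP; rewrite -subr_eq0; apply/eqP.
transitivity ((1 - (c ^+ 2 + s ^+ 2)) / (c ^+ 2 * s ^+ 2)); last by rewrite e subrr mul0r.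
by rewrite -mulr_natr; field; rewrite !gt_eqF.
Qed.

(** The sample points of the finite identity that replaces the partial fraction expansion of [1
    / sin x ^ 2]. *)
Definition odd_angle (R : realType) (n k : nat) : R := (k.*2.+1)%:R * pi / (2 ^ n.+2)%:R.

Lemma odd_angle_range (R : realType) (n k : nat) : (k < 2 ^ n)%N -> 0 < odd_angle R n k < pi / 2.
Proof.
move=> kn; have p0 := pi_gt0 R.
have e0 : 0 < ((2 ^ n.+2)%:R : R) by rewrite ltr0n expn_gt0.
rewrite /odd_angle divr_gt0 ?mulr_gt0 ?ltr0n ?expn_gt0//=.
rewrite ltr_pdivrMr// (mulrC _ pi) -mulrA ltr_pM2l//.
rewrite expnS natrM mulrA mulVf// mul1r ltr_nat expnS.
by rewrite mul2n -leq_double doubleS in kn *; apply: leq_trans kn.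
Qed.

(** By induction: half of a sample angle and the complement of that half together run through
    the sample angles of the next level. *)
Lemma sum_inv_sin_sqr (R : realType) (n : nat) :
  \sum_(0 <= k < 2 ^ n) (sin (odd_angle R n k) ^+ 2)^-1 = (2 * 4 ^ n)%:R.
Proof.
elim: n => [|n IH].
  rewrite big_nat1 muln1 /odd_angle mul1r.
  have hp := pi_gt0 R.
  have q : 0 < (pi : R) / 4 < pi / 2 by lra.
  have := inv_sin_sqr_halve q; have -> : 2 * (pi / 4) = pi / 2 :> R by field.
  have -> : pi / 2 - pi / 4 = pi / 4 :> R by field.
  by rewrite sin_pihalf expr1n invr1; lra.
rewrite (@big_cat_nat _ _ _ (2 ^ n))//=; last by rewrite leq_exp2l.
have -> : \sum_(2 ^ n <= k < 2 ^ n.+1) (sin (odd_angle R n.+1 k) ^+ 2)^-1 =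
    \sum_(0 <= k < 2 ^ n) (sin (pi / 2 - odd_angle R n.+1 k) ^+ 2)^-1.
  rewrite big_nat_rev/= -{1}[(2 ^ n)%N]add0n big_addn expnS mul2n -addnn addnK.
  apply: eq_big_nat => k /andP[_ kn]; congr ((sin _ ^+ 2)^-1).
  rewrite /odd_angle; have e0 : ((2 ^ n)%:R : R) != 0 by rewrite pnatr_eq0 expn_eq0.
  have -> : ((2 ^ n + (2 ^ n + 2 ^ n) - (k + 2 ^ n).+1).*2.+1 = 4 * 2 ^ n - k.*2.+1)%N.
    by rewrite -!mul2n; lia.
  rewrite natrB; last by rewrite -mul2n; lia.
  by rewrite !expnS !natrM; field.
rewrite -big_split/= expnS mulnCA natrM -IH mulr_sumr; apply: eq_big_nat => k /andP[_ kn].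
rewrite -inv_sin_sqr_halve; last first.
  by apply: odd_angle_range; apply: leq_trans kn _; rewrite leq_exp2l.
congr (4 * (sin _ ^+ 2)^-1); rewrite /odd_angle [(2 ^ n.+3)%N]expnS natrM; move: (pi : R) => y; field.
by rewrite pnatr_eq0 expn_eq0.
Qed.

(** Compare [1 / sin x ^ 2] with [1 / x ^ 2] at the sample angles. *)
Lemma odd_inv_sqr_sum (R : realType) (n : nat) :
  (pi : R) ^+ 2 / 8 * (1 - (2 ^ n.+1)%:R^-1) <= \sum_(0 <= k < 2 ^ n) ((k.*2.+1)%:R ^+ 2)^-1 <= (pi : R) ^+ 2 / 8.
Proof.
set S := \sum_(0 <= k < _) _; have p0 := pi_gt0 R.
pose t : R := (2 ^ n)%:R; have t0 : 0 < t by rewrite ltr0n expn_gt0.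
have angE k : (odd_angle R n k ^+ 2)^-1 = 16 * t ^+ 2 / pi ^+ 2 * ((k.*2.+1)%:R ^+ 2)^-1.
  rewrite /odd_angle !expnS !natrM -/t.
  have : 0 < (k.*2.+1%:R : R) by rewrite ltr0n.
  by move: k.*2.+1%:R (pi : R) p0 => v y y0 v0; field; rewrite !gt_eqF.
have t2 : 2 * t ^+ 2 = (2 * 4 ^ n)%:R by rewrite natrM /t -natrX -expnM mulnC expnM.
have lo : 16 * t ^+ 2 / pi ^+ 2 * S <= 2 * t ^+ 2.
  rewrite t2 -(sum_inv_sin_sqr R n) mulr_sumr.
  rewrite big_nat_cond [leRHS]big_nat_cond; apply: ler_sum => k /andP[/andP[_ kn] _].
  have /andP[h _] := inv_sin_sqr_between (odd_angle_range R kn).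
  by rewrite (le_trans _ h)// angE.
have hi : 2 * t ^+ 2 <= 16 * t ^+ 2 / pi ^+ 2 * S + t.
  rewrite t2 -(sum_inv_sin_sqr R n) mulr_sumr.
  have -> : t = \sum_(0 <= k < 2 ^ n) 1 by rewrite sumr_const_nat subn0.
  rewrite -big_split/= big_nat_cond [leRHS]big_nat_cond; apply: ler_sum => k /andP[/andP[_ kn] _].
  have /andP[_ h] := inv_sin_sqr_between (odd_angle_range R kn).
  by rewrite (le_trans h)// angE sumr_const_nat subn0.
have E : S = pi ^+ 2 / (16 * t ^+ 2) * (16 * t ^+ 2 / pi ^+ 2 * S) by move: (pi : R) p0 => y y0; field; rewrite !gt_eqF.
have c0 : 0 < pi ^+ 2 / (16 * t ^+ 2) by rewrite divr_gt0 ?mulr_gt0 ?exprn_gt0.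
apply/andP; split.
  rewrite [leLHS](_ : _ = pi ^+ 2 / (16 * t ^+ 2) * (2 * t ^+ 2 - t)).
    by rewrite [leRHS]E ler_pM2l//; lra.
  by rewrite expnS natrM -/t; move: (pi : R) => y; field; rewrite gt_eqF.
rewrite [leRHS](_ : _ = pi ^+ 2 / (16 * t ^+ 2) * (2 * t ^+ 2)).
  by rewrite [leLHS]E ler_pM2l.
by move: (pi : R) => y; field; rewrite gt_eqF.
Qed.

Definition zeta2 (R : realType) (K : nat) : R := \sum_(1 <= k < K.+1) (k%:R ^+ 2)^-1.

Lemma zeta2_double (R : realType) (N : nat) :
  zeta2 R N.*2 = \sum_(0 <= k < N) ((k.*2.+1)%:R ^+ 2)^-1 + zeta2 R N / 4.
Proof.
rewrite /zeta2; elim: N => [|N IH]; first by rewrite !big_geq// mul0r addr0.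
rewrite doubleS 2?big_nat_recr//= IH [in RHS]big_nat_recr//= [X in _ = _ + X / 4]big_nat_recr//=.
have -> : (N.*2.+2%:R : R) = 2 * N.+1%:R by rewrite -doubleS -mul2n natrM.
have : 0 < (N.+1%:R : R) by rewrite ltr0n.
move: (\sum_(0 <= k < N) _) (\sum_(1 <= k < N.+1) _) (N.*2.+1%:R ^- 2) (N.+1%:R : R) => a b c d d0.
by field; rewrite gt_eqF.
Qed.

(** The sum over all integers is the sum over the odd ones plus a quarter of itself. *)
Lemma zeta2_pow2 (R : realType) (n : nat) :
  (pi : R) ^+ 2 / 6 * (1 - 3 / 2 * (2 ^ n)%:R^-1) <= zeta2 R (2 ^ n) <= (pi : R) ^+ 2 / 6.
Proof.
have p0 : 0 < (pi : R) ^+ 2 by rewrite exprn_gt0// pi_gt0.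
elim: n => [|n /andP[IH1 IH2]].
  have /andP[_ ] := odd_inv_sqr_sum R 0; rewrite /zeta2 !expn0 !big_nat1 !expr1n invr1 => h; apply/andP; split; last by lra.
  by lra.
have /andP[h1 h2] := odd_inv_sqr_sum R n.
rewrite {2 3}expnS mul2n zeta2_double; apply/andP; split; last by lra.
move: h1 IH1; rewrite expnS natrM invfM; set w := (2 ^ n)%:R^-1; set S := \sum_(0 <= k < _) _; set z := zeta2 _ _.
move: (pi ^+ 2 : R) p0 => y y0 h1 IH1.
have -> : y / 6 * (1 - 3 / 2 * (2^-1 * w)) = y / 8 * (1 - 2^-1 * w) + (y / 6 * (1 - 3 / 2 * w)) / 4 by field.
by apply: lerD => //; rewrite ler_pM2r.
Qed.

Lemma zeta2_tail (R : realType) (K M : nat) : (0 < K)%N -> (K <= M)%N ->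
  0 <= zeta2 R M - zeta2 R K <= K%:R^-1.
Proof.
move=> K0 KM; rewrite /zeta2 sumr_nat_diff//.
apply/andP; split; first by apply: sumr_ge0 => k _; rewrite invr_ge0 sqr_ge0.
suff : \sum_(K.+1 <= k < M.+1) (k%:R ^+ 2)^-1 <= K%:R^-1 - M%:R^-1 :> R.
  by move=> /le_trans; apply; rewrite gerDl oppr_le0 invr_ge0.
rewrite -(subnKC KM); elim: (M - K)%N => [|d IH]; first by rewrite addn0 big_geq// subrr.
rewrite addnS big_nat_recr//=; last by rewrite ltnS leq_addr.
apply: le_trans (lerD IH (lexx _)) _; rewrite -[(K + d).+1%:R]natr1.
have n0 : 0 < ((K + d)%:R : R) by rewrite ltr0n addn_gt0 K0.
move: ((K + d)%:R : R) n0 (K%:R^-1) => x x0 u.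
rewrite -subr_ge0.
have -> : u - (x + 1)^-1 - (u - x^-1 + (x + 1) ^- 2) = (x * (x + 1) ^+ 2)^-1.
  by field; rewrite !gt_eqF//; lra.
by rewrite invr_ge0 mulr_ge0 ?sqr_ge0// ltW.
Qed.

(** By [zeta2_pow2] the value is the limit along powers of 2, and [zeta2_tail] bounds what
    remains after [K]. *)
Lemma basel (R : realType) (K : nat) : (0 < K)%N -> 0 <= (pi : R) ^+ 2 / 6 - zeta2 R K <= K%:R^-1.
Proof.
move=> K0; have K2 : (K <= 2 ^ K)%N by apply/ltnW/ltn_expl.
have p0 : 0 < (pi : R) ^+ 2 by rewrite exprn_gt0// pi_gt0.
apply/andP; split.
  have /andP[_ h2] := zeta2_pow2 R K.
  by have /andP[h3 _] := zeta2_tail R K0 K2; lra.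
apply/ler_addgt0Pl => eps e0.
pose c : R := pi ^+ 2 / 4.
pose m := (Num.truncn (c / eps)).+1.
have hm : c / eps < m%:R by rewrite /m truncnS_gt.
pose n := (m + K)%N.
have nM : (m%:R : R) <= (2 ^ n)%:R by rewrite ler_nat (leq_trans (leq_addr K m))// ltnW// ltn_expl.
have Kn : (K <= 2 ^ n)%N by apply: leq_trans (leq_addl m K) _; apply/ltnW/ltn_expl.
have /andP[h1 _] := zeta2_pow2 R n; have /andP[_ h3] := zeta2_tail R K0 Kn.
have T0 : 0 < ((2 ^ n)%:R : R) by rewrite ltr0n expn_gt0.
have : c * (2 ^ n)%:R^-1 <= eps.
  rewrite ler_pdivrMr//; move: hm; rewrite ltr_pdivrMr// => hm.
  by apply: ltW; apply: lt_le_trans hm _; rewrite mulrC ler_pM2l.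
by move: h1; rewrite /c; move: (2 ^ n)%:R^-1 => w; lra.
Qed.

(** * Counting squarefree integers *)

Definition sqf_count (n : nat) : nat := \sum_(1 <= m < n.+1) sqf m.

Lemma sqf_count_le (n : nat) : (sqf_count n <= n)%N.
Proof.
rewrite -[leqRHS]muln1 -[X in (_ <= X * _)%N](subnK (leq0n n)) addn0.
rewrite -[(n - 0)%N]/(n.+1 - 1)%N -sum_nat_const_nat; apply: leq_sum => m _.
by case: (sqf m).
Qed.

(** The exponents of [m] are the parities of those of [m * k ^ 2]. *)
Lemma sqf_part_uniq (m k m' k' : nat) : sqf m -> sqf m' -> (0 < k)%N -> (0 < k')%N ->
  (m * k ^ 2 = m' * k' ^ 2)%N -> k = k'.
Proof.
move=> /sqfP[m0 sm] /sqfP[m'0 sm'] k0 k'0 e.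
apply: eqn_from_log => // p.
have := congr1 (logn p) e; rewrite !lognM ?expn_gt0 ?k0 ?k'0//.
have := sm p; have := sm' p.
move: (logn p m) (logn p m') (logn p k) (logn p k') => a b c d; lia.
Qed.

(** Every positive integer is in exactly one way a squarefree number times a square. *)
Lemma sqf_count_convolution (n K : nat) : (n <= K)%N ->
  (\sum_(1 <= k < K.+1) sqf_count (n %/ k ^ 2) = n)%N.
Proof.
move=> nK.
transitivity (\sum_(1 <= k < K.+1) \sum_(1 <= j < n.+1) ((k ^ 2 %| j) && sqf (j %/ k ^ 2)))%N.
  apply: eq_big_nat => k /andP[k0 _]; have k20 : (0 < k ^ 2)%N by rewrite expn_gt0 k0.
  have /= := sum_dvd (fun j => (sqf (j %/ k ^ 2) : nat)) n k20.
  rewrite /sqf_count big_mkcond/= => h.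
  transitivity (\sum_(1 <= i < n.+1) (if (k ^ 2 %| i)%N then sqf (i %/ k ^ 2) : nat else 0%N))%N.
    by rewrite [RHS]h; apply: eq_bigr => m _; rewrite mulKn.
  by apply: eq_bigr => i _; case: (_ %| _)%N.
rewrite exchange_big/=.
rewrite -[RHS](subn0 n) -[RHS]muln1 -[(n - 0)%N]/(n.+1 - 1)%N -sum_nat_const_nat.
apply: eq_big_nat => j /andP[j0 jn].
have [m [k [jE sm]]] := sqf_part j0.
have m0 : (0 < m)%N by case/sqfP: sm.
have k0 : (0 < k)%N by case: k jE j0 => // ->; rewrite muln0.
have kj : (k <= j)%N.
  by rewrite jE; apply: leq_trans (leq_pmull _ m0); rewrite -mulnn leq_pmulr.
rewrite (bigD1_seq k) ?iota_uniq//=; last first.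
  by rewrite mem_index_iota k0 ltnS (leq_trans kj)// (leq_trans _ nK).
rewrite big_nat_cond big1.
  by rewrite jE dvdn_mull// mulnK ?expn_gt0 ?k0// sm.
move=> l /andP[/andP[l0 _] lk]; case: (boolP (_ && _)) => // /andP[ld sl].
case/eqP: lk; apply: (sqf_part_uniq sl sm l0 k0).
by rewrite divnK.
Qed.

Lemma inv_sqr_sum34 (R : realType) (K : nat) : \sum_(2 <= k < K.+1) (k%:R ^+ 2)^-1 <= 3 / 4 :> R.
Proof.
have [K2|K2] := leqP 2 K; last by rewrite big_geq//; lra.
rewrite big_ltn//=.
have /andP[_ h] := zeta2_tail R (isT : (0 < 2)%N) K2.
by move: h; rewrite /zeta2 sumr_nat_diff// => h; lra.
Qed.

(** The density of the squarefree integers. *)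
Definition kappa (R : realType) : R := 6 / pi ^+ 2.

Lemma kappa_gt0 (R : realType) : 0 < kappa R.
Proof. by rewrite divr_gt0// exprn_gt0// pi_gt0. Qed.

Lemma kappa_le1 (R : realType) : kappa R <= 1.
Proof.
have p0 : 0 < (pi : R) ^+ 2 by rewrite exprn_gt0// pi_gt0.
rewrite /kappa ler_pdivrMr// mul1r.
by have /andP[h _] := basel R (isT : (0 < 1)%N); move: h; rewrite /zeta2 big_nat1 expr1n invr1; lra.
Qed.

Lemma kappa_zeta2 (R : realType) (K : nat) : (0 < K)%N -> 0 <= 1 - kappa R * zeta2 R K <= K%:R^-1.
Proof.
move=> K0; have /andP[h1 h2] := basel R K0; have k0 := kappa_gt0 R.
have p0 : 0 < (pi : R) ^+ 2 by rewrite exprn_gt0// pi_gt0.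
have -> : 1 - kappa R * zeta2 R K = kappa R * (pi ^+ 2 / 6 - zeta2 R K).
  by rewrite mulrBr /kappa; congr (_ - _); move: (pi ^+ 2 : R) p0 => y y0; field; rewrite gt_eqF.
rewrite mulr_ge0 ?(ltW k0)//=; apply: le_trans h2.
by rewrite -[leRHS]mul1r ler_wpM2r// kappa_le1.
Qed.

Definition sqf_err (R : realType) (n : nat) : R := (sqf_count n)%:R - kappa R * n%:R.

(** Subtract from [sqf_count_convolution] its main terms; the terms with [k > D] are bounded
    trivially. *)
Lemma sqf_err_rec (R : realType) (n D : nat) : (0 < D)%N ->
  `|sqf_err R n| <= \sum_(2 <= k < D.+1) `|sqf_err R (n %/ k ^ 2)| + n%:R / D%:R + D%:R.
Proof.
move=> D0; set K := maxn n D.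
have DK : (D <= K)%N by apply: leq_maxr.
have k0 := kappa_gt0 R.
have cv : \sum_(1 <= k < K.+1) (sqf_count (n %/ k ^ 2))%:R = n%:R :> R.
  by rewrite -natr_sum (sqf_count_convolution (leq_maxl n D)).
have div_le k : (0 < k)%N -> (n%:R : R) / k%:R ^+ 2 - 1 <= (n %/ k ^ 2)%:R <= (n%:R : R) / k%:R ^+ 2.
  move=> k0'; have k2 : 0 < (k%:R ^+ 2 : R) by rewrite exprn_gt0// ltr0n.
  rewrite lerBlDr ler_pdivrMr// ler_pdivlMr// -natrX natr1 -!natrM !ler_nat leq_trunc_div andbT.
  by rewrite ltnW// ltn_ceil// expn_gt0 k0'.
pose T : R := \sum_(D.+1 <= k < K.+1) (sqf_count (n %/ k ^ 2))%:R.
have T0 : 0 <= T by apply: sumr_ge0.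
have T1 : T <= n%:R / D%:R.
  have /andP[_ h] := zeta2_tail R D0 DK.
  apply: (@le_trans _ _ (n%:R * (zeta2 R K - zeta2 R D))); last by rewrite ler_wpM2l.
  rewrite /T /zeta2 sumr_nat_diff// mulr_sumr big_nat_cond [leRHS]big_nat_cond; apply: ler_sum => k /andP[/andP[Dk _] _].
  have k0' : (0 < k)%N by apply: leq_ltn_trans Dk.
  have /andP[_ h2] := div_le k k0'; apply: le_trans h2; rewrite ler_nat; exact: sqf_count_le.
pose r : R := \sum_(2 <= k < D.+1) (n%:R / k%:R ^+ 2 - (n %/ k ^ 2)%:R).
have r0 : 0 <= r.
  rewrite /r big_nat_cond; apply: sumr_ge0 => k /andP[/andP[k1 _] _].
  by have /andP[_ h] := div_le k (ltnW k1); rewrite subr_ge0.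
have r1 : r <= D%:R.
  apply: (@le_trans _ _ (\sum_(2 <= k < D.+1) 1)).
    rewrite /r big_nat_cond [leRHS]big_nat_cond; apply: ler_sum => k /andP[/andP[k1 _] _].
    by have /andP[h _] := div_le k (ltnW k1); rewrite lerBlDr addrC -lerBlDr.
  by rewrite sumr_const_nat ler_nat subSS leq_subr.
have kap := kappa_zeta2 R D0.
have z1 : zeta2 R D = 1 + \sum_(2 <= k < D.+1) (k%:R ^+ 2)^-1.
  by rewrite /zeta2 big_ltn// expr1n invr1.
pose SE : R := \sum_(2 <= k < D.+1) sqf_err R (n %/ k ^ 2).
have E1 : \sum_(2 <= k < D.+1) (sqf_count (n %/ k ^ 2))%:R = SE + kappa R * (n%:R * (zeta2 R D - 1) - r).
  have -> : n%:R * (zeta2 R D - 1) - r = \sum_(2 <= k < D.+1) (n %/ k ^ 2)%:R.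
    by rewrite z1 /r sumrB [1 + _]addrC addrK mulr_sumr opprB addrCA subrr addr0.
  rewrite mulr_sumr -big_split/=.
  by apply: eq_bigr => k _; rewrite /sqf_err subrK.
have E2 : n%:R = (sqf_count n)%:R + (SE + kappa R * (n%:R * (zeta2 R D - 1) - r)) + T.
  rewrite -E1 -[LHS]cv (@big_cat_nat _ _ _ D.+1)//=; congr (_ + _).
  by rewrite big_ltn//= exp1n divn1.
have E3 : sqf_err R n = n%:R * (1 - kappa R * zeta2 R D) - SE + kappa R * r - T.
  apply/eqP; rewrite -subr_eq0; apply/eqP.
  transitivity ((sqf_count n)%:R + (SE + kappa R * (n%:R * (zeta2 R D - 1) - r)) + T - n%:R).
    by rewrite /sqf_err; ring.
  by rewrite -E2 subrr.
have SE1 : `|SE| <= \sum_(2 <= k < D.+1) `|sqf_err R (n %/ k ^ 2)| by apply: ler_norm_sum.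
have /andP[kz0 kz1] := kap.
have b1 : 0 <= n%:R * (1 - kappa R * zeta2 R D) <= n%:R / D%:R.
  by rewrite mulr_ge0//= ler_wpM2l.
have b2 : 0 <= kappa R * r <= D%:R.
  rewrite mulr_ge0 ?(ltW k0)//=; apply: le_trans r1.
  by rewrite -[leRHS]mul1r ler_wpM2r// kappa_le1.
rewrite E3; move: b1 b2 SE1 T0 T1; move: (n%:R * _) (kappa R * r) (\sum_(2 <= k < D.+1) _) (n%:R / D%:R) => a b S c.
clear; move=> /andP[a0 a1] /andP[b0 b1] SE1 T0 T1.
move: SE1; rewrite !ler_norml => /andP[s0 s1]; apply/andP; split; lra.
Qed.

(** Strong induction with [D] about the sixteenth root of [n]. With [m] the integer part of [n /
    k ^ 2], for [k <= D] the logarithm of [m + 1] is at least 7 / 8 of that of [n + 1], the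
    inverse squares from 2 on sum to at most 3 / 4, and [8 / 7 * 3 / 4 < 1]. *)
Lemma sqf_err_le (R : realType) (n : nat) : `|sqf_err R n| * ln n.+1%:R <= 336 * n%:R.
Proof.
(* [336 = 7 * 48] with 48 from the error terms of [sqf_err_rec]; kept opaque, as side
   conditions would compute with it *)
have [B [B0 BE]] : exists B : R, 0 <= B /\ B = 336 by exists 336; split; [exact: ler0n|].
rewrite -BE; elim/ltn_ind: n => n IH.
have [->|n0] := posnP n; first by rewrite ln1 mulr0 mulr0.
have [D [D0 /andP[Dn nD]]] := @nat_root 16 n.+1 isT isT.
have D0' : 0 < (D%:R : R) by rewrite ltr0n.
have l0 := ln_nat_ge0 R n.+1.
have lD : ln n.+1%:R <= 16 * D%:R :> R.
  have h : ln n.+1%:R <= 16 * ln D.+1%:R :> R.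
    rewrite mulr_natl -lnXn ?ltr0n// -natrX ler_ln ?posrE ?ltr0n ?expn_gt0//.
    by rewrite ler_nat ltnW.
  apply: le_trans h _; rewrite ler_pM2l//; apply: le_trans (ln_le_pred R (ltn0Sn D)) _.
  by rewrite -natr1 addrK.
have DD : (D * D <= 2 * n)%N.
  apply: (@leq_trans (D ^ 16)%N); first by rewrite mulnn leq_pexp2l.
  by apply: leq_trans Dn _; rewrite mul2n -addnn -addn1 leq_add2l.
have term k : (1 < k)%N -> (k <= D)%N ->
    `|sqf_err R (n %/ k ^ 2)| * (7 * ln n.+1%:R) <= 8 * B * n%:R * (k%:R ^+ 2)^-1.
  move=> k1 kD; set m := (n %/ k ^ 2)%N.
  have k0 : (0 < k ^ 2)%N by rewrite expn_gt0 ltnW.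
  have mn : (m < n)%N by rewrite /m ltn_Pdiv// -(exp1n 2) ltn_sqr.
  have le7 : 7 * ln n.+1%:R <= 8 * ln m.+1%:R :> R.
    rewrite !mulr_natl -!lnXn ?ltr0n// -!natrX ler_ln ?posrE ?ltr0n ?expn_gt0//.
    rewrite ler_nat -(@leq_pmul2r n.+1)// -expnSr.
    apply: (@leq_trans ((m.+1 * k ^ 2) ^ 8)); first by rewrite leq_exp2r// ltn_ceil.
    rewrite expnMn leq_mul2l -expnM orbC (leq_trans _ Dn)//.
    by rewrite leq_exp2r.
  apply: (@le_trans _ _ (`|sqf_err R m| * (8 * ln m.+1%:R))); first by rewrite ler_wpM2l.
  rewrite mulrCA -2!mulrA ler_pM2l//; apply: le_trans (IH m mn) _.
  rewrite ler_wpM2l// ler_pdivlMr ?exprn_gt0 ?ltr0n ?(ltnW k1)//.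
  by rewrite -natrX -natrM ler_nat leq_trunc_div.
have S1 : (\sum_(2 <= k < D.+1) `|sqf_err R (n %/ k ^ 2)|) * (7 * ln n.+1%:R) <= 8 * B * n%:R * (3 / 4).
  apply: (@le_trans _ _ (8 * B * n%:R * \sum_(2 <= k < D.+1) (k%:R ^+ 2)^-1)); last first.
    by rewrite ler_wpM2l ?inv_sqr_sum34// !mulr_ge0.
  rewrite mulr_suml mulr_sumr big_nat_cond [leRHS]big_nat_cond; apply: ler_sum => k /andP[/andP[k1 kD] _].
  exact: term.
have h3 : n%:R / D%:R + D%:R <= 3 * (n%:R / D%:R) :> R.
  have : D%:R <= 2 * (n%:R / D%:R) :> R.
    by rewrite mulrA ler_pdivlMr// -!natrM ler_nat.
  by lra.
have h4 : 3 * (n%:R / D%:R) * ln n.+1%:R <= 48 * n%:R :> R.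
  apply: (@le_trans _ _ (3 * (n%:R / D%:R) * (16 * D%:R))).
    by rewrite ler_wpM2l// mulr_ge0// divr_ge0.
  by rewrite le_eqVlt; apply/orP; left; apply/eqP; field; rewrite gt_eqF.
have rec := sqf_err_rec R n D0.
have h5 := ler_wpM2r l0 rec; have h6 := ler_wpM2r l0 h3.
move: S1 h4 h5 h6; set S := \sum_(_ <= k < _) _.
move: `|sqf_err R n| (ln (n.+1%:R : R)) ((n%:R : R) / D%:R) (n%:R : R) (D%:R : R) => a l q y d.
by clear -BE; rewrite BE => h1 h2 h3 h4; lra.
Qed.

(** * Counting triples *)

Lemma squarefreeP (n : int) : n != 0 -> squarefree n <-> sqf `|n|.
Proof.
move=> n0; split.
  move=> h; apply/sqfP; split; first by rewrite absz_gt0.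
  move=> p; rewrite leqNgt; apply/negP => l2.
  have pp : prime p by apply: contraLR l2 => /negbTE np; rewrite lognE np.
  have pd : (p ^ 2 %| `|n|)%N by rewrite pfactor_dvdn// absz_gt0.
  have : (p%:Z \is a GRing.unit) by apply: h; rewrite dvdzE abszX.
  by rewrite -[_ \is a _]/((p%:Z == 1) || (p%:Z == -1)) orbF => /eqP[p1]; move: pp; rewrite p1.
move=> /sqfP[_ h] d; rewrite dvdzE abszX => dd.
suff d1 : `|d|%N = 1%N.
  by rewrite -[_ \is a _]/((d == 1) || (d == -1)); case: d d1 {dd} => [k|k] /=; case: k => [|[|k]].
apply/eqP; apply: contraTT dd => d1.
have [dz|dp] := posnP `|d|%N; first by rewrite dz dvd0n absz_eq0.
have [p pp pd] : exists2 p, prime p & (p %| `|d|)%N by exists (pdiv `|d|); rewrite ?pdiv_dvd// pdiv_prime// ltn_neqAle eq_sym d1.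
apply/negP => dd; have := h p; apply/negP; rewrite -ltnNge -pfactor_dvdn ?absz_gt0//.
by apply: dvdn_trans dd; rewrite dvdn_exp2r.
Qed.

Lemma normG_Y_points (a b : int) (c : nat) : normG a b c%:R -> Y_points a b c rat !=set0.
Proof.
move=> [n1 [n2 [n3 [[x [y ->]] [z [t ->]] [u [w ->]] e]]]].
by exists (x, y, z, t, u, w); rewrite /Y_points /= -e.
Qed.

Lemma card_fset_set_count (T : choiceType) (A Q : set T) (s : seq T) : uniq s ->
  (forall x, A x <-> x \in s) ->
  #|` fset_set [set x | A x /\ Q x]| = count (fun x => `[< Q x >]) s.
Proof.
move=> us As; rewrite (_ : [set x | A x /\ Q x] = [set` [fset x in [seq x <- s | `[< Q x >]]]%fset]).
  by rewrite set_fsetK card_fseq undup_id ?filter_uniq// size_filter.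
apply/seteqP; split=> x /=; rewrite inE mem_filter.
  by move=> [/As xs qx]; rewrite xs andbT; apply/asboolP.
by move=> /andP[/asboolP qx /As].
Qed.

Definition signed_sqf (n : nat) : seq int :=
  [seq i%:Z | i <- iota 1 n & sqf i] ++ [seq - i%:Z | i <- iota 1 n & sqf i].

Lemma signed_sqfP (n : nat) (a : int) : a \in signed_sqf n = sqf `|a| && (`|a| <= n)%N.
Proof.
have im k : (k \in [seq i <- iota 1 n | sqf i]) = sqf k && (k <= n)%N.
  rewrite mem_filter mem_iota add1n ltnS; case sk: (sqf k) => //=.
  by have [k0 _] := sqfP k sk; rewrite k0.
rewrite mem_cat -im; apply/orP/idP.
  by case=> /mapP[i i_in ->]; rewrite ?abszN.
move=> h; case: (leP 0 a) => a0; [left|right].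
  by apply/mapP; exists `|a|%N => //; rewrite gez0_abs.
by apply/mapP; exists `|a|%N => //; rewrite ltz0_abs// opprK.
Qed.

Lemma signed_sqf_uniq (n : nat) : uniq (signed_sqf n).
Proof.
rewrite cat_uniq !map_inj_uniq ?filter_uniq ?iota_uniq//=; try by [move=> i j []|move=> i j /oppr_inj []].
rewrite andbT; apply/hasPn => x /mapP[i]; rewrite mem_filter mem_iota => /and3P[_ i0 _] ->.
apply/negP => /mapP[j] _; case: i i0 => // i _ /eqP; by case: j.
Qed.

Lemma sum_signed_sqf (R : nmodType) (n : nat) (F : int -> R) :
  \sum_(a <- signed_sqf n) F a = \sum_(1 <= i < n.+1 | sqf i) F i%:Z + \sum_(1 <= i < n.+1 | sqf i) F (- i%:Z).
Proof. by rewrite big_cat/= !big_map !big_filter /index_iota subSS subn0. Qed.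

(** A list, so that the cardinals in question become values of [size] and [count]. *)
Definition sqf_triples (n : nat) : seq (int * int * int) :=
  [seq (ab, c) | ab <- [seq (a, b) | a <- signed_sqf n, b <- signed_sqf n],
                 c <- [seq i%:Z | i <- iota 1 n & sqf i]].

Lemma triples_leP (R : realType) (P : R) (x : int * int * int) : 0 <= P ->
  triples_le P x <-> x \in sqf_triples (Num.truncn P).
Proof.
move=> P0; case: x => [[a b] c].
have tr (k : int) : (`|k| <= Num.truncn P)%N = (`|k|%:~R <= P).
  by rewrite truncn_ge_nat// -abszE -pmulrn.
have mem_c : (c \in [seq i%:Z | i <- iota 1 (Num.truncn P) & sqf i]) = [&& 0 < c, sqf `|c| & (`|c| <= Num.truncn P)%N].
  apply/mapP/and3P.
    by move=> [i]; rewrite mem_filter mem_iota add1n ltnS => /and3P[si i0 iP] ->.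
  move=> [c0 sc cP]; exists `|c|%N; last by rewrite gtz0_abs.
  by rewrite mem_filter mem_iota sc add1n ltnS cP absz_gt0 gt_eqF.
have -> : ((a, b, c) \in sqf_triples (Num.truncn P)) =
    [&& a \in signed_sqf (Num.truncn P), b \in signed_sqf (Num.truncn P) &
        c \in [seq i%:Z | i <- iota 1 (Num.truncn P) & sqf i]].
  apply/allpairsP/and3P => [[[ab c'] [/allpairsP[[a' b'] [a'P b'P ->]] c'P /= [-> -> ->]]]|[aP bP cP]]//.
  by exists ((a, b), c); split=> //; apply/allpairsP; exists (a, b).
rewrite !signed_sqfP mem_c !tr; split.
  move=> [[[a0 b0 c0] [[sa sb sc] cpos]] /= mP].
  have le3 (k : int) : k <= Num.max (Num.max `|a| `|b|) c -> k%:~R <= P.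
    by move=> km; apply: le_trans mP; rewrite ler_int.
  move/(squarefreeP a0): sa => ->; move/(squarefreeP b0): sb => ->; move/(squarefreeP c0): sc => ->.
  by rewrite cpos /= !le3// ?(gtr0_norm cpos) !le_max lexx ?orbT.
move=> /and3P[/andP[sa aP] /andP[sb bP] /and3P[c0 sc cP]].
have nz (k : int) : sqf `|k| -> k != 0 by case/sqfP; rewrite absz_gt0.
split; last first.
  rewrite /= /Order.max; case: (_ < c); first by rewrite -(gtr0_norm c0).
  by case: (_ < _).
split; first by split; apply: nz.
by split=> //; split; apply/squarefreeP => //; apply: nz.
Qed.

Lemma sqf_triples_uniq (n : nat) : uniq (sqf_triples n).
Proof.
apply: allpairs_uniq; last by move=> [x1 x2] [y1 y2] _ _ /= [-> ->].
  by apply: allpairs_uniq; rewrite ?signed_sqf_uniq// => -[x1 x2] [y1 y2].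
by rewrite map_inj_uniq ?filter_uniq ?iota_uniq// => i j [].
Qed.

Lemma size_sqf (n : nat) : size [seq i <- iota 1 n | sqf i] = sqf_count n.
Proof.
by rewrite size_filter /sqf_count -sum1_count big_mkcond/= /index_iota subSS subn0; apply: eq_bigr => i _; case: (sqf i).
Qed.

Lemma card_triplesE (R : realType) (P : R) : 0 <= P ->
  card_triples P = (4 * sqf_count (Num.truncn P) ^ 3)%N.
Proof.
move=> P0; rewrite /card_triples.
rewrite (_ : triples_le P = [set x | triples_le P x /\ setT x]); last first.
  by apply/seteqP; split=> x //= [].
rewrite (card_fset_set_count setT (sqf_triples_uniq (Num.truncn P))); last by move=> x; apply: triples_leP.
rewrite (eq_count (a2 := predT)); last by move=> x; apply/asboolP.
by rewrite count_predT /sqf_triples !size_allpairs /signed_sqf size_cat !size_map size_sqf; ring.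
Qed.

Definition has_rat_point (x : int * int * int) : Prop := let: (a, b, c) := x in Y_points a b c rat !=set0.

Lemma N_globE (R : realType) (P : R) : 0 <= P ->
  N_glob P = count (fun x => `[< has_rat_point x >]) (sqf_triples (Num.truncn P)).
Proof.
move=> P0; rewrite /N_glob -(card_fset_set_count has_rat_point (sqf_triples_uniq (Num.truncn P)) (A := triples_le P)).
  by congr (#|` fset_set _|); apply/seteqP; split=> -[[a b] c].
by move=> x; apply: triples_leP.
Qed.

(** Otherwise one of the two orders of the pair satisfies the hypotheses of
    [normG_of_noncyclic_prime]. *)
Lemma rat_point_of_nonexceptional (R : realType) (a b : int) (c : nat) : sqf `|a| -> sqf `|b| -> (0 < c)%N ->
  ~~ exceptional a b -> has_rat_point (a, b, c%:Z).
Proof.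
move=> sa sb c0 nex; apply: normG_Y_points.
have ram u v : sqf `|u| -> sqf `|v| -> ramified u v -> normG u v c%:R.
  by move=> su sv [p [pp op pu pv lv]]; apply: (normG_of_noncyclic_prime R su sv pp op pu pv lv).
have [r|nr] := pselect (ramified a b); first exact: ram.
have [r|nr'] := pselect (ramified b a); first by apply: normG_sym; apply: ram.
by case/negP: nex; apply/asboolP.
Qed.

Lemma sum_sqf_le_sum2 (R : realType) (n : nat) (e f : int) :
  \sum_(1 <= i < n.+1 | sqf i) \sum_(1 <= j < n.+1 | sqf j) (exceptional (e * i%:Z) (f * j%:Z))%:R
  <= sum2 n.+1 (fun i j => (exceptional (e * i%:Z) (f * j%:Z))%:R) :> R.
Proof.
have le1 (F : nat -> R) : (forall i, 0 <= F i) ->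
    \sum_(1 <= i < n.+1 | sqf i) F i <= \sum_(0 <= i < n.+1) F i.
  move=> F0; rewrite [leRHS]big_ltn// -[leLHS]add0r; apply: lerD => //.
  by rewrite [leRHS](bigID sqf)/= lerDl; apply: sumr_ge0.
apply: le_trans (le1 _ _) _; first by move=> i; apply: sumr_ge0.
by apply: ler_sum => i _; apply: le1.
Qed.

Lemma pointless_le (R : realType) (n : nat) :
  (count (fun x => ~~ `[< has_rat_point x >]) (sqf_triples n))%:R <=
  \sum_(a <- signed_sqf n) \sum_(b <- signed_sqf n) (exceptional a b)%:R * (sqf_count n)%:R :> R.
Proof.
rewrite -sum1_count big_mkcond/= natr_sum /sqf_triples.
rewrite !big_allpairs.
rewrite big_seq [leRHS]big_seq; apply: ler_sum => a ain; rewrite big_seq [leRHS]big_seq; apply: ler_sum => b bin.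
have {ain} sa : sqf `|a| by move: ain; rewrite signed_sqfP => /andP[].
have {bin} sb : sqf `|b| by move: bin; rewrite signed_sqfP => /andP[].
have [ex|nex] := boolP (exceptional a b).
  rewrite mul1r -(size_sqf n) -(size_map Posz) -sum1_size natr_sum.
  by apply: ler_sum => c _; case: (~~ _).
rewrite mul0r big_seq big1// => c /mapP[k]; rewrite mem_filter mem_iota => /and3P[_ k0 _] ->.
by rewrite (_ : `[< has_rat_point _ >] = true)//; apply/asboolP; apply: (rat_point_of_nonexceptional R).
Qed.

(** The triples without a rational point lie over the exceptional pairs, for each of the four
    choices of signs. *)
Lemma pointless_bound (R : realType) : exists C : R, 0 < C /\ forall n : nat, (0 < n)%N ->
  (count (fun x => ~~ `[< has_rat_point x >]) (sqf_triples n))%:R * ln n.+1%:R <=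
  C * (n.+1%:R ^+ 2 * n%:R).
Proof.
have [C [C0 hC]] : exists C : R, 0 < C /\ forall (e f : int) (X : nat), is_sign e -> is_sign f -> (1 < X)%N ->
    sum2 X (fun i j => (exceptional (e * i%:Z) (f * j%:Z))%:R) * ln X%:R <= C * X%:R ^+ 2.
  by exists 3120; split=> [|e f X]; [rewrite ltr0n|apply: exceptional_count].
exists (4 * C); split=> [|n n0]; first exact: mulr_gt0.
have l0 : 0 <= ln n.+1%:R :> R by apply: ln_nat_ge0.
pose ex e f : R := sum2 n.+1 (fun i j => (exceptional (e * i%:Z) (f * j%:Z))%:R).
have exb e f : is_sign e -> is_sign f -> ex e f * ln n.+1%:R <= C * n.+1%:R ^+ 2.
  by move=> se sf; apply: hC.
apply: (@le_trans _ _ ((ex 1 1 + ex 1 (-1) + (ex (-1) 1 + ex (-1) (-1))) * n%:R * ln n.+1%:R)).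
  rewrite ler_wpM2r//; apply: le_trans (pointless_le R n) _.
  under eq_bigr do rewrite -mulr_suml.
  rewrite -mulr_suml; apply: ler_pM => //; last by rewrite ler_nat sqf_count_le.
    by apply: sumr_ge0 => a _; apply: sumr_ge0.
  rewrite sum_signed_sqf; under eq_bigr do rewrite sum_signed_sqf.
  under [X in _ + X <= _]eq_bigr do rewrite sum_signed_sqf.
  rewrite !big_split/=; apply: lerD; apply: lerD; apply: le_trans (sum_sqf_le_sum2 _ _ _ _);
  by apply: ler_sum => i _; apply: ler_sum => j _; rewrite ?mul1r ?mulN1r.
rewrite mulrAC.
have s1 : is_sign 1 by left.
have s2 : is_sign (-1) by right.
have := exb _ _ s1 s1; have := exb _ _ s1 s2; have := exb _ _ s2 s1; have := exb _ _ s2 s2.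
move=> h1 h2 h3 h4; rewrite [leRHS]mulrA; apply: ler_wpM2r => //.
move: h1 h2 h3 h4; move: (ex 1 1) (ex 1 (-1)) (ex (-1) 1) (ex (-1) (-1)) (n.+1%:R ^+ 2) (ln _) => x y z t u l.
by clear; move=> h1 h2 h3 h4; lra.
Qed.

Lemma ln_le_id (R : realType) (P : R) : 0 < P -> ln P <= P.
Proof.
move=> P0; have := @le_ln1Dx R (P - 1); rewrite addrCA subrr addr0 => h.
by apply: le_trans (h _) _; lra.
Qed.

Lemma truncn_approx (R : realType) (P : R) : 2 <= P ->
  [/\ (0 < Num.truncn P)%N, (Num.truncn P)%:R <= P, P <= (Num.truncn P).+1%:R,
      (Num.truncn P).+1%:R <= 2 * P & 0 < ln P <= ln (Num.truncn P).+1%:R].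
Proof.
move=> P2; have P0 : 0 <= P by lra.
have h1 : (Num.truncn P)%:R <= P by rewrite truncn_le.
have h2 : P < (Num.truncn P).+1%:R by apply: truncnS_gt.
split=> //; [by rewrite truncn_ge_nat//; lra|exact: ltW|by rewrite -natr1; lra|].
apply/andP; split; first by rewrite ln_gt0//; lra.
by rewrite ler_ln ?posrE//; [exact: ltW|lra].
Qed.

Lemma N_glob_card (R : realType) : exists C : R, 0 < C /\ forall P : R, 2 <= P ->
  `|(N_glob P)%:R - (card_triples P)%:R| <= C * (P ^+ 3 / ln P).
Proof.
have [C [C0 hC]] := pointless_bound R.
exists (4 * C); split=> [|P P2]; first exact: mulr_gt0.
have P0 : 0 <= P by lra.
have [n0 nP Pn nP2 /andP[l0 ln_le]] := truncn_approx P2.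
rewrite N_globE//; set n := Num.truncn P in n0 nP Pn nP2 ln_le *.
have -> : card_triples P = size (sqf_triples n).
  by rewrite card_triplesE// -/n /sqf_triples !size_allpairs /signed_sqf size_cat !size_map size_sqf; ring.
rewrite -(count_predC (fun x => `[< has_rat_point x >])) natrD opprD addrA subrr sub0r normrN ger0_norm//.
rewrite mulrA ler_pdivlMr//; apply: (@le_trans _ _ (C * (n.+1%:R ^+ 2 * n%:R))).
  by apply: le_trans (hC n n0); rewrite ler_wpM2l.
rewrite [leRHS](_ : _ = C * (4 * P ^+ 3)); last by ring.
rewrite ler_pM2l//.
apply: (@le_trans _ _ ((2 * P) ^+ 2 * P)).
  by apply: ler_pM => //; rewrite ?exprn_ge0// ler_sqr ?nnegrE// mulr_ge0.
by rewrite (_ : (2 * P) ^+ 2 * P = 4 * P ^+ 3)//; ring.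
Qed.

Lemma cube_diff_le (R : realFieldType) (x y P : R) : 0 <= x <= P -> 0 <= y <= P ->
  `|x ^+ 3 - y ^+ 3| <= 3 * P ^+ 2 * `|x - y|.
Proof.
move=> /andP[x0 xP] /andP[y0 yP].
have -> : x ^+ 3 - y ^+ 3 = (x ^+ 2 + x * y + y ^+ 2) * (x - y) by ring.
have s0 : 0 <= x ^+ 2 + x * y + y ^+ 2 by rewrite !addr_ge0 ?sqr_ge0// mulr_ge0.
rewrite normrM (ger0_norm s0) ler_wpM2r//.
have h1 : x ^+ 2 <= P ^+ 2 by rewrite ler_sqr ?nnegrE// (le_trans x0).
have h2 : y ^+ 2 <= P ^+ 2 by rewrite ler_sqr ?nnegrE// (le_trans y0).
have h3 : x * y <= P ^+ 2 by rewrite expr2 ler_pM.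
by lra.
Qed.

(** [864 / pi ^ 6] is [4 * (6 / pi ^ 2) ^ 3]; the error of the squarefree count enters through a
    difference of cubes. *)
Lemma card_asymp (R : realType) : exists C : R, 0 < C /\ forall P : R, 2 <= P ->
  `|(card_triples P)%:R - 864 / pi ^+ 6 * P ^+ 3| <= C * (P ^+ 3 / ln P).
Proof.
have [B [B0 hB]] : exists B : R, 0 < B /\ forall n, `|sqf_err R n| * ln n.+1%:R <= B * n%:R.
  by exists 336; split; [rewrite ltr0n|apply: sqf_err_le].
exists (12 * (B + 1)); split=> [|P P2]; first by rewrite mulr_gt0// addr_gt0.
have P0 : 0 < P by lra.
have [n0 nP Pn nP2 /andP[l0 ln_le]] := truncn_approx P2.
rewrite card_triplesE ?(ltW P0)//; set n := Num.truncn P in n0 nP Pn nP2 ln_le *.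
have k0 := kappa_gt0 R; have k1 := kappa_le1 R.
have -> : (4 * sqf_count n ^ 3)%:R - 864 / pi ^+ 6 * P ^+ 3 =
    4 * ((sqf_count n)%:R ^+ 3 - (kappa R * P) ^+ 3) :> R.
  rewrite natrM natrX /kappa; have := pi_gt0 R; move: (pi : R) => y y0; field.
  by rewrite gt_eqF.
have Q1 : `|(sqf_count n)%:R - kappa R * P| <= (B + 1) * (P / ln P).
  have e1 : `|sqf_err R n| <= B * (P / ln P).
    rewrite mulrA ler_pdivlMr//; apply: (@le_trans _ _ (B * n%:R)); last by rewrite ler_pM2l.
    by apply: le_trans (hB n); rewrite ler_wpM2l.
  have e2 : 1 <= P / ln P by rewrite ler_pdivlMr// mul1r ln_le_id.
  have -> : (sqf_count n)%:R - kappa R * P = sqf_err R n - kappa R * (P - n%:R) by rewrite /sqf_err; ring.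
  apply: le_trans (ler_normB _ _) _; rewrite mulrDl mul1r; apply: lerD => //.
  apply: le_trans e2; rewrite ger0_norm; last by rewrite mulr_ge0 ?(ltW k0)// subr_ge0.
  rewrite -[leRHS]mulr1; apply: ler_pM => //; rewrite ?(ltW k0) ?subr_ge0//.
  by move: Pn; rewrite -natr1; lra.
rewrite normrM ger0_norm//.
apply: (@le_trans _ _ (4 * (3 * P ^+ 2 * ((B + 1) * (P / ln P))))).
  rewrite ler_pM2l//; apply: le_trans (cube_diff_le (P := P) _ _) _.
  - by rewrite ler0n /=; apply: le_trans nP; rewrite ler_nat sqf_count_le.
  - by rewrite mulr_ge0 ?(ltW k0) ?(ltW P0)//= -[leRHS]mul1r ler_wpM2r// ltW.
  - by rewrite ler_wpM2l// mulr_ge0// sqr_ge0.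
by rewrite le_eqVlt; apply/orP; left; apply/eqP; move: (ln P) l0 => l l0; field; rewrite gt_eqF.
Qed.

Theorem mainTheorem2 (R : realType) :
  [/\ exists C : R, 0 < C /\ forall P : R, 2 <= P ->
        `|(N_glob P)%:R - (card_triples P)%:R| <= C * (P ^+ 3 / ln P),
      exists C : R, 0 < C /\ forall P : R, 2 <= P ->
        `|(N_glob P)%:R - 864 / pi ^+ 6 * P ^+ 3| <= C * (P ^+ 3 / ln P)
    & (fun P : R => (N_glob P)%:R / (card_triples P)%:R : R) @ +oo --> (1 : R)].
Proof.
have [C1 [C10 h1]] := N_glob_card R; have [C2 [C20 h2]] := card_asymp R.
split; first by exists C1.
  exists (C1 + C2); split=> [|P P2]; first exact: addr_gt0.
  rewrite [leRHS]mulrDl; apply: le_trans _ (lerD (h1 P P2) (h2 P P2)).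
  by apply: le_trans (ler_normD _ _); rewrite addrA subrK.
have [k [k0 kE]] : exists k : R, 0 < k /\ 864 / pi ^+ 6 = k.
  exists (4 * kappa R ^+ 3); split; first by rewrite mulr_gt0// exprn_gt0// kappa_gt0.
  by rewrite /kappa; have := pi_gt0 R; move: (pi : R) => y y0; field; rewrite gt_eqF.
apply/cvgrPdist_le => eps e0.
(* beyond [expR M] the count of triples exceeds half its main term and the error is at most [eps] of it *)
pose M : R := 2 * C2 / k + 2 * C1 / (k * eps).
near=> P.
have P2 : 2 <= P by near: P; apply: nbhs_pinfty_ge; rewrite num_real.
have PM : expR M <= P by near: P; apply: nbhs_pinfty_ge; rewrite num_real.
have P0 : 0 < P by lra.
have l0 : 0 < ln P by rewrite ln_gt0//; lra.
have lM : M <= ln P by rewrite -(expRK M) ler_ln ?posrE ?expR_gt0.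
have P3 : 0 < P ^+ 3 by rewrite exprn_gt0.
have u2 : C2 / ln P <= k / 2.
  rewrite ler_pdivrMr// -ler_pdivrMl ?divr_gt0//; apply: le_trans lM.
  rewrite [leLHS](_ : _ = 2 * C2 / k); last by field; rewrite gt_eqF.
  by rewrite lerDl divr_ge0 ?mulr_ge0 ?(ltW C10) ?(ltW k0) ?(ltW e0).
have u1 : C1 / ln P <= k / 2 * eps.
  rewrite ler_pdivrMr// -ler_pdivrMl ?mulr_gt0 ?divr_gt0//; apply: le_trans lM.
  rewrite [leLHS](_ : _ = 2 * C1 / (k * eps)); last by field; rewrite !gt_eqF.
  by rewrite lerDr divr_ge0 ?mulr_ge0 ?(ltW C20) ?(ltW k0).
have card_ge : k / 2 * P ^+ 3 <= (card_triples P)%:R.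
  have := h2 P P2; rewrite kE ler_norml => /andP[lo _].
  have : C2 * (P ^+ 3 / ln P) <= k / 2 * P ^+ 3.
    by rewrite mulrCA mulrA -[leLHS]mulrA [leRHS]mulrC ler_pM2l.
  by lra.
have c0 : 0 < ((card_triples P)%:R : R) by apply: lt_le_trans card_ge; rewrite mulr_gt0// divr_gt0.
have -> : 1 - (N_glob P)%:R / (card_triples P)%:R = - (((N_glob P)%:R - (card_triples P)%:R) / (card_triples P)%:R) :> R.
  by rewrite mulrBl divff ?gt_eqF// opprB.
rewrite normrN normrM normfV (gtr0_norm c0) ler_pdivrMr//.
apply: le_trans (h1 P P2) _; apply: (@le_trans _ _ (eps * (k / 2 * P ^+ 3))); last by rewrite ler_pM2l.
by rewrite mulrCA [leRHS]mulrA [leRHS]mulrC ler_pM2l// [leRHS]mulrC.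
Unshelve. all: by end_near.
Qed.
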